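(* Let $\alpha>0$ and let $\mu_\alpha$ be a holonomic discounted stationary Mather measure. Let $\pi:\mathbb{R}^n\times\Omega\to\Omega$ be the projection. Then there exists a function $V_\alpha:\Omega\to\mathbb{R}^n$ such that $$\operatorname{supp}\mu_\alpha=\{(v,\omega)\in\mathbb{R}^n\times\Omega:\ \omega\in\pi(\operatorname{supp}\mu_\alpha),\ v=V_\alpha(\omega)\}.$$ Furthermore, $V_\alpha$ is partially Lipschitz in the following sense: $$|V_\alpha(\tau_y\omega)-V_\alpha(\omega)|\le C|y|$$ for all $\omega\in\pi(\operatorname{supp}\mu_\alpha)$ and all $y\in\mathbb{R}^n$, where $C$ is uniformly bounded as $\alpha\to0$.
   Context: Setting. $(\Omega,d)$ is a compact metric space on which $\mathbb{R}^n$ acts continuously by $(x,\omega)\mapsto\tau_x\omega$, with $\tau_{x+y}\omega=\tau_x\tau_y\omega$, $\tau_0=\mathrm{Id}$. The action is uniformly transitive: for every $\varepsilon>0$ there is $M>0$ such that for all $\omega_1,\omega_2\in\Omega$ there is $z\in\mathbb{R}^n$ with $|z|<M$ and $d(\tau_z\omega_1,\omega_2)<\varepsilon$. The Lagrangian $L=L(x,v,\omega):\mathbb{R}^n\times\mathbb{R}^n\times\Omega\to\mathbb{R}$ is continuous, $C^3$ in $(x,v)$, strictly convex and superlinear in $v$, nonnegative, satisfies $L(x+y,v,\omega)-L(x,v,\omega)\le |y|(C+C\,L(x,v,\omega))$ for some constant $C$ and all $x,y,v,\omega$, and is stationary: $L(x+y,v,\omega)=L(x,v,\tau_y\omega)$.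 A function $\varphi:\mathbb{R}^n\times\Omega\to\mathbb{R}$ is stationary if $\varphi(x+y,\omega)=\varphi(x,\tau_y\omega)$ for all $x,y,\omega$. $C^1_s(\mathbb{R}^n\times\Omega)$ is the set of stationary $\varphi$ that are $C^1$ in $x$, continuous in $\omega$, and such that $\omega\mapsto D_x\varphi(0,\omega)$ is continuous. Discounted Mather measures. Given $\alpha>0$ and a probability measure $\nu$ on $\Omega$, a discounted stationary Mather measure with trace $\nu$ is a probability measure $\mu$ on $\mathbb{R}^n\times\Omega$ minimizing $\int L(0,v,\omega)\,d\mu(v,\omega)$ among probability measures satisfying $\int (v\cdot D_x\varphi(0,\omega)-\alpha\varphi(0,\omega))\,d\mu=-\alpha\int_\Omega\varphi(0,\omega)\,d\nu$ for all $\varphi\in C^1_s(\mathbb{R}^n\times\Omega)$. It is called holonomic if moreover $\int\varphi(0,\omega)\,d\mu(v,\omega)=\int_\Omega\varphi(0,\omega)\,d\nu(\omega)$ for all $\varphi\in C^1_s(\mathbb{R}^n\times\Omega)$.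
   Formalization: ''Strictly convex in v'' is taken as positive definite Hessian D²_vv L, and ''C³ in (x,v)'' as all (x,v)-derivatives up to order 3 being continuous jointly in (x,v,ω); with plain strict convexity the Lipschitz claim fails. *)

(* Defs.v *)
(* MathComp-Analysis *)
From HB Require Import structures.
From mathcomp Require Import all_boot all_order all_algebra.
From mathcomp Require Import all_classical all_reals all_analysis.

Set Implicit Arguments.
Unset Strict Implicit.
Unset Printing Implicit Defensive.

Import Order.TTheory GRing.Theory Num.Theory.
Import numFieldNormedType.Exports.

Local Open Scope classical_set_scope.
Local Open Scope ring_scope.

(* Metric spaces with a distinguished point: the library only builds
   generated sigma-algebras on pointed types.  The point plays no other
   role. *)
#[short(type="pmetricType")]
HB.structure Definition PointedMetric (K : numDomainType) :=
  {M of Metric K M & Pointed M}.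

(* Join missing from the library: binary products of pointed topological
   spaces, needed for the Borel sigma-algebra of a product. *)
HB.instance Definition _ (T1 T2 : ptopologicalType) :=
  Pointed.on (T1 * T2)%type.

Section Euclidean.
Variables (R : realType) (n : nat).

Definition dotv (u v : 'rV[R]_n) : R := \sum_i u 0 i * v 0 i.

(* The library norm on ['rV[R]_n] is the sup norm; it induces the same
   topology and the same derivatives. *)
Definition enorm (u : 'rV[R]_n) : R := Num.sqrt (dotv u u).

Definition grad (f : 'rV[R]_n -> R) (x : 'rV[R]_n) : 'rV[R]_n :=
  \row_i 'D_(delta_mx 0 i) f x.

End Euclidean.

(* [f z w] is of class C^k in [z], all the derivatives in [z] of order at
   most [k] being continuous functions of the pair [(z, w)]. *)
Fixpoint Ck_param (R : realType) (V : normedModType R) (W : topologicalType)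
    (k : nat) (f : V -> W -> R) : Prop :=
  continuous (fun p : V * W => f p.1 p.2) /\
  if k is k'.+1 then
    (forall w z, differentiable (f ^~ w) z) /\
    (forall u, Ck_param k' (fun z w => 'D_u (f ^~ w) z))
  else True.

Section Borel.
Variable R : realType.

Definition borel (T : ptopologicalType) := g_sigma_algebraType (@open T).

Definition msupport (T : ptopologicalType) (mu : probability (borel T) R) :
    set T :=
  [set z | forall U : set T, open U -> U z -> (0 < mu U)%E].

End Borel.

Section Setting.
Variables (R : realType) (n : nat) (Om : pmetricType R).
Variable tau : 'rV[R]_n -> Om -> Om.

Definition continuous_action : Prop :=
  [/\ continuous (fun p : 'rV[R]_n * Om => tau p.1 p.2),
      (forall x y w, tau (x + y) w = tau x (tau y w)) &
      (forall w, tau 0 w = w)].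

Definition uniformly_transitive : Prop :=
  forall eps : R, 0 < eps -> exists2 M : R, 0 < M &
    forall w1 w2 : Om, exists2 z : 'rV[R]_n,
      enorm z < M & mdist (tau z w1) w2 < eps.

Definition stationary (phi : 'rV[R]_n -> Om -> R) : Prop :=
  forall x y w, phi (x + y) w = phi x (tau y w).

Definition C1s (phi : 'rV[R]_n -> Om -> R) : Prop :=
  [/\ stationary phi,
      (forall w, (forall x, differentiable (phi ^~ w) x) /\
                 continuous (grad (phi ^~ w))),
      (forall x, continuous (phi x)) &
      continuous (fun w => grad (phi ^~ w) 0)].

Section Lagrangian.
Variable L : 'rV[R]_n -> 'rV[R]_n -> Om -> R.

(* Strict convexity in the sense of Tonelli Lagrangians: the Hessian
   D^2_vv L is positive definite, that is, <D^2_vv L u, u> > 0. *)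
Definition strictly_convex_v : Prop :=
  forall x v w u, u != 0 ->
    0 < 'D_u (fun v' => 'D_u (fun v'' => L x v'' w) v') v.

Definition superlinear_v : Prop :=
  forall x w (K : R), exists r : R,
    forall v, r <= enorm v -> K * enorm v <= L x v w.

Definition admissible_lagrangian : Prop :=
  [/\ Ck_param 3
        (fun (z : 'rV[R]_n * 'rV[R]_n) (w : Om) => L z.1 z.2 w),
      strictly_convex_v,
      superlinear_v &
      [/\ (forall x v w, 0 <= L x v w),
          (exists C : R, forall x y v w,
             L (x + y) v w - L x v w <= enorm y * (C + C * L x v w)) &
          (forall x y v w, L (x + y) v w = L x v (tau y w))]].

Definition action (mu : probability (borel ('rV[R]_n * Om)%type) R) : \bar R :=
  (\int[mu]_z (L 0 z.1 z.2)%:E)%E.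

End Lagrangian.

(* The integral is extended-real valued and equal to a finite number, so the
   integrand is required to be integrable. *)
Definition discounted_constraint (alpha : R) (nu : probability (borel Om) R)
    (mu : probability (borel ('rV[R]_n * Om)%type) R) : Prop :=
  forall phi, C1s phi ->
    (\int[mu]_z (dotv z.1 (grad (phi ^~ z.2) 0) - alpha * phi 0 z.2)%:E =
     (- alpha)%:E * \int[nu]_w (phi 0 w)%:E)%E.

Definition discounted_mather (L : 'rV[R]_n -> 'rV[R]_n -> Om -> R) (alpha : R)
    (nu : probability (borel Om) R)
    (mu : probability (borel ('rV[R]_n * Om)%type) R) : Prop :=
  discounted_constraint alpha nu mu /\
  forall mu', discounted_constraint alpha nu mu' ->
    (action L mu <= action L mu')%E.

Definition holonomic (nu : probability (borel Om) R)
    (mu : probability (borel ('rV[R]_n * Om)%type) R) : Prop :=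
  forall phi, C1s phi ->
    (\int[mu]_z (phi 0 z.2)%:E = \int[nu]_w (phi 0 w)%:E)%E.

End Setting.

(* Main.v *)
Require Import Defs.
From HB Require Import structures.
From mathcomp Require Import all_boot all_order all_algebra.
From mathcomp Require Import all_classical all_reals all_analysis.
From mathcomp Require Import measurable_realfun.
From mathcomp Require Import ring lra.

Set Implicit Arguments.
Unset Strict Implicit.
Unset Printing Implicit Defensive.

Import Order.TTheory GRing.Theory Num.Theory.
Import numFieldNormedType.Exports.

Local Open Scope classical_set_scope.
Local Open Scope ring_scope.

(** The support of the measure lies where a semiconcave subsolution of the
    discounted Hamilton-Jacobi equation is also semiconvex, and at such points
    the velocity is a Lipschitz function of the base point along the orbits.

    The subsolution is the discounted value function u, the infimum of the costs
    of piecewise linear paths.  Along the orbits it is Lipschitz and semiconcave,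
    with constants that serve every discount in (0, a] (value_lipschitz,
    value_semiconcave), and it satisfies alpha u - v.Du <= L(0, v, .) in
    integrated form (value_subsolution).  Finitely many almost optimal paths,
    each followed from the base points where it is the best of them, give
    occupation measures that obey the discounted constraint and have action at
    most alpha (int u dnu) + e (competitor).  A Mather measure mu therefore has
    action at most alpha (int u dnu).

    As u is not differentiable, it is replaced by phi(w), the supremum over z of
    u(tau_z w) - k |z|^2.  It inherits semiconcavity from u and is semiconvex as a
    supremum, hence has a quadratic Taylor expansion along the orbits
    (sup_convolution_expansion) with a continuous gradient P, and is an admissible
    test function.  It is within O(1/k) of u and is a subsolution up to O(1/k)
    (regularization).  The constraint and the holonomy of mu together say that
    v.P has mean zero for each such gradient P.  Consequently the defect
    L + v.P - alpha phi + O(1/k), which is nonnegative, has a mean of order 1/k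
    (mean_defect_le), and letting k tend to infinity gives pointwise information
    on the support (null_open_set):

    - velocities in the support are bounded (support_bounded);
    - comparing the velocities v and v - s h at the same base point bounds the
      increments of u from above (support_upper);
    - adding the subsolution inequalities at tau_h w and tau_(-h) w, with
      velocities v + (1 + alpha) h and v - (1 + alpha) h, bounds the second
      differences of u from below, up to a term v.Q where Q is the gradient of the
      second difference of phi.  This term has no sign, but multiplied by a function
      of that second difference it becomes v times an exact gradient, whose
      mean is zero; this is the device of Evans and Gomes (support_lower).

    At a point (v, w) of the support u thus agrees with an affine function of slope
    - D_v L(0, v, w) up to O(|h|^2) on both sides.  Comparing the expansions at w
    and at tau_y w shows that D_v L varies by O(|y|) between the two points, and
    the uniform convexity of L on bounded sets turns this into a bound on the
    velocities themselves (support_lipschitz).  In particular the velocity is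
    determined by the base point, and the McShane formula along the orbits extends
    it to a function V which is Lipschitz from the points of the projected support
    (lipschitz_graph). *)

(** * The Euclidean norm *)

Section EuclideanTheory.
Variables (R : realType) (n : nat).
Implicit Types (u v w : 'rV[R]_n) (a : R).

Lemma dotvC u v : dotv u v = dotv v u.
Proof. by apply: eq_bigr => i _; rewrite mulrC. Qed.

Lemma dotvDl u v w : dotv (u + v) w = dotv u w + dotv v w.
Proof.
by rewrite /dotv -big_split; apply: eq_bigr => i _; rewrite mxE mulrDl.
Qed.

Lemma dotvZl a u w : dotv (a *: u) w = a * dotv u w.
Proof. by rewrite /dotv big_distrr; apply: eq_bigr => i _; rewrite mxE /= mulrA. Qed.

Lemma dotvDr u v w : dotv w (u + v) = dotv w u + dotv w v.
Proof. by rewrite dotvC dotvDl !(dotvC w). Qed.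

Lemma dotvZr a u w : dotv w (a *: u) = a * dotv w u.
Proof. by rewrite dotvC dotvZl dotvC. Qed.

Lemma dotvNl u w : dotv (- u) w = - dotv u w.
Proof. by rewrite -scaleN1r dotvZl mulN1r. Qed.

Lemma dotvNr u w : dotv w (- u) = - dotv w u.
Proof. by rewrite dotvC dotvNl dotvC. Qed.

Lemma dotv0l w : dotv 0 w = 0.
Proof. by rewrite -(scale0r 0) dotvZl mul0r. Qed.

Lemma dotv0r w : dotv w 0 = 0.
Proof. by rewrite dotvC dotv0l. Qed.

Lemma dotvv_ge0 u : 0 <= dotv u u.
Proof. by apply: sumr_ge0 => i _; rewrite -expr2 sqr_ge0. Qed.

Lemma dotvv_eq0 u : (dotv u u == 0) = (u == 0).
Proof.
apply/eqP/eqP => [H|->]; last by rewrite dotv0l.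
apply/rowP => i; rewrite mxE.
have := @psumr_eq0P R 'I_n xpredT (fun i => u 0 i * u 0 i)
  (fun i _ => sqr_ge0 (u 0 i)) H i isT.
by move/eqP; rewrite mulf_eq0 orbb => /eqP.
Qed.

Lemma enorm_ge0 u : 0 <= enorm u.
Proof. exact: sqrtr_ge0. Qed.

Lemma sqr_enorm u : enorm u ^+ 2 = dotv u u.
Proof. by rewrite sqr_sqrtr ?dotvv_ge0. Qed.

Lemma enorm0 : enorm (0 : 'rV[R]_n) = 0.
Proof. by rewrite /enorm dotv0l sqrtr0. Qed.

Lemma enorm_eq0 u : (enorm u == 0) = (u == 0).
Proof. by rewrite -(sqrf_eq0 (enorm u)) sqr_enorm dotvv_eq0. Qed.

Lemma enormZ a u : enorm (a *: u) = `|a| * enorm u.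
Proof.
by rewrite /enorm dotvZl dotvZr mulrA -expr2 sqrtrM ?sqr_ge0// sqrtr_sqr.
Qed.

Lemma enormN u : enorm (- u) = enorm u.
Proof. by rewrite -scaleN1r enormZ normrN1 mul1r. Qed.

(** Cauchy-Schwarz: the square of the norm of |v|^2 u - <u, v> v equals
    |v|^2 (|u|^2 |v|^2 - <u, v>^2), so this quantity is nonnegative. *)
Lemma dotv_le_enorm u v : dotv u v <= enorm u * enorm v.
Proof.
have [->|v0] := eqVneq v 0; first by rewrite dotv0r enorm0 mulr0.
have vv : 0 < dotv v v by rewrite lt_def dotvv_eq0 v0 dotvv_ge0.
have := dotvv_ge0 (dotv v v *: u - dotv u v *: v).
rewrite dotvDl !dotvDr !dotvNl !dotvNr !dotvZl !dotvZr (dotvC v u) => H.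
have {H} : 0 <= dotv v v * (dotv u u * dotv v v - dotv u v ^+ 2).
  by apply: le_trans H _; lra.
rewrite pmulr_rge0// subr_ge0 => H.
rewrite -[leRHS]ger0_norm ?mulr_ge0 ?enorm_ge0//.
apply: le_trans (ler_norm _) _.
by rewrite -ler_sqr ?nnegrE// !real_normK ?num_real// exprMn !sqr_enorm.
Qed.

Lemma normr_dotv_le u v : `|dotv u v| <= enorm u * enorm v.
Proof.
rewrite ler_norml dotv_le_enorm andbT lerNl -dotvNl.
by apply: le_trans (dotv_le_enorm _ _) _; rewrite enormN.
Qed.

Lemma sqr_enormD u v : enorm (u + v) ^+ 2 = enorm u ^+ 2 + 2 * dotv u v + enorm v ^+ 2.
Proof. rewrite !sqr_enorm dotvDl !dotvDr (dotvC v u); lra. Qed.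

Lemma sqr_enormB u v : enorm (u - v) ^+ 2 = enorm u ^+ 2 - 2 * dotv u v + enorm v ^+ 2.
Proof. by rewrite sqr_enormD enormN dotvNr mulrN. Qed.

Lemma ler_enormD u v : enorm (u + v) <= enorm u + enorm v.
Proof.
rewrite -ler_sqr ?nnegrE ?addr_ge0 ?enorm_ge0// sqr_enormD sqrrD.
rewrite lerD2r lerD2l -[leRHS]mulr_natl ler_pM2l//; exact: dotv_le_enorm.
Qed.

Lemma ler_enormB u v : enorm (u - v) <= enorm u + enorm v.
Proof. by rewrite (le_trans (ler_enormD _ _))// enormN. Qed.

Lemma sqr_enormD_le u v : enorm (u + v) ^+ 2 <= 2 * (enorm u ^+ 2 + enorm v ^+ 2).
Proof.
rewrite sqr_enormD; have := sqr_ge0 (enorm (u - v)); rewrite sqr_enormB; lra.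
Qed.

Lemma normr_coord_le u i : `|u 0 i| <= enorm u.
Proof.
rewrite -ler_sqr ?nnegrE ?enorm_ge0// sqr_enorm real_normK ?num_real//.
rewrite /dotv (bigD1 i)//= -expr2 lerDl; apply: sumr_ge0 => j _.
by rewrite -expr2 sqr_ge0.
Qed.

Lemma enorm_le_sum u : enorm u <= \sum_i `|u 0 i|.
Proof.
rewrite -ler_sqr ?nnegrE ?enorm_ge0 ?sumr_ge0// sqr_enorm expr2 big_distrl /=.
apply: ler_sum => i _; rewrite (le_trans (ler_norm _))// normrM ler_wpM2l//.
by rewrite (bigD1 i)//= lerDl sumr_ge0.
Qed.

Lemma dotv_delta u i : dotv u (delta_mx 0 i) = u 0 i.
Proof.
rewrite /dotv (bigD1 i)//= big1 ?addr0 ?mxE ?eqxx ?mulr1// => j ji.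
by rewrite mxE (negbTE ji) andbF mulr0.
Qed.

Lemma enorm_delta i : enorm (delta_mx 0 i : 'rV[R]_n) = 1.
Proof. by rewrite /enorm dotv_delta mxE !eqxx sqrtr1. Qed.

Lemma continuous_bigsum (T : topologicalType) (I : Type) (r : seq I)
    (f : I -> T -> R) :
  (forall i, continuous (f i)) -> continuous (fun x => \sum_(i <- r) f i x).
Proof.
move=> cf; elim: r => [|i r IH] x.
  by under eq_fun do rewrite big_nil; exact: cst_continuous.
by under eq_fun do rewrite big_cons; apply: continuousD; [exact: cf|exact: IH].
Qed.

Lemma continuous_dotv (T : topologicalType) (f g : T -> 'rV[R]_n) :
  continuous f -> continuous g -> continuous (fun x => dotv (f x) (g x)).
Proof.
move=> cf cg; apply: continuous_bigsum => i x.
apply: continuousM.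
  exact: continuous_comp (cf x) (@coord_continuous _ _ _ 0 i _).
exact: continuous_comp (cg x) (@coord_continuous _ _ _ 0 i _).
Qed.

Lemma continuous_enorm : continuous (@enorm R n).
Proof.
move=> x; apply: (@continuous_comp _ _ _ (fun u => dotv u u) Num.sqrt).
  by apply: continuous_dotv => ?; exact: cvg_id.
exact: sqrt_continuous.
Qed.

Lemma mx_norm_le_enorm u : `|u| <= enorm u.
Proof.
rewrite [leLHS]/Num.Def.normr /= mx_normrE; apply: bigmax_le; first exact: enorm_ge0.
by move=> [i j] _ /=; rewrite (ord1 i) normr_coord_le.
Qed.

Lemma enorm_le_mx_norm u : enorm u <= n%:R * `|u|.
Proof.
apply: le_trans (enorm_le_sum u) _.
have -> : n%:R * `|u| = \sum_(i < n) `|u|.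
  by rewrite sumr_const card_ord mulr_natl.
apply: ler_sum => i _.
rewrite [leRHS]/Num.Def.normr /= mx_normrE.
exact: (le_bigmax _ (fun x : 'I_1 * 'I_n => `|u x.1 x.2|) (0, i)).
Qed.

Lemma compact_eball r : compact [set u : 'rV[R]_n | enorm u <= r].
Proof.
apply: bounded_closed_compact.
  exists r; split; first exact: num_real.
  move=> x rx u /= ur; apply: le_trans (mx_norm_le_enorm u) _.
  exact: le_trans ur (ltW rx).
apply: (@closed_comp _ _ (@enorm R n) [set x | x <= r]).
  by move=> x _; exact: continuous_enorm.
exact: closed_le.
Qed.

Lemma compact_esphere r : compact [set u : 'rV[R]_n | enorm u = r].
Proof.
apply: (@subclosed_compact _ _ [set u : 'rV[R]_n | enorm u <= r]).
- apply: (@closed_comp _ _ (@enorm R n) [set x | x = r]).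
    by move=> x _; exact: continuous_enorm.
  exact: closed_eq.
- exact: compact_eball.
- by move=> u /= ->.
Qed.

End EuclideanTheory.

(** * Derivatives along lines and in products *)

Section LineCalculus.
Variables (R : realType) (V : normedModType R).
Implicit Types (f : V -> R) (z p q : V).

Lemma is_derive_line f z p (s : R) : differentiable f (z + s *: p) ->
  is_derive s (1 : R) (fun s => f (z + s *: p)) ('D_p f (z + s *: p)).
Proof.
move=> df.
have E : (fun h : R => h^-1 *: (f (z + (h *: 1 + s) *: p) - f (z + s *: p))) =
    (fun h : R => h^-1 *: (f (h *: p + (z + s *: p)) - f (z + s *: p))).
  apply/funext => h; congr (_ *: (f _ - _)).
  by rewrite scalerDl [h *: 1]mulr1 addrCA.
have D := @diff_derivable _ _ _ f (z + s *: p) p df.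
by apply: DeriveDef; rewrite /derivable /derive /= E.
Qed.

Lemma MVT_line f z p (a b : R) : a < b ->
  (forall z, differentiable f z) ->
  exists2 c, a < c < b &
    f (z + b *: p) - f (z + a *: p) = 'D_p f (z + c *: p) * (b - a).
Proof.
move=> ab df.
have dl s : is_derive s (1 : R) (fun s => f (z + s *: p)) ('D_p f (z + s *: p)).
  exact: is_derive_line.
have [|c] := @MVT R (fun s => f (z + s *: p))
    (fun s => 'D_p f (z + s *: p)) a b ab (fun x _ => dl x).
  by apply: derivable_within_continuous => x _; apply: ex_derive.
by rewrite in_itv /=; exists c.
Qed.

Lemma MVT_line01 f z p : (forall z, differentiable f z) ->
  exists2 c, 0 < c < 1 & f (z + p) - f z = 'D_p f (z + c *: p).
Proof.
move=> df; have [c c01] := @MVT_line f z p 0 1 ltr01 df.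
by rewrite scale0r scale1r addr0 subr0 mulr1; exists c.
Qed.

(** The second difference is an increment over [0, 1] of
    s |-> f (z + s p) - f (z - p + s p), whose derivative is again an increment. *)
Lemma second_difference_le f z p (M : R) :
  (forall z, differentiable f z) ->
  (forall z, differentiable ('D_p f) z) ->
  (forall s, `|s| <= 1 -> 'D_p ('D_p f) (z + s *: p) <= M) ->
  f (z + p) + f (z - p) - 2 * f z <= M.
Proof.
move=> df ddf bM.
pose m (s : R) := f (z + s *: p) - f (z - p + s *: p).
have dm s : is_derive s (1 : R) m ('D_p f (z + s *: p) - 'D_p f (z - p + s *: p)).
  by apply: is_deriveB; exact: is_derive_line.
have [|c c01] := @MVT R m
    (fun s => 'D_p f (z + s *: p) - 'D_p f (z - p + s *: p)) 0 1 ltr01 (fun x _ => dm x).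
  by apply: derivable_within_continuous => x _; apply: ex_derive.
rewrite in_itv /= in c01; case/andP: c01 => c0 c1.
rewrite /m subr0 mulr1 !scale1r !scale0r !addr0 subrK.
have -> : z - p + c *: p = z + (c - 1) *: p.
  by rewrite scalerBl scale1r -addrA [- p + _]addrC.
have c1c : c - 1 < c by rewrite gtrBl.
have [d /andP[d1 d2]] := @MVT_line ('D_p f) z p (c - 1) c c1c ddf.
move=> -> H.
have -> : f (z + p) + f (z - p) - 2 * f z = f (z + p) - f z - (f z - f (z - p)) by lra.
rewrite H opprB addrCA subrr addr0 mulr1; apply: bM.
by rewrite ler_norml; apply/andP; split; lra.
Qed.

Lemma convex_extrapolation f z p (r : R) :
  (forall z, differentiable f z) ->
  (forall z, differentiable ('D_p f) z) ->
  (forall z, 0 <= 'D_p ('D_p f) z) ->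
  1 <= r -> f z + r * (f (z + p) - f z) <= f (z + r *: p).
Proof.
move=> df ddf ge0; rewrite le_eqVlt => /predU1P[<-|r1].
  by rewrite mul1r scale1r addrC subrK.
have [c /andP[c0 c1] H0] := @MVT_line01 f z p df.
have [d /andP[d1 dr]] := @MVT_line f z p 1 r r1 df.
rewrite scale1r => H1.
have [e _ He] := @MVT_line ('D_p f) z p c d (lt_trans c1 d1) ddf.
have : 'D_p f (z + c *: p) <= 'D_p f (z + d *: p).
  by rewrite -subr_ge0 He mulr_ge0// subr_ge0 ltW// (lt_trans c1).
have r1' : 0 <= r - 1 by lra.
move/(ler_wpM2r r1'); rewrite -H0 -H1; lra.
Qed.

Lemma derive2Z f p (a : R) z : (forall z, differentiable f z) ->
  (forall z, differentiable ('D_p f) z) ->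
  'D_(a *: p) ('D_(a *: p) f) z = a ^+ 2 * 'D_p ('D_p f) z.
Proof.
move=> df ddf.
have -> : 'D_(a *: p) f = a \*: 'D_p f.
  by apply/funext => y /=; rewrite (deriveE _ (df y)) (deriveE p (df y)) linearZ.
rewrite deriveZ; last exact: diff_derivable.
by rewrite (deriveE (a *: p) (ddf z)) (deriveE p (ddf z)) linearZ /= [LHS]mulrA -expr2.
Qed.

End LineCalculus.

Section SecondDerivative.
Variables (R : realType) (V : normedModType R) (I : finType).
Variables (b : I -> V) (c : I -> V -> R).
Hypothesis span : forall z, z = \sum_i c i z *: b i.

Lemma derive_lin (f : V -> R) z p : differentiable f z ->
  'D_p f z = \sum_i c i p * 'D_(b i) f z.
Proof.
move=> df; rewrite deriveE// [in LHS](span p) linear_sum; apply: eq_bigr => i _.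
by rewrite linearZ/= deriveE.
Qed.

Lemma derive_bigsum (J : Type) (r : seq J) (a : J -> R) (f : J -> V -> R) z p :
  (forall j, differentiable (f j) z) ->
  differentiable (fun z => \sum_(j <- r) a j * f j z) z /\
  'D_p (fun z => \sum_(j <- r) a j * f j z) z = \sum_(j <- r) a j * 'D_p (f j) z.
Proof.
move=> df; elim: r => [|j r [IH1 IH2]].
  under eq_fun do rewrite big_nil.
  by rewrite big_nil derive_cst; split => //; exact: differentiable_cst.
have E : (fun z => \sum_(k <- j :: r) a k * f k z) =
   (a j \*: f j) + (fun z => \sum_(k <- r) a k * f k z).
  by apply/funext => y; rewrite big_cons.
have dj : differentiable (a j \*: f j) z by exact: differentiableZ.
rewrite E; split; first exact: differentiableD.
rewrite deriveD ?deriveZ ?IH2 ?big_cons//; try exact: diff_derivable.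
Qed.

(** Controls second derivatives in all directions, uniformly in the point, by
    those in finitely many directions. *)
Lemma derive2_lin (f : V -> R) z p q :
  (forall z, differentiable f z) ->
  (forall i z, differentiable ('D_(b i) f) z) ->
  'D_q ('D_p f) z = \sum_i \sum_j c i p * c j q * 'D_(b j) ('D_(b i) f) z.
Proof.
move=> df ddf.
have -> : 'D_p f = (fun z => \sum_i c i p * 'D_(b i) f z).
  by apply/funext => y; exact: derive_lin.
have [_ ->] := @derive_bigsum I (index_enum I) (c^~ p) (fun i => 'D_(b i) f) z q
  (fun i => ddf i z).
apply: eq_bigr => i _; rewrite (derive_lin _ (ddf i z)) big_distrr /=.
by apply: eq_bigr => j _; rewrite mulrA.
Qed.

End SecondDerivative.

Section ProductBasis.
Variables (R : realType) (n : nat).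
Local Notation E := 'rV[R]_n.

Definition pair_basis (k : ('I_n + 'I_n)%type) : (E * E)%type :=
  match k with inl i => (delta_mx 0 i, 0) | inr i => (0, delta_mx 0 i) end.

(** Coordinates in [pair_basis]; the space of positions and velocities carries
    no matrix structure of its own. *)
Definition pair_coord (k : ('I_n + 'I_n)%type) (z : (E * E)%type) : R :=
  match k with inl i => z.1 0 i | inr i => z.2 0 i end.

Lemma pair_basis_span z : z = \sum_k pair_coord k z *: pair_basis k.
Proof.
rewrite big_sumType /=.
have -> : \sum_i z.1 0 i *: ((delta_mx 0 i, 0) : (E * E)%type) = (z.1, 0).
  rewrite [in RHS](row_sum_delta z.1).
  elim/big_rec2 : _ => // i y x _ ->; apply/pair_equal_spec; split => //=.
  by rewrite scaler0 addr0.
have -> : \sum_i z.2 0 i *: ((0, delta_mx 0 i) : (E * E)%type) = (0, z.2).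
  rewrite [in RHS](row_sum_delta z.2).
  elim/big_rec2 : _ => // i y x _ ->; apply/pair_equal_spec; split => //=.
  by rewrite scaler0 addr0.
by case: z => x v; apply/pair_equal_spec; rewrite /= addr0 add0r.
Qed.

Lemma pair_coord_le k z : `|pair_coord k z| <= enorm z.1 + enorm z.2.
Proof.
case: k => i /=.
  by rewrite (le_trans (normr_coord_le _ _))// lerDl enorm_ge0.
by rewrite (le_trans (normr_coord_le _ _))// lerDr enorm_ge0.
Qed.

Lemma derive_snd (f : E * E -> R) x v u :
  'D_u (fun v' => f (x, v')) v = 'D_(0, u) f (x, v).
Proof.
have E : (fun h : R => h^-1 *: (f (x, h *: u + v) - f (x, v))) =
    (fun h : R => h^-1 *: (f (h *: ((0, u) : E * E) + (x, v)) - f (x, v))).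
  apply/funext => h; congr (_ *: (f _ - _)).
  by apply/pair_equal_spec; rewrite /= scaler0 add0r.
by rewrite /derive /= E.
Qed.

End ProductBasis.

(** * The Lagrangian over a compact space *)

Section Continuity.
Variables (T U W : topologicalType).

Lemma continuous_compose (f : T -> U) (g : U -> W) :
  continuous f -> continuous g -> continuous (fun x => g (f x)).
Proof. by move=> cf cg x; exact: continuous_comp (cf x) (cg _). Qed.

Lemma continuous_pair (f : T -> U) (g : T -> W) :
  continuous f -> continuous g -> continuous (fun x => (f x, g x)).
Proof. by move=> cf cg x; apply: cvg_pair; [exact: cf|exact: cg]. Qed.

Lemma continuous_fst : continuous (fun x : T * U => x.1).
Proof. by move=> x; exact: cvg_fst. Qed.

Lemma continuous_snd : continuous (fun x : T * U => x.2).
Proof. by move=> x; exact: cvg_snd. Qed.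

Lemma continuous_cst (a : U) : continuous (fun _ : T => a).
Proof. by move=> x; exact: cvg_cst. Qed.

End Continuity.

Section RealContinuity.
Variables (R : realType) (T : topologicalType).
Implicit Types f g : T -> R.

Lemma continuous_add f g :
  continuous f -> continuous g -> continuous (fun x => f x + g x).
Proof. by move=> cf cg x; exact: cvgD (cf x) (cg x). Qed.

Lemma continuous_sub f g :
  continuous f -> continuous g -> continuous (fun x => f x - g x).
Proof. by move=> cf cg x; exact: cvgB (cf x) (cg x). Qed.

Lemma continuous_mul f g :
  continuous f -> continuous g -> continuous (fun x => f x * g x).
Proof. by move=> cf cg x; exact: cvgM (cf x) (cg x). Qed.

End RealContinuity.

Section CompactBound.
Variable R : realType.

Lemma compact_continuous_bounded (T : topologicalType) (f : T -> R) (A : set T) :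
  compact A -> continuous f ->
  exists2 M : R, 0 <= M & forall x, A x -> `|f x| <= M.
Proof.
move=> cA cf.
have cfA : compact (f @` A).
  by apply: continuous_compact => //; exact: continuous_subspaceT.
have /ex_strict_bound_gt0[k k0 /= bk] := compact_bounded cfA.
by exists k => [|x Ax]; [exact: ltW | apply: ltW; apply: bk; exists x].
Qed.

End CompactBound.

Section Lagrangian.
Variables (R : realType) (n : nat) (Om : pmetricType R).
Variable tau : 'rV[R]_n -> Om -> Om.
Variable L : 'rV[R]_n -> 'rV[R]_n -> Om -> R.
Hypothesis cO : compact [set: Om].
Hypothesis tauP : continuous_action tau.
Hypothesis LP : admissible_lagrangian tau L.
Local Notation E := 'rV[R]_n.

Let G (w : Om) (z : E * E) := L z.1 z.2 w.

Lemma continuous_lagrangian : continuous (fun p : (E * E) * Om => L p.1.1 p.1.2 p.2).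
Proof. by case: LP => [[cL _] _ _ _]. Qed.

Lemma continuous_lagrangian0 : continuous (fun p : E * Om => L 0 p.1 p.2).
Proof.
have cf : continuous (fun p : E * Om => ((0, p.1), p.2) : (E * E) * Om).
  apply: continuous_pair; last exact: continuous_snd.
  by apply: continuous_pair; [exact: continuous_cst|exact: continuous_fst].
exact: (continuous_compose cf continuous_lagrangian).
Qed.

Let dG w z : differentiable (G w) z.
Proof. by case: LP => [[_ [dL _]] _ _ _]; exact: dL. Qed.

Let ddG w p z : differentiable ('D_p (G w)) z.
Proof. by case: LP => [[_ [_ /(_ p) [_ [ddL _]]]] _ _ _]; exact: ddL. Qed.

Let cddG p q : continuous (fun x : (E * E) * Om => 'D_q ('D_p (G x.2)) x.1).
Proof. by case: LP => [[_ [_ /(_ p) [_ [_ /(_ q) [cddL _]]]]] _ _ _]; exact: cddL. Qed.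

Let DDE w p q z :
  'D_q ('D_p (G w)) z = \sum_i \sum_j pair_coord i p * pair_coord j q *
     'D_(pair_basis R j) ('D_(pair_basis R i) (G w)) z.
Proof. exact: derive2_lin (@pair_basis_span R n) _ _ _ _ _ _. Qed.

Let DD_gt0 w u z : u != 0 -> 0 < 'D_(0, u) ('D_(0, u) (G w)) z.
Proof.
case: z => x v u0; case: LP => [_ /(_ x v w u u0) + _ _].
have -> : (fun v' => 'D_u (fun v'' => L x v'' w) v') =
  (fun v' => 'D_(0, u) (G w) (x, v')).
  by apply/funext => v'; rewrite (derive_snd (G w)).
by rewrite (derive_snd ('D_(0, u) (G w))).
Qed.

Lemma lagrangian_stationary x v w : L x v w = L 0 v (tau x w).
Proof. by case: LP => [_ _ _ [_ _ /(_ 0 x v w)]]; rewrite add0r. Qed.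

Lemma lagrangian_ge0 x v w : 0 <= L x v w.
Proof. by case: LP => [_ _ _ [+ _ _]]; apply. Qed.

Lemma lagrangian_bounded r :
  exists2 M : R, 0 <= M & forall v w, enorm v <= r -> L 0 v w <= M.
Proof.
have cK : compact ([set u : E | enorm u <= r] `*` [set: Om]).
  by apply: compact_setX => //; exact: compact_eball.
have [M M0 bM] := compact_continuous_bounded cK continuous_lagrangian0.
by exists M => // v w vr; apply: le_trans (ler_norm _) (bM (v, w) _).
Qed.

(** Each second derivative along basis directions is continuous, hence bounded on
    a compact set of positions, velocities and base points. *)
Lemma hessian_bounded r : exists2 C : R, 0 <= C &
  forall w (p q z : E * E), enorm z.1 <= r -> enorm z.2 <= r ->
  `|'D_q ('D_p (G w)) z| <=
     C * (enorm p.1 + enorm p.2) * (enorm q.1 + enorm q.2).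
Proof.
have cK : compact (([set u : E | enorm u <= r] `*` [set u : E | enorm u <= r]) `*` [set: Om]).
  by apply: compact_setX => //; apply: compact_setX; exact: compact_eball.
pose M i j (x : (E * E) * Om) := 'D_(pair_basis R j) ('D_(pair_basis R i) (G x.2)) x.1.
have cM : continuous (fun x => \sum_i \sum_j `|M i j x|).
  apply: continuous_bigsum => i; apply: continuous_bigsum => j x.
  by apply: continuous_comp; [exact: cddG|exact: norm_continuous].
have [C C0 bC] := compact_continuous_bounded cK cM.
exists C => // w p q z z1 z2; rewrite DDE.
apply: le_trans (ler_norm_sum _ _ _) _.
apply: (@le_trans _ _ (\sum_i \sum_j `|M i j (z, w)| *
   ((enorm p.1 + enorm p.2) * (enorm q.1 + enorm q.2)))).
  apply: ler_sum => i _; apply: le_trans (ler_norm_sum _ _ _) _.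
  apply: ler_sum => j _; rewrite !normrM mulrC ler_wpM2l//.
  by apply: ler_pM => //; exact: pair_coord_le.
under eq_bigr do rewrite -big_distrl.
rewrite -big_distrl /= -mulrA ler_wpM2r//.
  by rewrite mulr_ge0// addr_ge0// enorm_ge0.
exact: le_trans (ler_norm _) (bC (z, w) _).
Qed.

(** By stationarity the translation of the base point by h is a displacement of
    the position, so the left-hand side is a second difference of L in the
    direction (h, xi). *)
Lemma lagrangian_second_difference r : exists2 C : R, 0 <= C &
  forall v h xi w, enorm v <= r -> enorm h <= r -> enorm xi <= r ->
  L 0 (v + xi) (tau h w) + L 0 (v - xi) (tau (- h) w) - 2 * L 0 v w <=
    C * (enorm h ^+ 2 + enorm xi ^+ 2).
Proof.
have [C C0 HC] := hessian_bounded (2 * r).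
exists (2 * C); first by rewrite mulr_ge0.
move=> v h xi w vr hr xr.
have r0 : 0 <= r by exact: le_trans (enorm_ge0 _) vr.
rewrite -!lagrangian_stationary.
have -> : L 0 v w = G w (0, v) by [].
have -> : L h (v + xi) w = G w ((0, v) + (h, xi)) by rewrite /G /= add0r.
have -> : L (- h) (v - xi) w = G w ((0, v) - (h, xi)) by rewrite /G /= add0r.
apply: second_difference_le => // s s1.
apply: le_trans (ler_norm _) _; apply: le_trans (HC _ _ _ _ _ _) _ => /=.
- rewrite add0r enormZ.
  by rewrite (le_trans (ler_wpM2r (enorm_ge0 _) s1))// mul1r; lra.
- rewrite (le_trans (ler_enormD _ _))// enormZ.
  by have := ler_wpM2r (enorm_ge0 xi) s1; rewrite mul1r; lra.
have /= := mulr_ge0 C0 (sqr_ge0 (enorm h - enorm xi)); lra.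
Qed.

Lemma derivable_lagrangian v u w : derivable (fun v => L 0 v w) v u.
Proof.
have E1 : (fun h : R => h^-1 *: (L 0 (h *: u + v) w - L 0 v w)) =
    (fun h : R => h^-1 *: (G w (h *: ((0, u) : E * E) + (0, v)) - G w (0, v))).
  by apply/funext => h; rewrite /G /= scaler0 add0r.
rewrite /derivable /= E1; exact: (@diff_derivable _ _ _ (G w) (0, v) (0, u)).
Qed.

Lemma derive_lagrangian_linear v w (a : R) (p q : E) :
  'D_(a *: p + q) (fun v => L 0 v w) v =
  a * 'D_p (fun v => L 0 v w) v + 'D_q (fun v => L 0 v w) v.
Proof.
have H u : 'D_u (fun v => L 0 v w) v = 'd (G w) (0, v) (0, u).
  by rewrite (derive_snd (G w)) deriveE.
rewrite !H; have -> : (0, a *: p + q) = a *: (0, p) + (0, q) :> E * E.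
  by apply/pair_equal_spec; rewrite /= scaler0 add0r.
by rewrite linearP.
Qed.

(** Again a displacement y of the base point is a displacement of the position,
    and the mixed second derivatives of L are bounded. *)
Lemma derive_lagrangian_lipschitz r : exists2 C : R, 0 <= C &
  forall v y u w, enorm v <= r -> enorm y <= r ->
  `|'D_u (fun v => L 0 v (tau y w)) v - 'D_u (fun v => L 0 v w) v| <=
    C * enorm y * enorm u.
Proof.
have [C C0 HC] := hessian_bounded r; exists C => // v y u w vr yr.
have -> : (fun v => L 0 v (tau y w)) = (fun v => G w (y, v)).
  by apply/funext => v'; rewrite -lagrangian_stationary.
rewrite (derive_snd (G w)) (derive_snd (G w)).
have [c /andP[c0 c1]] := @MVT_line01 _ _ ('D_(0, u) (G w)) (0, v) (y, 0)
  (ddG w (0, u)).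
have -> : (0, v) + (y, 0) = (y, v) :> E * E.
  by apply/pair_equal_spec; rewrite /= add0r addr0.
move=> ->; apply: le_trans (HC _ _ _ _ _ _) _ => /=.
- rewrite add0r enormZ ger0_norm; last exact: ltW.
  apply: le_trans yr; rewrite ler_piMl ?enorm_ge0//; exact: ltW.
- by rewrite scaler0 addr0.
by rewrite enorm0 addr0 add0r mulrAC.
Qed.

(** Strict convexity is uniform on compact sets: the second derivative along unit
    directions attains a positive minimum. *)
Lemma derive_lagrangian_monotone r : exists2 g : R, 0 < g &
  forall v1 v2 w, enorm v1 <= r -> enorm v2 <= r ->
  g * enorm (v1 - v2) ^+ 2 <=
   'D_(v1 - v2) (fun v => L 0 v w) v1 - 'D_(v1 - v2) (fun v => L 0 v w) v2.
Proof.
pose S := [set u : E | enorm u = 1].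
pose K := S `*` ([set u : E | enorm u <= r] `*` [set: Om]).
have triv v w : 'D_(0 : E) (fun v => L 0 v w) v = 0.
  by rewrite (derive_snd (G w)) deriveE ?linear0.
have [K0|K0] := pselect (K !=set0); last first.
  exists 1 => // v1 v2 w v1r v2r.
  have [->|v12] := eqVneq v1 v2; first by rewrite subrr enorm0 !triv subrr; lra.
  exfalso; apply: K0; exists ((enorm (v1 - v2))^-1 *: (v1 - v2), (v1, w)).
  split => //; rewrite /S /= enormZ ger0_norm ?invr_ge0 ?enorm_ge0// mulVf//.
  by rewrite enorm_eq0 subr_eq0.
have cK : compact K.
  apply: compact_setX; first exact: compact_esphere.
  by apply: compact_setX => //; exact: compact_eball.
pose H (x : E * (E * Om)) := 'D_(0, x.1) ('D_(0, x.1) (G x.2.2)) (0, x.2.1).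
have cH : continuous H.
  rewrite /H; under eq_fun do rewrite DDE.
  apply: continuous_bigsum => i; apply: continuous_bigsum => j x.
  have cc k : continuous (fun x : E * (E * Om) => pair_coord k (0, x.1)).
    case: k => k /=; first by move=> ?; exact: cvg_cst.
    exact: continuous_compose (@continuous_fst _ _) (@coord_continuous _ _ _ 0 k).
  apply: cvgM; first by apply: cvgM; exact: cc.
  have cf : continuous (fun x : E * (E * Om) => ((0, x.2.1), x.2.2) : (E * E) * Om).
    apply: continuous_pair; first apply: continuous_pair.
    - exact: continuous_cst.
    - exact: continuous_compose (@continuous_snd _ _) (@continuous_fst _ _).
    - exact: continuous_compose (@continuous_snd _ _) (@continuous_snd _ _).
  exact: (continuous_compose cf (@cddG (pair_basis R i) (pair_basis R j))).
have [[u0 [v0 w0]] /set_mem [Su0 _] Hmin] :=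
  compact_EVT_min K0 cK (continuous_subspaceT cH).
have u00 : u0 != 0 by rewrite -enorm_eq0 Su0 oner_eq0.
exists (H (u0, (v0, w0))).
  exact: DD_gt0.
move=> v1 v2 w v1r v2r.
have [->|v12] := eqVneq v1 v2; first by rewrite subrr enorm0 !triv subrr expr0n/= mulr0.
move Ed : (v1 - v2) => d; rewrite !(derive_snd (G w)).
have [c /andP[c0 c1]] := @MVT_line01 _ _ ('D_(0, d) (G w)) (0, v2) (0, d)
  (ddG w (0, d)).
have -> : (0, v2) + (0, d) = (0, v1) :> E * E.
  by apply/pair_equal_spec; rewrite /= addr0 -Ed addrC subrK.
move=> ->.
have d0 : enorm d != 0 by rewrite -Ed enorm_eq0 subr_eq0.
pose e := (enorm d)^-1 *: d.
have : H (u0, (v0, w0)) <= H (e, (v2 + c *: d, w)).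
  apply: Hmin; apply/mem_set; split => /=.
    by rewrite /S/= enormZ ger0_norm ?invr_ge0 ?enorm_ge0// mulVf.
  split => //=; have -> : v2 + c *: d = (1 - c) *: v2 + c *: v1.
    by rewrite -Ed scalerBr scalerBl scale1r addrAC addrA.
  rewrite (le_trans (ler_enormD _ _))// !enormZ !ger0_norm//; try lra.
  have h1 : (1 - c) * enorm v2 <= (1 - c) * r by rewrite ler_wpM2l//; lra.
  have h2 : c * enorm v1 <= c * r by rewrite ler_wpM2l//; lra.
  lra.
move=> Hd; have -> : 'D_(0, d) ('D_(0, d) (G w)) ((0, v2) + c *: (0, d)) =
    H (e, (v2 + c *: d, w)) * enorm d ^+ 2; last by rewrite ler_wpM2r// sqr_ge0.
have -> : (0, v2) + c *: (0, d) = (0, v2 + c *: d) :> E * E.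
  by apply/pair_equal_spec; rewrite /= scaler0 addr0.
have -> : (0, d) = enorm d *: (0, e) :> E * E.
  apply/pair_equal_spec; rewrite /= scaler0 /e scalerA mulfV//.
  by rewrite scale1r.
by rewrite derive2Z// mulrC.
Qed.

(** Superlinearity is assumed at each w separately.  The strict inequality on a sphere
    of velocities persists for nearby base points by compactness of the sphere, and
    convexity extrapolates it outwards from the sphere; compactness of the space of
    base points then makes r uniform. *)
Lemma lagrangian_superlinear (K : R) : exists2 r : R, 0 < r &
  forall v w, r <= enorm v -> K * enorm v <= L 0 v w.
Proof.
have [A A0 bA] := lagrangian_bounded 0.
have {}bA w : L 0 0 w <= A by apply: bA; rewrite enorm0.
pose P (r : R) w := forall v, r <= enorm v -> K * enorm v <= L 0 v w.
have local (w0 : Om) : exists2 r : R, 0 < r & \forall w \near w0, P r w.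
  have [r0 Hr0] : exists r, forall v, r <= enorm v -> (K + 2 + A) * enorm v <= L 0 v w0.
    by case: LP => [_ _ /(_ 0 w0 (K + 2 + A)) [r Hr] _]; exists r.
  pose r := Num.max r0 1.
  have r1 : 1 <= r by rewrite le_max lexx orbT.
  have rpos : 0 < r by exact: lt_le_trans r1.
  exists r => //.
  have := @compact_esphere R n r.
  move/compact_near_coveringP => /(_ Om (nbhs w0)
    (fun w v => (K + 1 + A) * r < L 0 v w) _).
  have H v : [set u : E | enorm u = r] v ->
      \near v & w0, (fun w v => (K + 1 + A) * r < L 0 v w) w0 v.
    move=> /= vr; have lt : (K + 1 + A) * r < L 0 v w0.
      apply: lt_le_trans (Hr0 v _); last by rewrite vr le_max lexx.
      by rewrite vr ltr_pM2r//; lra.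
    by have /cvgr_gt := @continuous_lagrangian0 (v, w0); apply.
  move=> /(_ H); apply: filterS => w Hw v rv.
  pose e := (r / enorm v) *: v; pose rho := enorm v / r.
  have v0 : 0 < enorm v by exact: lt_le_trans rv.
  have er : enorm e = r.
    by rewrite enormZ ger0_norm ?divr_ge0 ?ltW// divfK// gt_eqF.
  have rho1 : 1 <= rho by rewrite ler_pdivlMr// mul1r.
  have ve : v = rho *: e.
    rewrite /e /rho scalerA mulrA divfK; last by rewrite gt_eqF.
    by rewrite divff ?scale1r// gt_eqF.
  have := Hw e er => Le.
  have e0 : e != 0 by rewrite -enorm_eq0 er gt_eqF.
  have := @convex_extrapolation _ _ (G w) 0 (0, e) rho (dG w) (ddG w (0, e))
    (fun z => ltW (DD_gt0 w z e0)) rho1.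
  have -> : 0 + rho *: (0, e) = (0, v) :> E * E.
    by rewrite add0r ve; apply/pair_equal_spec; rewrite /= scaler0.
  rewrite add0r /G /= => conv; apply: le_trans conv.
  have L0 := lagrangian_ge0 0 0 w.
  apply: (@le_trans _ _ (rho * ((K + 1 + A) * r - A))); last first.
    apply: (@le_trans _ _ (rho * (L 0 e w - L 0 0 w))); last by rewrite lerDr.
    rewrite ler_pM2l; first by have := bA w; lra.
    exact: lt_le_trans rho1.
  have -> : enorm v = rho * r by rewrite /rho divfK// gt_eqF.
  rewrite mulrCA ler_pM2l; last exact: lt_le_trans rho1.
  have : A <= A * r by rewrite ler_peMr.
  have : 0 <= r by exact: ltW.
  lra.
have /compact_near_coveringP/(_ R (+oo : set_system R) P _) := cO.
have H (w : Om) : [set: Om] w ->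
    \forall w' \near w & x \near (+oo : set_system R), P x w'.
  move=> _; have [r r0 Hr] := local w.
  exists ([set w | P r w], [set x | r < x]); first split => //=.
    by exists r; split => //; exact: num_real.
  move=> [w' x] /= [Pw rx] v xv; apply: Pw; apply: le_trans xv; exact: ltW.
move=> /(_ H) [r [_ Hr]].
exists (Num.max r 0 + 1); first by rewrite ltr_wpDl// le_max lexx orbT.
move=> v w vr; apply: (Hr (Num.max r 0 + 1)) => //.
by rewrite ltr_pwDr// le_max lexx.
Qed.

End Lagrangian.

(** * Quadratic expansions along orbits *)

Section QuadraticExpansion.
Variables (R : realType) (n : nat).
Local Notation E := 'rV[R]_n.

(** The linear form of slope p, as a function that can carry a linear structure. *)
Definition dotvr (p : E) : E -> R := fun h => dotv h p.

Fact dotvr_is_linear p : linear (dotvr p).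
Proof. by move=> a u v; rewrite /dotvr dotvDl dotvZl. Qed.

HB.instance Definition _ p := GRing.isLinear.Build R E R *:%R (dotvr p) (dotvr_is_linear p).

Lemma continuous_dotvr p : continuous (dotvr p).
Proof. by apply: continuous_dotv; [move=> ?; exact: cvg_id|exact: continuous_cst]. Qed.

(** A quadratic remainder is little-o of the increment, the two norms being
    equivalent. *)
Lemma differentiable_expansion (f : E -> R) (x p : E) (K : R) :
  (forall h, `|f (x + h) - f x - dotv h p| <= K * enorm h ^+ 2) ->
  differentiable f x /\ (forall u, 'D_u f x = dotv u p).
Proof.
move=> H.
have o : f \o shift x = cst (f x) + dotvr p +o_ (0 : E) id.
  apply/eqaddoP => eps eps0.
  pose C := `|K| * n%:R ^+ 2 + 1.
  have C0 : 0 < C by rewrite ltr_wpDl ?mulr_ge0 ?sqr_ge0.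
  have dC : 0 < eps / C by rewrite divr_gt0.
  near=> h.
  have -> : (f \o shift x - (cst (f x) + dotvr p)) h = f (x + h) - f x - dotv h p.
    by rewrite !fctE /= /dotvr (addrC h) opprD addrA.
  apply: le_trans (H h) _.
  apply: (@le_trans _ _ (C * `|h| ^+ 2)).
    apply: (@le_trans _ _ (`|K| * (n%:R * `|h|) ^+ 2)).
      apply: (@le_trans _ _ (`|K| * enorm h ^+ 2)).
        by rewrite ler_wpM2r ?sqr_ge0// ler_norm.
      rewrite ler_wpM2l// ler_sqr ?nnegrE ?mulr_ge0 ?enorm_ge0//.
      exact: enorm_le_mx_norm.
    by rewrite exprMn mulrA ler_wpM2r ?sqr_ge0// lerDl.
  rewrite expr2 mulrA ler_wpM2r//.
  have hs : `|h| <= eps / C by near: h; exact: (@nbhs0_le R E).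
  by rewrite -(@ler_pM2l _ C) // [C * (_ / _)]mulrC divfK ?gt_eqF in hs.
have dE := diff_unique (@continuous_dotvr p) o.
have df : differentiable f x.
  apply/diff_locallyP; rewrite dE; split => //; exact: continuous_dotvr.
split => // u; by rewrite deriveE// dE.
Unshelve. all: by end_near. Qed.

End QuadraticExpansion.

Section OrbitExpansion.
Variables (R : realType) (n : nat) (Om : pmetricType R).
Variable tau : 'rV[R]_n -> Om -> Om.
Hypothesis tauP : continuous_action tau.
Local Notation E := 'rV[R]_n.

Lemma tauD x y w : tau (x + y) w = tau x (tau y w).
Proof. by case: tauP. Qed.

Lemma tau0 w : tau 0 w = w.
Proof. by case: tauP. Qed.

Lemma tauK x w : tau (- x) (tau x w) = w.
Proof. by rewrite -tauD addNr tau0. Qed.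

Lemma continuous_tau2 : continuous (fun p : E * Om => tau p.1 p.2).
Proof. by case: tauP. Qed.

Lemma continuous_tau x : continuous (tau x).
Proof.
have cf : continuous (fun w : Om => (x, w) : E * Om).
  by apply: continuous_pair; [exact: continuous_cst|move=> w; exact: cvg_id].
exact: (continuous_compose cf continuous_tau2).
Qed.

Lemma continuous_orbit w : continuous (tau ^~ w).
Proof.
have cf : continuous (fun x : E => (x, w) : E * Om).
  by apply: continuous_pair; [move=> ?; exact: cvg_id|exact: continuous_cst].
exact: (continuous_compose cf continuous_tau2).
Qed.

(** A C^{1,1} condition along the orbits, uniform over the base points. *)
Definition orbit_expansion (K : R) (f : Om -> R) (P : Om -> E) :=
  forall w h, `|f (tau h w) - f w - dotv h (P w)| <= K * enorm h ^+ 2.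

(** The gradient is a uniform limit of difference quotients of f, which are
    continuous in the base point. *)
Lemma orbit_expansion_continuous K f P :
  orbit_expansion K f P -> continuous f -> continuous P.
Proof.
move=> fP cf w0.
have coord i : continuous (fun w => P w 0 i).
  move=> w; apply/cvgrPdist_lt => eps eps0.
  pose s := eps / (4 * (`|K| + 1)).
  have K1 : 0 < `|K| + 1 by rewrite ltr_wpDl.
  have s0 : 0 < s by rewrite divr_gt0// mulr_gt0.
  have est w' : `|f (tau (s *: delta_mx 0 i) w') - f w' - s * P w' 0 i| <= s * (eps / 4).
    have := fP w' (s *: delta_mx 0 i).
    rewrite dotvZl dotvC dotv_delta enormZ enorm_delta mulr1 => /le_trans; apply.
    rewrite real_normK ?num_real//.
    have -> : eps / 4 = (`|K| + 1) * s.
      by rewrite /s; field; rewrite gt_eqF.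
    have := ler_wpM2r (sqr_ge0 s) (ler_norm K); have := sqr_ge0 s; lra.
  have cg : continuous (fun w => f (tau (s *: delta_mx 0 i) w) - f w).
    move=> x; apply: cvgB; last exact: cf.
    exact: (continuous_compose (@continuous_tau _) cf).
  have se : 0 < s * (eps / 4) by rewrite mulr_gt0// divr_gt0.
  have /cvgrPdist_lt/(_ _ se) := cg w; apply: filterS => w' Hw'.
  have := est w; have := est w'.
  rewrite -(@ltr_pM2l _ s)// -[X in X * `|_|](gtr0_norm s0) -normrM mulrBr.
  move: Hw'; rewrite !ltr_norml !ler_norml.
  move: (s * P w 0 i) (s * P w' 0 i) (f (tau _ w)) (f (tau _ w')) => a b c d.
  move=> /andP[? ?] /andP[? ?] /andP[? ?]; apply/andP; split; lra.
apply/cvgrPdist_lt => eps eps0.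
have : \forall w \near w0, forall j, `|P w0 0 j - P w 0 j| < eps.
  by apply: filter_forall => j; have /cvgrPdist_lt := coord j w0; exact.
apply: filterS => w Hw.
rewrite [X in X < _]/Num.Def.normr /= mx_normrE.
by apply/bigmax_ltP; split => //= -[i j] _ /=; rewrite (ord1 i) !mxE.
Qed.

(** Such functions are admissible test functions: a function of the base point
    extends to a stationary one by following the orbit. *)
Lemma orbit_expansion_C1s K f P : continuous f -> orbit_expansion K f P ->
  C1s tau (fun x w => f (tau x w)) /\
  forall w, grad (fun x => f (tau x w)) 0 = P w.
Proof.
move=> cf fP.
have dif w x : differentiable (fun x => f (tau x w)) x /\
    forall u, 'D_u (fun x => f (tau x w)) x = dotv u (P (tau x w)).
  apply: (@differentiable_expansion _ _ _ _ _ K) => h.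
  by rewrite (addrC x h) tauD; exact: fP.
have gE w x : grad (fun x => f (tau x w)) x = P (tau x w).
  apply/rowP => i; rewrite mxE; have [_ ->] := dif w x.
  by rewrite dotvC dotv_delta.
have cP := orbit_expansion_continuous fP cf.
split; last by move=> w; rewrite gE tau0.
split.
- by move=> x y w; rewrite tauD.
- move=> w; split => [x|]; first by case: (dif w x).
  rewrite (_ : grad _ = (fun x => P (tau x w))); last by apply/funext => x; exact: gE.
  exact: (continuous_compose (@continuous_orbit w) cP).
- by move=> x; exact: (continuous_compose (@continuous_tau x) cf).
- by under eq_fun do rewrite gE tau0.
Qed.

End OrbitExpansion.

(** * Sup-convolution along orbits *)

Section Tube.
Variables (R : realType) (T U : topologicalType).

Lemma tube (F : T * U -> R) (K : set T) (w : U) (e : R) :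
  continuous F -> compact K -> 0 < e ->
  \forall w' \near w, forall z, K z -> `|F (z, w) - F (z, w')| < e.
Proof.
move=> cF /compact_near_coveringP cK e0.
apply: (cK U (nbhs w) (fun w' z => `|F (z, w) - F (z, w')| < e) _) => z Kz.
have e2 : 0 < e / 2 by rewrite divr_gt0.
have /cvgrPdist_lt/(_ _ e2) near1 := cF (z, w).
have near2 : \forall x \near (z, w), `|F (z, w) - F (x.1, w)| < e / 2.
  have cg : continuous (fun x : T * U => F (x.1, w)).
    have cf : continuous (fun x : T * U => (x.1, w)).
      by apply: continuous_pair; [exact: continuous_fst|exact: continuous_cst].
    exact: (continuous_compose cf cF).
  by have /cvgrPdist_lt/(_ _ e2) := cg (z, w).
have : \forall x \near (z, w), `|F (x.1, w) - F (x.1, x.2)| < e.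
  apply: filterS2 near1 near2 => -[x1 x2] /=.
  rewrite !ltr_norml => /andP[? ?] /andP[? ?]; apply/andP; split; lra.
by [].
Qed.

End Tube.

Section SupConvolution.
Variables (R : realType) (n : nat) (Om : pmetricType R).
Variable tau : 'rV[R]_n -> Om -> Om.
Hypothesis tauP : continuous_action tau.
Local Notation E := 'rV[R]_n.
Variables (u : Om -> R) (B c k : R).
Hypotheses (cu : continuous u) (B0 : 0 <= B) (c0 : 0 <= c) (k0 : 0 < k) (ck : c <= k).
Hypothesis uB : forall w y, `|u (tau y w) - u w| <= B * enorm y.
Hypothesis uc : forall w y,
  u (tau y w) + u (tau (- y) w) - 2 * u w <= c * enorm y ^+ 2.

(** Since u grows at most like B |z|, points with |z| > B / k do no better than
    z = 0, so the supremum is a maximum over a compact ball. *)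
Lemma sup_convolution_max w : exists2 z : E, enorm z <= B / k &
  forall z', u (tau z' w) - k * enorm z' ^+ 2 <= u (tau z w) - k * enorm z ^+ 2.
Proof.
pose g z := u (tau z w) - k * enorm z ^+ 2.
have cg : continuous g.
  have c1 := continuous_compose (continuous_orbit tauP (w := w)) cu.
  apply: (continuous_sub c1); apply: continuous_mul; first exact: continuous_cst.
  by apply: continuous_mul; exact: continuous_enorm.
have r0 : 0 <= B / k by rewrite divr_ge0// ltW.
have ne : [set z : E | enorm z <= B / k] !=set0 by exists 0 => /=; rewrite enorm0.
have [z /set_mem zr zmax] := compact_EVT_max ne (@compact_eball R n _)
  (continuous_subspaceT cg).
exists z => // z'; have [z'r|z'r] := leP (enorm z') (B / k).
  by apply: zmax; apply/mem_set.
apply: (@le_trans _ _ (g 0)); last by apply: zmax; apply/mem_set; rewrite /= enorm0.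
rewrite /g enorm0 tau0// expr0n /= mulr0 subr0.
have := uB w z'; rewrite ler_norml => /andP[_].
have : B * enorm z' <= k * enorm z' ^+ 2.
  rewrite expr2 mulrA ler_wpM2r ?enorm_ge0// mulrC -ler_pdivrMr//; exact: ltW.
lra.
Qed.

Definition sup_point w : E := projT1 (cid2 (sup_convolution_max w)).

Lemma sup_point_le w : enorm (sup_point w) <= B / k.
Proof. by rewrite /sup_point; case: cid2. Qed.

Definition sup_convolution w :=
  u (tau (sup_point w) w) - k * enorm (sup_point w) ^+ 2.

(** Freezing the optimal displacement and differentiating the remaining quadratic
    gives this slope (see [sup_convolution_below]). *)
Definition sup_gradient w : E := (2 * k) *: sup_point w.

Local Notation phi := sup_convolution.
Local Notation P := sup_gradient.

Lemma sup_convolution_ge w z : u (tau z w) - k * enorm z ^+ 2 <= phi w.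
Proof. by rewrite /phi /sup_point; case: cid2 => /= ? ? H; exact: H. Qed.

Lemma le_sup_convolution w : u w <= phi w.
Proof.
have := sup_convolution_ge w 0.
by rewrite tau0// enorm0 expr0n /= mulr0 subr0.
Qed.

Lemma sup_convolution_le w : phi w <= u w + B ^+ 2 / k.
Proof.
have := uB w (sup_point w); rewrite ler_norml => /andP[_ H].
have h1 : B * enorm (sup_point w) <= B ^+ 2 / k.
  by rewrite expr2 -mulrA ler_wpM2l// sup_point_le.
have := mulr_ge0 (ltW k0) (sqr_ge0 (enorm (sup_point w))).
rewrite /phi; lra.
Qed.

Lemma sup_gradient_le w : enorm (P w) <= 2 * B.
Proof.
have := sup_point_le w; rewrite ler_pdivlMr// => H.
by rewrite enormZ ger0_norm; [lra|rewrite mulr_ge0// ltW].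
Qed.

Lemma sup_convolution_continuous : continuous phi.
Proof.
move=> w; apply/cvgrPdist_lt => e e0.
have cF := continuous_compose (continuous_tau2 tauP) cu.
have := tube w cF (@compact_eball R n (B / k)) e0.
apply: filterS => w' /= Hw.
have := Hw _ (sup_point_le w); have := Hw _ (sup_point_le w').
have := sup_convolution_ge w (sup_point w').
have := sup_convolution_ge w' (sup_point w).
rewrite /phi !ltr_norml => ? ? /andP[? ?] /andP[? ?]; apply/andP; split; lra.
Qed.

(** With z1 = m + d and z2 = m - d optimal for the two translates, compare with
    the displacement m at w: the penalties leave - 2 k |d|^2, which absorbs the part
    of the second difference of u caused by d as long as c <= k. *)
Lemma sup_convolution_semiconcave w h :
  phi (tau h w) + phi (tau (- h) w) - 2 * phi w <= 2 * c * enorm h ^+ 2.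
Proof.
set z1 := sup_point (tau h w); set z2 := sup_point (tau (- h) w).
pose m := (2^-1 : R) *: (z1 + z2); pose d := (2^-1 : R) *: (z1 - z2).
have z1E : z1 = m + d.
  by apply/rowP => i; rewrite !mxE; lra.
have z2E : z2 = m - d.
  by apply/rowP => i; rewrite !mxE; lra.
have := sup_convolution_ge w m.
have := uc (tau m w) (h + d); rewrite -!(tauD tauP).
have -> : phi (tau h w) = u (tau (h + d + m) w) - k * enorm (m + d) ^+ 2.
  by rewrite /phi -/z1 z1E -(tauD tauP); congr (u (tau _ _) - _); rewrite addrC -addrA (addrC d).
have -> : phi (tau (- h) w) = u (tau (- (h + d) + m) w) - k * enorm (m - d) ^+ 2.
  rewrite /phi -/z2 z2E -(tauD tauP); congr (u (tau _ _) - _).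
  by rewrite opprD addrC -addrA (addrC (- d)).
rewrite (sqr_enormD m d) (sqr_enormB m d).
have := sqr_enormD_le h d => /(ler_wpM2l c0).
have := ler_wpM2r (sqr_ge0 (enorm d)) ck.
lra.
Qed.

(** The displacement z - h from tau_h w reaches the same point as z from w. *)
Lemma sup_convolution_below w h :
  phi w + dotv h (P w) - k * enorm h ^+ 2 <= phi (tau h w).
Proof.
apply: le_trans (sup_convolution_ge (tau h w) (sup_point w - h)).
rewrite -(tauD tauP) subrK /phi sqr_enormB /P dotvZr (dotvC h); lra.
Qed.

(** One side is the parabola from below; the other follows from the one at - h
    and semiconcavity. *)
Lemma sup_convolution_expansion : orbit_expansion tau (k + 2 * c) phi P.
Proof.
move=> w h; rewrite ler_norml; apply/andP; split.
  have := sup_convolution_below w h.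
  have := mulr_ge0 c0 (sqr_ge0 (enorm h)); lra.
have := sup_convolution_below w (- h); rewrite dotvNl enormN.
have := sup_convolution_semiconcave w h; lra.
Qed.

Lemma sup_convolution_lipschitz w y : `|phi (tau y w) - phi w| <= B * enorm y.
Proof.
have half w' y' : phi (tau y' w') <= phi w' + B * enorm y'.
  set z := sup_point (tau y' w').
  have := sup_convolution_ge w' z; have := uB (tau z w') y'.
  have -> : tau y' (tau z w') = tau z (tau y' w') by rewrite -!(tauD tauP) addrC.
  rewrite ler_norml => /andP[_].
  rewrite [phi (tau y' w')]/sup_convolution -/z; lra.
have := half w y; have := half (tau y w) (- y); rewrite tauK// enormN => ? ?.
rewrite ler_norml; apply/andP; split; lra.
Qed.

End SupConvolution.

Section OneSided.
Variables (R : realType) (n : nat) (Om : pmetricType R).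
Variable tau : 'rV[R]_n -> Om -> Om.
Hypothesis tauP : continuous_action tau.

(** The constant of the upper bound can be improved to that of semiconcavity:
    the bound at h / 2 with constant K yields the bound at h with (K + c) / 2, and
    this is iterated.  It matters because K grows with the regularization parameter
    while c does not. *)
Lemma semiconcave_expansion_le (f : Om -> R) P (K c : R) :
  (forall w h, f (tau h w) + f (tau (- h) w) - 2 * f w <= 2 * c * enorm h ^+ 2) ->
  orbit_expansion tau K f P ->
  forall w h, f (tau h w) <= f w + dotv h (P w) + c * enorm h ^+ 2.
Proof.
move=> fc fP w.
have iter j h : f (tau h w) - f w - dotv h (P w) <=
    (c + (K - c) / 2 ^+ j) * enorm h ^+ 2.
  elim: j h => [|j IH] h.
    rewrite expr0 divr1 (_ : c + (K - c) = K); last by lra.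
    exact: le_trans (ler_norm _) (fP w h).
  pose h2 := (2^-1 : R) *: h.
  have hE : h = h2 + h2 by apply/rowP => i; rewrite !mxE; lra.
  have := fc (tau h2 w) h2; rewrite -!(tauD tauP) -hE addNr tau0//.
  have := IH h2; have -> : dotv h2 (P w) = dotv h (P w) / 2.
    by rewrite dotvZl mulrC.
  have -> : enorm h2 ^+ 2 = enorm h ^+ 2 / 4.
    by rewrite enormZ exprMn ger0_norm ?invr_ge0//; lra.
  have -> : (K - c) / 2 ^+ j.+1 = (K - c) / 2 ^+ j / 2.
    by rewrite exprSr invfM mulrA.
  move: (f (tau h w)) (f (tau h2 w)) (f w) (dotv h (P w)).
  move: ((K - c) / 2 ^+ j) (enorm h ^+ 2) => X Q a b d e ? ?; lra.
move=> h; apply/ler_addgt0Pr => e e0.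
pose C := `|K - c| * enorm h ^+ 2 + 1.
have C0 : 0 < C by rewrite ltr_wpDl// mulr_ge0// sqr_ge0.
pose j := Num.bound (C / e).
have jb : C / e < 2 ^+ j.
  apply: lt_le_trans (archi_boundP _) _; first by rewrite divr_ge0// ltW.
  by rewrite -natrX ler_nat ltnW// ltn_expl.
move: j jb => j jb.
have p2 : (0 : R) < 2 ^+ j by rewrite exprn_gt0.
have : (K - c) / 2 ^+ j * enorm h ^+ 2 <= e.
  rewrite mulrAC ler_pdivrMr//.
  move: jb; rewrite ltr_pdivrMr// mulrC => /ltW jb; apply: le_trans jb.
  apply: (@le_trans _ _ (`|K - c| * enorm h ^+ 2)); last by rewrite lerDl.
  by rewrite ler_wpM2r ?sqr_ge0// ler_norm.
have := iter j h; move: ((K - c) / 2 ^+ j) => X; lra.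
Qed.

End OneSided.

(** * Discounted integrals *)

Section DiscountedTime.
Variables (R : realType) (alpha : R).
Hypothesis alpha0 : 0 < alpha.

Implicit Types (t r s M : R) (g : R -> R).

(** The change of variable r = 1 - exp (- alpha s) turns the discount factor
    exp (- alpha s) ds into dr / alpha; [clock] is its inverse.  The maximum makes it
    continuous on the whole line and is inactive for times at most 1. *)
Definition clock (r : R) : R := - ln (Num.max (1 - r) (expR (- alpha))) / alpha.

Definition elapsed (t : R) : R := 1 - expR (- alpha * t).

(** The integral of exp (- alpha s) g(s) over [0, t], written as a Lebesgue
    integral without weight, which a uniform law can represent. *)
Definition disc_int (t : R) (g : R -> R) : R :=
  alpha^-1 * (\int[lebesgue_measure]_(r in `[0%R, elapsed t]) g (clock r))%R.

Lemma continuous_clock : continuous clock.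
Proof.
have cmax : continuous (fun r : R => Num.max (1 - r) (expR (- alpha))).
  move=> r; apply: (@continuous_max R R (fun r => 1 - r) (fun _ => expR (- alpha))).
    by apply: cvgB; [exact: cvg_cst|exact: cvg_id].
  exact: cvg_cst.
move=> r; apply: cvgM; last exact: cvg_cst.
apply: cvgN; apply: (continuous_comp (cmax r)).
by apply: continuous_ln; rewrite lt_max expR_gt0 orbT.
Qed.

Lemma elapsed_gt0 t : 0 < t -> 0 < elapsed t.
Proof. by move=> t0; rewrite subr_gt0 -expR0 ltr_expR mulNr oppr_lt0 mulr_gt0. Qed.

Lemma elapsed_le t : elapsed t <= alpha * t.
Proof. by have := expR_ge1Dx (- alpha * t); rewrite /elapsed; lra. Qed.

Lemma elapsed_ge t : alpha * t * expR (- alpha * t) <= elapsed t.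
Proof.
have := expR_ge1Dx (alpha * t) => /(ler_wpM2r (expR_ge0 (- alpha * t))).
rewrite -expRD mulNr subrr expR0 /elapsed mulNr; lra.
Qed.

Lemma clockE t r : t <= 1 -> r <= elapsed t -> clock r = - ln (1 - r) / alpha.
Proof.
move=> t1 rt; rewrite /clock max_l//.
have : expR (- alpha) <= expR (- alpha * t).
  by rewrite ler_expR mulNr lerN2 ler_piMr// ltW.
by move: rt; rewrite /elapsed; lra.
Qed.

Lemma clock_elapsed t : t <= 1 -> clock (elapsed t) = t.
Proof.
move=> t1; rewrite (clockE t1)// /elapsed opprB addrCA subrr addr0 expRK.
by field; rewrite gt_eqF.
Qed.

Lemma clock_itv t r : t <= 1 -> 0 <= r <= elapsed t -> 0 <= clock r <= t.
Proof.
move=> t1 /andP[r0 rt]; rewrite (clockE t1)//.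
have r1 : 0 < 1 - r.
  by move: rt; rewrite /elapsed; have := expR_gt0 (- alpha * t); lra.
apply/andP; split.
  apply: divr_ge0; last exact: ltW.
  by rewrite oppr_ge0 -ln1 ler_ln ?posrE//; lra.
rewrite ler_pdivrMr// lerNl mulrC -mulNr -[leLHS]expRK ler_ln ?posrE ?expR_gt0//.
by move: rt; rewrite /elapsed; lra.
Qed.

Lemma integrable_clock t g : continuous g ->
  lebesgue_measure.-integrable `[0%R, elapsed t] (EFin \o (fun r => g (clock r))).
Proof.
move=> cg; apply: continuous_compact_integrable; first exact: segment_compact.
apply: continuous_subspaceT; exact: (continuous_compose continuous_clock cg).
Qed.

Lemma disc_int_le t g M : 0 < t <= 1 -> continuous g ->
  (forall s, 0 <= s <= t -> g s <= M) -> disc_int t g <= M * (elapsed t / alpha).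
Proof.
move=> /andP[t0 t1] cg gM; rewrite /disc_int mulrC mulrA ler_pM2r ?invr_gt0//.
have mI : lebesgue_measure `[0%R, elapsed t]%classic = (elapsed t)%:E :> \bar R.
  by rewrite lebesgue_measure_itv /= lte_fin elapsed_gt0// -EFinD subr0.
have -> : M * elapsed t = (\int[lebesgue_measure]_(r in `[0%R, elapsed t]) M)%R.
  by rewrite Rintegral_cst// [X in _ * fine X](_ : _ = (elapsed t)%:E).
apply: le_Rintegral => //; first exact: integrable_clock.
  by apply: (@integrable_clock t (fun _ => M)); exact: continuous_cst.
by move=> r /=; rewrite in_itv /= => /(clock_itv t1) /gM.
Qed.

Lemma disc_intD t g1 g2 : continuous g1 -> continuous g2 ->
  disc_int t (fun s => g1 s + g2 s) = disc_int t g1 + disc_int t g2.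
Proof.
move=> c1 c2; rewrite /disc_int RintegralD ?mulrDr//; exact: integrable_clock.
Qed.

Lemma disc_intZ t g a : continuous g ->
  disc_int t (fun s => a * g s) = a * disc_int t g.
Proof.
move=> cg; rewrite /disc_int RintegralZl//; last exact: integrable_clock.
by rewrite mulrCA.
Qed.

Lemma disc_int_ge t g M : 0 < t <= 1 -> continuous g ->
  (forall s, 0 <= s <= t -> M <= g s) -> M * (elapsed t / alpha) <= disc_int t g.
Proof.
move=> t01 cg gM; rewrite -lerN2 -mulN1r -disc_intZ// -mulNr.
apply: disc_int_le => //.
  by apply: continuous_mul => //; exact: continuous_cst.
by move=> s /gM; lra.
Qed.

Lemma disc_int_le_ge0 t g M : 0 < t <= 1 -> continuous g -> 0 <= M ->
  (forall s, 0 <= s <= t -> g s <= M) -> disc_int t g <= M * t.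
Proof.
move=> t01 cg M0 gM; apply: le_trans (disc_int_le t01 cg gM) _.
by rewrite ler_wpM2l// ler_pdivrMr// mulrC elapsed_le.
Qed.

Lemma disc_int_ge0 t g : 0 < t <= 1 -> continuous g ->
  (forall s, 0 <= g s) -> 0 <= disc_int t g.
Proof.
by move=> t01 cg g0; rewrite -[leLHS](mul0r (elapsed t / alpha)); exact: disc_int_ge.
Qed.

Lemma disc_int_dist t g1 g2 M : 0 < t <= 1 -> continuous g1 -> continuous g2 ->
  (forall s, 0 <= s <= t -> `|g1 s - g2 s| <= M) ->
  `|disc_int t g1 - disc_int t g2| <= M * (elapsed t / alpha).
Proof.
move=> t01 c1 c2 H.
have half g g' : continuous g -> continuous g' ->
    (forall s, 0 <= s <= t -> `|g s - g' s| <= M) ->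
    disc_int t g - disc_int t g' <= M * (elapsed t / alpha).
  move=> cg cg' Hg; rewrite -(mulN1r (disc_int t g')) -disc_intZ//.
  have cN : continuous (fun s => -1 * g' s).
    by apply: continuous_mul => //; exact: continuous_cst.
  rewrite -disc_intD//; apply: disc_int_le => //; first exact: continuous_add.
  by move=> s /Hg; rewrite mulN1r; exact: le_trans (ler_norm _).
rewrite ler_norml; apply/andP; split; last exact: half.
by rewrite lerNl opprB; apply: half => // s /H; rewrite distrC.
Qed.

End DiscountedTime.

(** * The discounted value function *)

Section ValueFunction.
Variables (R : realType) (n : nat) (Om : pmetricType R).
Variable tau : 'rV[R]_n -> Om -> Om.
Variable L : 'rV[R]_n -> 'rV[R]_n -> Om -> R.
Hypothesis cO : compact [set: Om].
Hypothesis tauP : continuous_action tau.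
Hypothesis LP : admissible_lagrangian tau L.
Local Notation E := 'rV[R]_n.
Variables (a alpha A B R0 C : R).
Hypotheses (alpha0 : 0 < alpha) (alphaa : alpha <= a).
Hypothesis LA : forall w, L 0 0 w <= A.
Hypotheses (B0 : 0 <= B) (LB : forall v w, enorm v <= 1 -> L 0 v w <= B).
Hypotheses (R01 : 1 <= R0)
  (LR : forall v w, R0 <= enorm v -> expR a * B * enorm v <= L 0 v w).
Hypotheses (C0 : 0 <= C) (LC : forall v h xi w,
  enorm v <= R0 -> enorm h <= 1 -> enorm xi <= 1 ->
  L 0 (v + xi) (tau h w) + L 0 (v - xi) (tau (- h) w) - 2 * L 0 v w <=
    C * (enorm h ^+ 2 + enorm xi ^+ 2)).

Let L0 v w : 0 <= L 0 v w. Proof. exact: (lagrangian_ge0 LP). Qed.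

Definition running (v : E) (w : Om) (s : R) : R := L 0 v (tau (s *: v) w).

Definition segment_cost (t : R) (v : E) (w : Om) : R :=
  disc_int alpha t (running v w).

(** A path is a list of durations and constant velocities, followed by rest
    forever, whose discounted cost is at most A / alpha. *)
Fixpoint path_cost (l : seq (R * E)) (w : Om) : R :=
  if l is (t, v) :: l' then
    segment_cost t v w + expR (- alpha * t) * path_cost l' (tau (t *: v) w)
  else A / alpha.

(** The bound on durations is the range in which [clock] inverts the change of
    variable; longer segments are split. *)
Definition path_ok (l : seq (R * E)) := all (fun tv => 0 < tv.1 <= 1) l.

Definition value (w : Om) : R := inf [set path_cost l w | l in path_ok].

Lemma continuous_scale_orbit (v : E) w : continuous (fun s : R => tau (s *: v) w).
Proof.
have cs : continuous (fun s : R => s *: v) by exact: scalel_continuous.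
exact: (continuous_compose cs (continuous_orbit tauP (w := w))).
Qed.

Lemma continuous_running v w : continuous (running v w).
Proof.
have cf : continuous (fun s : R => (v, tau (s *: v) w) : E * Om).
  by apply: continuous_pair; [exact: continuous_cst|exact: continuous_scale_orbit].
exact: (continuous_compose cf (continuous_lagrangian0 LP)).
Qed.

Lemma A_ge0 : 0 <= A.
Proof. exact: le_trans (L0 0 point) (LA point). Qed.

Lemma segment_cost_ge0 t v w : 0 < t <= 1 -> 0 <= segment_cost t v w.
Proof.
move=> t01; apply: disc_int_ge0 => //; first exact: continuous_running.
by move=> s; exact: L0.
Qed.

Lemma path_cost_ge0 l w : path_ok l -> 0 <= path_cost l w.
Proof.
elim: l w => [|[t v] l IH] w /=; first by rewrite divr_ge0 ?A_ge0// ltW.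
by move=> /andP[t01 /IH H]; rewrite addr_ge0 ?segment_cost_ge0// mulr_ge0// expR_ge0.
Qed.

Lemma expR_discount_le1 t : 0 <= t -> expR (- alpha * t) <= 1.
Proof. by move=> t0; rewrite expR_le1 mulNr oppr_le0 mulr_ge0// ltW. Qed.

Lemma value_has_inf w : has_inf [set path_cost l w | l in path_ok].
Proof.
split; first by exists (path_cost [::] w), [::].
by exists 0 => _ [l lok <-]; exact: path_cost_ge0.
Qed.

Lemma value_le l w : path_ok l -> value w <= path_cost l w.
Proof. by move=> lok; apply: ge_inf; [case: (value_has_inf w)|exists l]. Qed.

Lemma value_adherent w e : 0 < e -> exists2 l, path_ok l & path_cost l w < value w + e.
Proof.
by move=> e0; have [_ [l lok <-] H] := inf_adherent e0 (value_has_inf w); exists l.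
Qed.

Lemma value_ge w x : (forall l, path_ok l -> x <= path_cost l w) -> x <= value w.
Proof.
move=> H; apply: lb_le_inf; first by case: (value_has_inf w).
by move=> _ [l lok <-]; exact: H.
Qed.

Lemma value_ge0 w : 0 <= value w.
Proof. by apply: value_ge => l; exact: path_cost_ge0. Qed.

Lemma alpha_value_le w : alpha * value w <= A.
Proof.
rewrite mulrC -ler_pdivlMr//; exact: (@value_le [::]).
Qed.

Lemma value_step t v w : 0 < t <= 1 ->
  value w <= segment_cost t v w + expR (- alpha * t) * value (tau (t *: v) w).
Proof.
move=> t01; rewrite -lerBlDl mulrC -ler_pdivrMr ?expR_gt0//.
apply: value_ge => l lok; rewrite ler_pdivrMr ?expR_gt0// lerBlDl mulrC.
by apply: (@value_le ((t, v) :: l)); rewrite /= t01.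
Qed.

Lemma path_ok_nseq N t v l : 0 < t <= 1 -> path_ok l -> path_ok (nseq N (t, v) ++ l).
Proof. by move=> t01 lok; elim: N => //= N ->; rewrite t01. Qed.

Lemma path_cost_nseq N t v l w : 0 < t <= 1 -> enorm v <= 1 -> path_ok l ->
  path_cost (nseq N (t, v) ++ l) w <=
    B * (N%:R * t) + expR (- alpha * (N%:R * t)) * path_cost l (tau ((N%:R * t) *: v) w).
Proof.
move=> t01 v1 lok; have /andP[t0 t1] := t01.
elim: N w => [|N IH] w.
  by rewrite !mul0r !mulr0 expR0 mul1r scale0r tau0// add0r.
have -> : N.+1%:R * t = N%:R * t + t by rewrite -natr1 mulrDl mul1r.
have h1 : segment_cost t v w <= B * t.
  apply: disc_int_le_ge0 => //; first exact: continuous_running.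
  by move=> s _; exact: LB.
have h2 := ler_wpM2l (expR_ge0 (- alpha * t)) (IH (tau (t *: v) w)).
have h3 : expR (- alpha * t) * (B * (N%:R * t)) <= B * (N%:R * t).
  apply: ler_piMl; last by apply: expR_discount_le1; exact: ltW.
  by apply: mulr_ge0 => //; apply: mulr_ge0 => //; exact: ltW.
rewrite /= scalerDl (tauD tauP) mulrDr [- alpha * (_ + t)]mulrDr expRD.
move: h1 h2 h3.
move: (segment_cost t v w) (path_cost (_ ++ _) _) (path_cost l _).
move: (expR (- alpha * t)) (expR (- alpha * (N%:R * t))).
move: (B * (N%:R * t)) (B * t) => b1 b2 x1 x2 a1 a2 a3; lra.
Qed.

Lemma split_time (x : R) : 0 < x -> exists N (t : R), 0 < t <= 1 /\ N%:R * t = x.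
Proof.
move=> x0; exists (Num.bound x), (x / (Num.bound x)%:R).
have N0 : 0 < (Num.bound x)%:R :> R.
  by apply: le_lt_trans (archi_boundP (ltW x0)); exact: ltW.
move: (archi_boundP (ltW x0)) N0; move: (Num.bound x) => N xN N0.
rewrite divr_gt0//= ler_pdivrMr// mul1r ltW//; split => //.
by rewrite mulrC divfK// gt_eqF.
Qed.

(** Reaching tau_y w from w at unit speed costs at most B |y|, after which a
    competitor from tau_y w can be followed. *)
Lemma value_lipschitz w y : `|value (tau y w) - value w| <= B * enorm y.
Proof.
suff half w' y' : value w' <= value (tau y' w') + B * enorm y'.
  have := half w y; have := half (tau y w) (- y); rewrite tauK// enormN => ? ?.
  rewrite ler_norml; apply/andP; split; lra.
have [->|y0] := eqVneq y' 0; first by rewrite tau0// enorm0 mulr0 addr0.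
have y'0 : 0 < enorm y' by rewrite lt_def enorm_eq0 y0 enorm_ge0.
have [N [t [t01 Nt]]] := split_time y'0.
pose v := (enorm y')^-1 *: y'.
have v1 : enorm v <= 1.
  by rewrite enormZ ger0_norm ?invr_ge0 ?enorm_ge0// mulVf// gt_eqF.
have vy : (N%:R * t) *: v = y'.
  by rewrite Nt scalerA mulfV ?scale1r// gt_eqF.
rewrite -lerBlDr; apply: value_ge => l lok; rewrite lerBlDr.
apply: le_trans (value_le _ (path_ok_nseq N v t01 lok)) _.
apply: le_trans (path_cost_nseq _ _ t01 v1 lok) _; rewrite vy Nt addrC lerD2r.
by rewrite ler_piMl ?path_cost_ge0// expR_discount_le1// enorm_ge0.
Qed.

Definition path_slow (r : R) (l : seq (R * E)) := all (fun tv => enorm tv.2 <= r) l.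

(** A segment at a speed above R0 costs more than crossing the same distance at
    unit speed; the slower crossing also delays, hence discounts, what follows. *)
Lemma path_slow_down l : path_ok l ->
  exists l', [/\ path_ok l', path_slow R0 l' & forall w, path_cost l' w <= path_cost l w].
Proof.
elim: l => [|[t v] l IH] /=; first by exists [::].
move=> /andP[t01 /IH[l' [ok' slow' le']]]; have /andP[t0 t1] := t01.
have [vR|vR] := leP (enorm v) R0.
  exists ((t, v) :: l'); split => /=; rewrite ?t01 ?vR//.
  by move=> w; rewrite lerD2l ler_wpM2l// expR_ge0.
have v0 : 0 < enorm v by apply: le_lt_trans vR; exact: le_trans R01.
have tv0 : 0 < t * enorm v by rewrite mulr_gt0.
have [N [s [s01 Ns]]] := split_time tv0.
pose e := (enorm v)^-1 *: v.
have e1 : enorm e = 1.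
  by rewrite enormZ ger0_norm ?invr_ge0 ?enorm_ge0// mulVf// gt_eqF.
exists (nseq N (s, e) ++ l'); split.
- exact: path_ok_nseq.
- rewrite /path_slow all_cat -/(path_slow R0 l') slow' andbT all_nseq /= e1 R01.
  by rewrite orbT.
move=> w; apply: le_trans (path_cost_nseq _ _ s01 _ ok') _; first by rewrite e1.
have -> : (N%:R * s) *: e = t *: v.
  by rewrite Ns scalerA mulfK// gt_eqF.
rewrite Ns; apply: lerD.
  apply: (@le_trans _ _ (expR a * B * enorm v * (elapsed alpha t / alpha))).
    have h1 : t * expR (- a) <= elapsed alpha t / alpha.
      rewrite ler_pdivlMr// mulrC mulrA; apply: le_trans (elapsed_ge alpha t).
      apply: ler_wpM2l; first by apply: mulr_ge0; exact: ltW.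
      rewrite ler_expR.
      by rewrite mulNr lerN2; apply: le_trans alphaa; rewrite ler_piMr// ltW.
    have p0 : 0 <= expR a * B * enorm v by rewrite !mulr_ge0 ?expR_ge0// ltW.
    apply: le_trans (ler_wpM2l p0 h1).
    have -> : expR a * B * enorm v * (t * expR (- a)) =
      B * (t * enorm v) * (expR a * expR (- a)) by ring.
    by rewrite -expRD subrr expR0 mulr1.
  apply: disc_int_ge => //; first exact: continuous_running.
  by move=> r _; apply: LR; exact: ltW.
apply: ler_pM; rewrite ?expR_ge0 ?path_cost_ge0//.
rewrite ler_expR !mulNr lerN2 ler_pM2l// ler_peMr//; first exact: ltW.
by apply: le_trans R01 _; exact: ltW.
Qed.

Lemma value_adherent_slow w e : 0 < e ->
  exists l, [/\ path_ok l, path_slow R0 l & path_cost l w < value w + e].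
Proof.
move=> e0; have [l lok H] := value_adherent w e0.
have [l' [ok' slow' le']] := path_slow_down lok.
by exists l'; split => //; exact: le_lt_trans (le' w) H.
Qed.

(** Start at tau_y w and tau_(-y) w and correct the velocity by - y and + y
    until the offset vanishes at time 1, then follow the given path.  The running
    costs differ from twice the original by second differences of L. *)
Lemma path_cost_semiconcave l : path_ok l -> path_slow R0 l ->
  forall w y, enorm y <= 1 -> exists l1 l2, [/\ path_ok l1, path_ok l2 &
    path_cost l1 (tau y w) + path_cost l2 (tau (- y) w) - 2 * path_cost l w <=
      2 * C * enorm y ^+ 2].
Proof.
elim: l => [|[t v] l IH] /=.
  move=> _ _ w y _; exists [::], [::]; split => //=.
  have -> : A / alpha + A / alpha - 2 * (A / alpha) = 0 by ring.
  by rewrite !mulr_ge0 ?enorm_ge0//.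
move=> /andP[t01 lok] /andP[vR lslow] w y y1; have /andP[t0 t1] := t01.
pose y' := (1 - t) *: y.
have y'E : enorm y' = (1 - t) * enorm y by rewrite enormZ ger0_norm// subr_ge0.
have y'1 : enorm y' <= 1.
  by rewrite y'E; apply: le_trans y1; rewrite ler_piMl ?enorm_ge0// gerBl ltW.
have [l1 [l2 [ok1 ok2 H]]] := IH lok lslow (tau (t *: v) w) y' y'1.
exists ((t, v - y) :: l1), ((t, v + y) :: l2); split; rewrite /= ?t01//.
have pos1 s : tau (s *: (v - y)) (tau y w) = tau ((1 - s) *: y) (tau (s *: v) w).
  by rewrite -!(tauD tauP); congr tau; apply/rowP => i; rewrite !mxE; ring.
have pos2 s : tau (s *: (v + y)) (tau (- y) w) = tau (- ((1 - s) *: y)) (tau (s *: v) w).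
  by rewrite -!(tauD tauP); congr tau; apply/rowP => i; rewrite !mxE; ring.
rewrite pos1 pos2 -/y'.
have h1 : segment_cost t (v - y) (tau y w) + segment_cost t (v + y) (tau (- y) w)
   - 2 * segment_cost t v w <= 2 * C * enorm y ^+ 2 * t.
  rewrite -mulNr /segment_cost -disc_intZ -?disc_intD//; do ?exact: continuous_running.
  - have cr := @continuous_running.
    apply: disc_int_le_ge0 => //.
    + apply: continuous_add; first by apply: continuous_add; exact: cr.
      by apply: continuous_mul; [exact: continuous_cst|exact: cr].
    + by rewrite !mulr_ge0 ?enorm_ge0//.
    move=> s /andP[s0 st]; rewrite /running pos1 pos2.
    have hy : enorm ((1 - s) *: y) <= enorm y.
      rewrite enormZ ger0_norm ?subr_ge0; last exact: le_trans t1.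
      by rewrite ler_piMl ?enorm_ge0// gerBl.
    have := @LC v ((1 - s) *: y) (- y) (tau (s *: v) w) vR (le_trans hy y1).
    rewrite enormN opprK => /(_ y1); rewrite mulNr; move/le_trans; apply.
    have : enorm ((1 - s) *: y) ^+ 2 <= enorm y ^+ 2.
      by rewrite ler_sqr ?nnegrE ?enorm_ge0.
    move/(ler_wpM2l C0); lra.
  - by apply: continuous_add; exact: continuous_running.
  - by apply: continuous_mul; [exact: continuous_cst|exact: continuous_running].
have h2 := ler_wpM2l (expR_ge0 (- alpha * t)) H.
have h3 : expR (- alpha * t) * (2 * C * enorm y' ^+ 2) <= 2 * C * enorm y ^+ 2 * (1 - t).
  apply: (@le_trans _ _ (2 * C * enorm y' ^+ 2)).
    apply: ler_piMl; first by rewrite !mulr_ge0 ?enorm_ge0//.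
    by apply: expR_discount_le1; exact: ltW.
  rewrite y'E exprMn expr2.
  have : (1 - t) * (1 - t) <= 1 - t by rewrite ler_piMl; lra.
  have p0 : 0 <= 2 * C * enorm y ^+ 2 by rewrite !mulr_ge0 ?enorm_ge0//.
  by move/(ler_wpM2l p0); lra.
move: h1 h2 h3.
move: (segment_cost t (v - y) _) (segment_cost t (v + y) _) (segment_cost t v w).
move: (expR _) (path_cost l1 _) (path_cost l2 _) (path_cost l _) => x a1 a2 a3 b1 b2 b3.
lra.
Qed.

(** For |y| > 1 the Lipschitz bound is stronger than the quadratic one. *)
Lemma value_semiconcave w y :
  value (tau y w) + value (tau (- y) w) - 2 * value w <= (2 * B + 2 * C) * enorm y ^+ 2.
Proof.
have [y1|y1] := leP (enorm y) 1.
  apply/ler_addgt0Pr => e e0.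
  have e2 : 0 < e / 2 by rewrite divr_gt0.
  have [l [lok lslow Hl]] := value_adherent_slow w e2.
  have [l1 [l2 [ok1 ok2 H]]] := path_cost_semiconcave lok lslow w y1.
  have := value_le (tau y w) ok1; have := value_le (tau (- y) w) ok2.
  have := mulr_ge0 B0 (sqr_ge0 (enorm y)).
  lra.
have := value_lipschitz w y; have := value_lipschitz w (- y).
rewrite enormN !ler_norml => /andP[_ h1] /andP[_ h2].
have : enorm y <= enorm y ^+ 2.
  by rewrite expr2 ler_peMl ?enorm_ge0// ltW.
move=> /(ler_wpM2l B0).
have := mulr_ge0 C0 (sqr_ge0 (enorm y)); lra.
Qed.

End ValueFunction.

(** * Continuity of the value function *)

Section ValueContinuity.
Variables (R : realType) (n : nat) (Om : pmetricType R).
Variable tau : 'rV[R]_n -> Om -> Om.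
Variable L : 'rV[R]_n -> 'rV[R]_n -> Om -> R.
Hypothesis cO : compact [set: Om].
Hypothesis tauP : continuous_action tau.
Hypothesis LP : admissible_lagrangian tau L.
Local Notation E := 'rV[R]_n.
Variables (a alpha A B R0 : R).
Hypotheses (alpha0 : 0 < alpha) (alphaa : alpha <= a).
Hypothesis LA : forall w, L 0 0 w <= A.
Hypotheses (B0 : 0 <= B) (LB : forall v w, enorm v <= 1 -> L 0 v w <= B).
Hypotheses (R01 : 1 <= R0)
  (LR : forall v w, R0 <= enorm v -> expR a * B * enorm v <= L 0 v w).

Local Notation J := (path_cost tau L alpha A).
Local Notation cost := (segment_cost tau L alpha).
Local Notation value := (value tau L alpha A).

Let alpha_ge0 : 0 <= alpha. Proof. exact: ltW. Qed.

(** The induction step of [path_cost_modulus]: over a segment the tolerance grows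
    by the factor 1 + alpha t / 2 while the discount shrinks the remaining cost, and
    the constant (2 + alpha) / alpha is large enough for the discount to win. *)
Lemma discount_budget t : 0 < t <= 1 ->
  (1 + alpha * t / 2) * (elapsed alpha t / alpha + expR (- alpha * t) * ((2 + alpha) / alpha))
    <= (2 + alpha) / alpha.
Proof.
move=> /andP[t0 t1]; set x := alpha * t.
have x0 : 0 <= x by rewrite mulr_ge0// ltW.
have xa : x <= alpha by rewrite ler_piMr// ltW.
rewrite /elapsed mulNr -/x; set q := expR (- x).
have q0 : 0 <= q by exact: expR_ge0.
have qp : q <= (1 + x)^-1.
  by rewrite /q expRN lef_pV2 ?posrE ?expR_gt0 ?expR_ge1Dx//; lra.
have -> : (1 + x / 2) * ((1 - q) / alpha + q * ((2 + alpha) / alpha)) =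
    ((1 + x / 2) * (1 + (1 + alpha) * q)) / alpha by field; rewrite gt_eqF.
rewrite ler_pM2r ?invr_gt0//.
set p := (1 + x)^-1 in qp.
have p1 : p * (1 + x) = 1 by rewrite mulVf// gt_eqF//; lra.
have p0 : 0 <= p by rewrite invr_ge0; lra.
have h1 : (1 + x / 2) * ((1 + alpha) * q) <= (1 + x / 2) * ((1 + alpha) * p).
  by apply: ler_wpM2l; first lra; apply: ler_wpM2l => //; lra.
have h2 : x / 2 * 1 <= x / 2 * (p * (1 + alpha)).
  by apply: ler_wpM2l; first lra; rewrite -p1 ler_wpM2l//; lra.
have h3 : (1 + x / 2) * p = 1 - x / 2 * p by lra.
have h4 : (1 + x / 2) * ((1 + alpha) * p) = (1 + alpha) * (1 - x / 2 * p).
  by rewrite -h3; ring.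
lra.
Qed.

(** Orbits of two nearby points may separate, so costs can only be compared with
    a tolerance that grows with the distance travelled.  Linear growth of rate
    alpha / (2 r) at speeds up to r is beaten by the exponential discount. *)
Lemma path_cost_modulus (r eta : R) l w1 w2 : 0 < r -> 0 <= eta ->
  path_ok l -> path_slow r l ->
  (forall y v, enorm v <= r ->
    `|L 0 v (tau y w1) - L 0 v (tau y w2)| <= eta * (1 + alpha / (2 * r) * enorm y)) ->
  `|J l w1 - J l w2| <= (2 + alpha) / alpha * eta.
Proof.
move=> r0; elim: l w1 w2 eta => [|[t v] l IH] w1 w2 eta eta0 /=.
  move=> _ _ _; rewrite subrr normr0; apply: mulr_ge0 => //.
  by apply: divr_ge0 => //; exact: addr_ge0.
move=> /andP[t01 lok] /andP[vr lslow] H; have /andP[t0 t1] := t01.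
set b := alpha / (2 * r) in H IH.
have r_ge0 : 0 <= r by exact: ltW.
have b0 : 0 <= b by apply: divr_ge0 => //; exact: mulr_ge0.
have btr : b * (t * r) = alpha * t / 2 by rewrite /b; field; rewrite gt_eqF.
have tl : `|J l (tau (t *: v) w1) - J l (tau (t *: v) w2)| <=
    (2 + alpha) / alpha * (eta * (1 + alpha * t / 2)).
  apply: IH => //.
    apply: mulr_ge0 => //; apply: addr_ge0 => //; rewrite -btr.
    by apply: mulr_ge0 => //; apply: mulr_ge0 => //; exact: ltW.
  move=> y v' v'r; rewrite -!(tauD tauP).
  apply: le_trans (H _ _ v'r) _; rewrite -mulrA ler_wpM2l// -btr.
  have h1 : enorm (y + t *: v) <= enorm y + t * r.
    apply: le_trans (ler_enormD _ _) _; rewrite lerD2l enormZ ger0_norm; last exact: ltW.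
    by rewrite ler_pM2l.
  have h2 : 0 <= (b * (t * r)) * (b * enorm y).
    apply: mulr_ge0; last by rewrite mulr_ge0 ?enorm_ge0.
    by apply: mulr_ge0 => //; apply: mulr_ge0 => //; exact: ltW.
  move/(ler_wpM2l b0): h1; lra.
have cd : `|cost t v w1 - cost t v w2| <=
    eta * (1 + alpha * t / 2) * (elapsed alpha t / alpha).
  have cr := continuous_running tauP LP.
  have Hs s : 0 <= s <= t -> `|running tau L v w1 s - running tau L v w2 s|
       <= eta * (1 + alpha * t / 2).
    move=> /andP[s0 st]; apply: le_trans (H _ _ vr) _; rewrite ler_wpM2l// lerD2l -btr.
    by rewrite ler_wpM2l// enormZ ger0_norm// ler_pM ?enorm_ge0.
  exact: disc_int_dist.
have -> : cost t v w1 + expR (- alpha * t) * J l (tau (t *: v) w1)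
   - (cost t v w2 + expR (- alpha * t) * J l (tau (t *: v) w2)) =
   (cost t v w1 - cost t v w2) +
   expR (- alpha * t) * (J l (tau (t *: v) w1) - J l (tau (t *: v) w2)) by ring.
apply: le_trans (ler_normD _ _) _; rewrite normrM (ger0_norm (expR_ge0 _)).
have h1 := ler_wpM2l (expR_ge0 (- alpha * t)) tl.
have h2 := ler_wpM2l eta0 (discount_budget t01).
lra.
Qed.

(** For |y| large the right-hand side exceeds the bound on L; the remaining y
    form a compact set, on which continuity is uniform. *)
Lemma near_modulus (r b eta : R) w1 : 0 < b -> 0 < eta ->
  \forall w2 \near w1, forall y v, enorm v <= r ->
    `|L 0 v (tau y w1) - L 0 v (tau y w2)| <= eta * (1 + b * enorm y).
Proof.
move=> b0 eta0.
have [M M0 HM] := lagrangian_bounded cO LP r.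
have L0 := lagrangian_ge0 LP.
pose K := [set v : E | enorm v <= r] `*` [set y : E | enorm y <= M / (eta * b)].
have cK : compact K by apply: compact_setX; exact: compact_eball.
have cF : continuous (fun x : (E * E) * Om => L 0 x.1.1 (tau x.1.2 x.2)).
  have cf : continuous (fun x : (E * E) * Om => (x.1.1, tau x.1.2 x.2) : E * Om).
    apply: continuous_pair.
      exact: (continuous_compose (@continuous_fst _ _) (@continuous_fst _ _)).
    have cg : continuous (fun x : (E * E) * Om => (x.1.2, x.2) : E * Om).
      apply: continuous_pair; last exact: continuous_snd.
      exact: (continuous_compose (@continuous_fst _ _) (@continuous_snd _ _)).
    exact: (continuous_compose cg (continuous_tau2 tauP)).
  exact: (continuous_compose cf (continuous_lagrangian0 LP)).
apply: filterS (tube w1 cF cK eta0) => w2 /= H y v vr.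
have eb : 0 < eta * b by rewrite mulr_gt0.
have [yr|yr] := leP (enorm y) (M / (eta * b)).
  apply: le_trans (ltW (H (v, y) _)) _; first by split.
  apply: ler_peMr; first exact: ltW.
  by rewrite lerDl mulr_ge0 ?enorm_ge0// ltW.
rewrite ltr_pdivrMr// in yr.
have := HM v (tau y w1) vr; have := HM v (tau y w2) vr.
have := L0 0 v (tau y w1); have := L0 0 v (tau y w2).
rewrite ler_norml => ? ? ? ?; apply/andP; split; lra.
Qed.

Lemma path_slow_exists (l : seq (R * E)) : exists2 r, 0 < r & path_slow r l.
Proof.
elim: l => [|[t v] l [r r0 IH]]; first by exists 1.
exists (Num.max r (enorm v)); first by rewrite lt_max r0.
rewrite /= le_max lexx orbT /=; apply: sub_all IH => x /= xr.
by rewrite le_max xr.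
Qed.

Lemma path_cost_near (r e : R) w1 : 0 < r -> 0 < e ->
  \forall w2 \near w1, forall l, path_ok l -> path_slow r l -> `|J l w1 - J l w2| < e.
Proof.
move=> r0 e0.
pose k := (2 + alpha) / alpha.
have k0 : 0 < k by rewrite divr_gt0// addr_gt0.
have b0 : 0 < alpha / (2 * r) by rewrite divr_gt0// mulr_gt0.
have eta0 : 0 < e / (2 * k) by rewrite divr_gt0// mulr_gt0.
apply: filterS (near_modulus r w1 b0 eta0) => w2 H l lok lslow.
apply: le_lt_trans (path_cost_modulus r0 (ltW eta0) lok lslow H) _.
have -> : (2 + alpha) / alpha * (e / (2 * k)) = e / 2.
  by rewrite -/k; field; rewrite gt_eqF.
lra.
Qed.

Lemma path_cost_continuous l : path_ok l -> continuous (J l).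
Proof.
move=> lok w1; have [r r0 lslow] := path_slow_exists l.
apply/cvgrPdist_lt => e e0; apply: filterS (path_cost_near w1 r0 e0) => w2.
exact.
Qed.

Lemma value_continuous : continuous value.
Proof.
move=> w1; apply/cvgrPdist_lt => e e0.
have e2 : 0 < e / 2 by rewrite divr_gt0.
have R00 : 0 < R0 by exact: lt_le_trans R01.
apply: filterS (path_cost_near w1 R00 e2) => w2 H.
have V w := value_adherent_slow tauP LP alpha0 alphaa LA B0 LB R01 LR w e2.
have [l1 [ok1 s1 h1]] := V w1; have [l2 [ok2 s2 h2]] := V w2.
have := H _ ok1 s1; have := H _ ok2 s2.
have := value_le tauP LP alpha0 LA w2 ok1.
have := value_le tauP LP alpha0 LA w1 ok2.
rewrite !ltr_norml => ? ? /andP[? ?] /andP[? ?]; apply/andP; split; lra.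
Qed.

Lemma value_subsolution v w d : 0 < d -> exists2 t0, 0 < t0 & forall t, 0 < t <= t0 ->
  value w <= t * (L 0 v w + d) + expR (- alpha * t) * value (tau (t *: v) w).
Proof.
move=> d0.
have /cvgrPdist_lt/(_ _ d0)/nbhs_ballP[e e0 He] := continuous_running tauP LP (v := v) (w := w) (x := 0).
exists (Num.min 1 (e / 2)); first by rewrite lt_min ltr01 divr_gt0.
move=> t /andP[t0]; rewrite le_min => /andP[t1 te].
have t01 : 0 < t <= 1 by rewrite t0.
apply: le_trans (value_step tauP LP alpha0 LA v w t01) _; rewrite lerD2r mulrC.
have L0 := lagrangian_ge0 LP.
apply: disc_int_le_ge0 => //.
- exact: continuous_running.
- by rewrite addr_ge0// ltW.
move=> s /andP[s0 st].
have : ball 0 e s.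
  rewrite /ball /= sub0r normrN ger0_norm//; apply: le_lt_trans st _.
  by apply: le_lt_trans te _; rewrite ltr_pdivrMr// ltr_pMr// ltr1n.
move/He; rewrite /= {1}/running scale0r tau0// ltr_norml => /andP[? ?]; lra.
Qed.

End ValueContinuity.

(** * Borel measurability *)

Section BorelMeasurability.
Variable R : realType.

Lemma open_borel (T : ptopologicalType) (U : set T) :
  open U -> measurable (U : set (borel T)).
Proof. by move=> oU; exact: sub_sigma_algebra. Qed.

Lemma measurable_to_borel d (S : measurableType d) (T : ptopologicalType) (D : set S)
    (f : S -> borel T) : measurable D ->
  (forall U : set T, open U -> measurable (D `&` f @^-1` U)) -> measurable_fun D f.
Proof.
move=> mD H.
apply: (@measurability _ _ S (borel T) D f (@open T) erefl) => _ [U oU <-].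
exact: H.
Qed.

Lemma continuous_borel_measurable (T U : ptopologicalType) (f : T -> U) :
  continuous f -> measurable_fun setT (f : borel T -> borel U).
Proof.
move=> cf; apply: measurable_to_borel => // V oV; rewrite setTI.
by apply: open_borel; apply: open_comp => // x _; exact: cf.
Qed.

Lemma continuous_real_measurable (T : ptopologicalType) (f : T -> R) :
  continuous f -> measurable_fun setT (f : borel T -> R).
Proof.
move=> cf; apply: (measurability _ (RGenOInfty.measurableE R)) => //.
move=> _ [_ [x ->] <-]; rewrite setTI.
apply: open_borel; rewrite set_itvE; apply: (open_comp (f := f)).
  by move=> y _; exact: cf.
exact: open_gt.
Qed.

(** The second factor being second countable, an open set of a product is a
    countable union of open rectangles. *)
Lemma open_prod_measurable (T : ptopologicalType) (W : set (T * R)) :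
  open W -> measurable (W : set (borel T * measurableTypeR R)).
Proof.
move=> oW.
pose I (q r : rat) : set R := `](ratr q - ratr r)%R, (ratr q + ratr r)%R[%classic.
pose A (q r : rat) : set T := interior [set w | forall s, I q r s -> W (w, s)].
have -> : W = \bigcup_q \bigcup_r (A q r `*` I q r).
  apply/seteqP; split => [[w s] Ws|[w s] [q _ [r _ [/= Aw Is]]]]; last first.
    exact: (interior_subset Aw).
  have [[N1 N2] /= [wN1 sN2] sub] : nbhs (w, s) W by exact: open_nbhs_nbhs.
  have /nbhs_ballP[e /= e0 eN2] := sN2.
  have [r] : exists r : rat, (0 : R) < ratr r < e / 2.
    have [r re] := rat_in_itvoo (divr_gt0 e0 (ltr0n R 2)).
    by exists r; move: re; rewrite in_itv.
  case/andP => r0 re.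
  have [q] : exists q : rat, s - ratr r < ratr q < s + ratr r.
    have [|q qs] := @rat_in_itvoo R (s - ratr r) (s + ratr r); first by lra.
    by exists q; move: qs; rewrite in_itv.
  case/andP => q1 q2.
  exists q => //; exists r => //; split => /=; last first.
    by rewrite /I /= in_itv /=; apply/andP; split; lra.
  apply: filterS wN1 => x N1x y; rewrite /I /= in_itv /= => /andP[y1 y2].
  apply: (sub (x, y)); split => //=; apply: eN2.
  by rewrite /ball /= ltr_norml; apply/andP; split; lra.
apply: bigcupT_measurable_rat => q; apply: bigcupT_measurable_rat => r.
apply: measurableX; first by apply: open_borel; exact: open_interior.
exact: measurable_itv.
Qed.

End BorelMeasurability.

(** * Occupation means of a path *)

Section OccupationMean.
Variables (R : realType) (n : nat) (Om : pmetricType R).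
Variable tau : 'rV[R]_n -> Om -> Om.
Hypothesis tauP : continuous_action tau.
Local Notation E := 'rV[R]_n.
Variable alpha : R.
Hypothesis alpha0 : 0 < alpha.

Implicit Types (l : seq (R * E)) (F : E * Om -> R) (w : Om) (v : E) (t : R).

(** The alpha-discounted time average of F along the path and the rest that
    follows it: the weights alpha exp (- alpha s) ds have total mass 1. *)
Fixpoint occ_mean (l : seq (R * E)) (F : E * Om -> R) (w : Om) : R :=
  if l is (t, v) :: l' then
    alpha * disc_int alpha t (fun s => F (v, tau (s *: v) w)) +
    expR (- alpha * t) * occ_mean l' F (tau (t *: v) w)
  else F (0, w).

Lemma continuous_along (F : E * Om -> R) v w : continuous F ->
  continuous (fun s : R => F (v, tau (s *: v) w)).
Proof.
move=> cF.
have cf : continuous (fun s : R => (v, tau (s *: v) w) : E * Om).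
  apply: continuous_pair; first exact: continuous_cst.
  exact: continuous_scale_orbit.
exact: (continuous_compose cf cF).
Qed.

Lemma disc_int_continuous t (G : R * Om -> R) : 0 < t <= 1 -> continuous G ->
  continuous (fun w => disc_int alpha t (fun s => G (s, w))).
Proof.
move=> t01 cG w; apply/cvgrPdist_lt => e e0.
have k0 : 0 < elapsed alpha t / alpha.
  by rewrite divr_gt0// elapsed_gt0//; case/andP: t01.
have e1 : 0 < e / (2 * (elapsed alpha t / alpha)) by rewrite divr_gt0// mulr_gt0.
have cs x : continuous (fun s : R => G (s, x)).
  have cf : continuous (fun s : R => (s, x) : R * Om).
    by apply: continuous_pair; [move=> ?; exact: cvg_id|exact: continuous_cst].
  exact: (continuous_compose cf cG).
apply: filterS (tube w cG (@segment_compact R 0 t) e1) => w' H.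
apply: (@le_lt_trans _ _ (e / 2)); last by rewrite ltr_pdivrMr// ltr_pMr// ltr1n.
have -> : e / 2 = e / (2 * (elapsed alpha t / alpha)) * (elapsed alpha t / alpha).
  move: (elapsed alpha t / alpha) k0 => k k0; field; rewrite gt_eqF//.
apply: disc_int_dist => // s st; apply: ltW; apply: H.
by rewrite /= in_itv.
Qed.

Lemma disc_along_continuous t F v : 0 < t <= 1 -> continuous F ->
  continuous (fun w => disc_int alpha t (fun s => F (v, tau (s *: v) w))).
Proof.
move=> t01 cF.
have cf : continuous (fun x : R * Om => (v, tau (x.1 *: v) x.2) : E * Om).
  apply: continuous_pair; first exact: continuous_cst.
  have cg : continuous (fun x : R * Om => (x.1 *: v, x.2) : E * Om).
    apply: continuous_pair; last exact: continuous_snd.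
    have cs : continuous (fun s : R => s *: v) by exact: scalel_continuous.
    exact: (continuous_compose (@continuous_fst _ _) cs).
  exact: (continuous_compose cg (continuous_tau2 tauP)).
exact: (disc_int_continuous t01 (continuous_compose cf cF)).
Qed.

Lemma occ_mean_continuous l F : path_ok l -> continuous F -> continuous (occ_mean l F).
Proof.
move=> + cF; elim: l => [|[t v] l IH] /=.
  move=> _; have cf : continuous (fun w : Om => (0, w) : E * Om).
    by apply: continuous_pair; [exact: continuous_cst|move=> ?; exact: cvg_id].
  exact: (continuous_compose cf cF).
move=> /andP[t01 lok]; apply: continuous_add; apply: continuous_mul.
- exact: continuous_cst.
- exact: disc_along_continuous.
- exact: continuous_cst.
- exact: (continuous_compose (continuous_tau tauP (x := t *: v)) (IH lok)).
Qed.

Lemma occ_mean_ge0 l F w : path_ok l -> continuous F -> (forall z, 0 <= F z) ->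
  0 <= occ_mean l F w.
Proof.
move=> + cF F0; elim: l w => [|[t v] l IH] w //= /andP[t01 lok].
apply: addr_ge0; apply: mulr_ge0.
- exact: ltW.
- by apply: disc_int_ge0 => //; exact: continuous_along.
- exact: expR_ge0.
- exact: IH.
Qed.

Lemma occ_meanB l F1 F2 w : path_ok l -> continuous F1 -> continuous F2 ->
  occ_mean l (fun z => F1 z - F2 z) w = occ_mean l F1 w - occ_mean l F2 w.
Proof.
move=> + c1 c2; elim: l w => [|[t v] l IH] w //= /andP[t01 lok].
rewrite IH//.
have -> : (fun s => F1 (v, tau (s *: v) w) - F2 (v, tau (s *: v) w)) =
    (fun s => F1 (v, tau (s *: v) w) + -1 * F2 (v, tau (s *: v) w)).
  by apply/funext => s; rewrite mulN1r.
have cc := @continuous_along.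
rewrite disc_intD ?disc_intZ//; try exact: cc; first by ring.
by apply: continuous_mul; [exact: continuous_cst|exact: cc].
Qed.

Lemma disc_int_cst t M : 0 < t <= 1 -> disc_int alpha t (fun=> M) = M * (elapsed alpha t / alpha).
Proof.
move=> t01; apply/eqP; rewrite eq_le disc_int_le ?disc_int_ge//; exact: continuous_cst.
Qed.

Lemma occ_mean1 l w : path_ok l -> occ_mean l (fun=> 1) w = 1.
Proof.
elim: l w => [|[t v] l IH] w //= /andP[t01 lok].
rewrite IH// disc_int_cst// mul1r mulr1 /elapsed; field; rewrite gt_eqF//.
Qed.

Lemma occ_mean_lagrangian (L : E -> E -> Om -> R) A l w :
  (forall w, L 0 0 w <= A) -> path_ok l ->
  occ_mean l (fun z => L 0 z.1 z.2) w <= alpha * path_cost tau L alpha A l w.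
Proof.
move=> LA; elim: l w => [|[t v] l IH] w /=.
  by rewrite mulrC divfK ?gt_eqF.
move=> /andP[t01 lok]; rewrite mulrDr lerD2l mulrCA.
by rewrite ler_wpM2l ?expR_ge0// IH.
Qed.

(** exp (- alpha s) (k' - alpha k) is the derivative of exp (- alpha s) k; after
    the change of variable its primitive is (1 - r) k(clock r). *)
Lemma disc_int_derivative t (k dk : R -> R) : 0 < t <= 1 ->
  (forall s, is_derive s (1 : R) k (dk s)) -> continuous dk ->
  alpha * disc_int alpha t (fun s => dk s - alpha * k s) =
    alpha * (expR (- alpha * t) * k t - k 0).
Proof.
move=> /andP[t0 t1] dkP cdk.
have ck : continuous k.
  by move=> s; apply: differentiable_continuous; apply/derivable1_diffP; apply: ex_derive.
pose G (r : R) := alpha * ((1 - r) * k (- ln (1 - r) / alpha)).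
pose g (r : R) := - ln (1 - r) / alpha.
have dG (r : R) : r < 1 -> is_derive r (1 : R) G (dk (g r) - alpha * k (g r)).
  move=> r1; have r0 : 0 < 1 - r by rewrite subr_gt0.
  have d1 : is_derive r (1 : R) (fun r : R => 1 - r) (-1).
    by rewrite -[X in is_derive _ _ _ X]sub0r; apply: is_deriveB.
  have dln : is_derive r (1 : R) (fun r => ln (1 - r)) ((1 - r)^-1 * -1).
    exact: (@is_derive1_comp R (@ln R) (fun r => 1 - r) r _ _ (is_derive1_ln r0) d1).
  have dg : is_derive r (1 : R) g ((1 - r)^-1 / alpha).
    have -> : g = (- alpha^-1) \*: (fun r => ln (1 - r)).
      by apply/funext => x; rewrite /g mulrC mulrN -mulNr.
    have -> : (1 - r)^-1 / alpha = (- alpha^-1) *: ((1 - r)^-1 * -1) :> R.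
      by rewrite /GRing.scale /=; ring.
    exact: is_deriveZ.
  have dkg := @is_derive1_comp R k g r _ _ (dkP (g r)) dg.
  have dm := is_deriveM d1 dkg.
  have -> : G = alpha \*: ((fun r => 1 - r) * (k \o g)) by [].
  have -> : dk (g r) - alpha * k (g r) =
     alpha *: ((1 - r) *: (dk (g r) * ((1 - r)^-1 / alpha)) + (k \o g) r *: (-1)) :> R.
    by rewrite /GRing.scale /=; field; rewrite !gt_eqF.
  exact: is_deriveZ.
have cG (r : R) : r < 1 -> {for r, continuous G}.
  move=> r1; apply: differentiable_continuous; apply/derivable1_diffP.
  by have := dG r r1 => H; apply: ex_derive.
have e1 : elapsed alpha t < 1 by rewrite /elapsed gtrBl expR_gt0.
have e0 : 0 < elapsed alpha t by exact: elapsed_gt0.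
rewrite /disc_int mulrA mulfV ?gt_eqF// mul1r /Rintegral.
rewrite (@continuous_FTC2 R (fun r => dk (clock alpha r) - alpha * k (clock alpha r)) G)//.
- rewrite -EFinB /= /G subr0 ln1 oppr0 mul0r mul1r -(clockE alpha0 t1 (lexx _)).
  by rewrite (clock_elapsed alpha0 t1) /elapsed; ring.
- apply: continuous_subspaceT.
  have ch : continuous (fun s => dk s - alpha * k s).
    apply: continuous_sub => //; apply: continuous_mul => //.
    exact: continuous_cst.
  have cc := continuous_compose (@continuous_clock R alpha) ch.
  exact: cc.
- split.
  + by move=> r; rewrite in_itv /= => /andP[_ r1]; have := dG r (lt_trans r1 e1) => H; apply: ex_derive.
  + by apply: cvg_at_right_filter; apply: cG.
  + by apply: cvg_at_left_filter; apply: cG.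
- move=> r; rewrite in_itv /= => /andP[r0 r1].
  rewrite derive1E (clockE alpha0 t1 (ltW r1)).
  by have := dG r (lt_trans r1 e1) => H; rewrite derive_val.
Qed.

(** The flux v.p - alpha f is, along a path, the derivative of the discounted
    value of f, so its average telescopes to the initial value. *)
Lemma occ_mean_constraint (f : Om -> R) (p : Om -> E) l w :
  continuous f -> continuous p ->
  (forall v w s, is_derive s (1 : R) (fun s => f (tau (s *: v) w))
     (dotv v (p (tau (s *: v) w)))) ->
  path_ok l ->
  occ_mean l (fun z => dotv z.1 (p z.2) - alpha * f z.2) w = - alpha * f w.
Proof.
move=> cf cp fp; elim: l w => [|[t v] l IH] w /=; first by rewrite dotv0l sub0r mulNr.
move=> /andP[t01 lok]; rewrite IH//.
rewrite (@disc_int_derivative t (fun s => f (tau (s *: v) w)) _ t01 (fp v w)).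
  by rewrite scale0r tau0//; ring.
apply: (@continuous_along (fun z => dotv z.1 (p z.2)) v w).
apply: continuous_dotv; first exact: continuous_fst.
exact: (continuous_compose (@continuous_snd _ _) cp).
Qed.

End OccupationMean.

(** * Occupation measures *)

Section CompetitorMeasure.
Variables (R : realType) (n : nat) (Om : pmetricType R).
Variable tau : 'rV[R]_n -> Om -> Om.
Hypothesis cO : compact [set: Om].
Hypothesis tauP : continuous_action tau.
Local Notation E := 'rV[R]_n.
Local Notation X := (borel (E * Om)%type).
Local Notation Y := (borel Om).
Variable alpha : R.
Hypothesis alpha0 : 0 < alpha.
Implicit Types (F : E * Om -> R).

Lemma finite_measure_pack d (T : measurableType d) (m : {measure set T -> \bar R}) :
  (m setT < +oo)%E ->
  exists m' : {finite_measure set T -> \bar R}, m' = m :> (set T -> \bar R).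
Proof.
move=> moo; exists (mfrestr measurableT moo).
by apply/funext => A; rewrite /= /mfrestr /mrestr setIT.
Qed.

Lemma continuous_EFin_measurable (T : ptopologicalType) (f : T -> R) :
  continuous f -> measurable_fun setT (fun z : borel T => (f z)%:E).
Proof. by move=> cf; apply/measurable_EFinP; exact: continuous_real_measurable. Qed.

(** Up to the factor elapsed t, the push-forward of nu times a uniform law on
    [0, elapsed t], the time along the segment being read off the clock. *)
Lemma segment_measure t v (nu : {finite_measure set Y -> \bar R}) : 0 < t <= 1 ->
  exists m : {measure set X -> \bar R}, forall F, continuous F -> (forall z, 0 <= F z) ->
   (\int[m]_z (F z)%:E =
    \int[nu]_w (alpha * disc_int alpha t (fun s => F (v, tau (s *: v) w)))%:E)%E.
Proof.
move=> t01; have /andP[t0 t1] := t01.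
have e0 : 0 < elapsed alpha t by exact: elapsed_gt0.
pose P := uniform_prob e0.
pose Psi (x : Y * measurableTypeR R) : X := (v, tau (clock alpha x.2 *: v) x.1).
have cPsi : continuous (fun x : Om * R => (v, tau (clock alpha x.2 *: v) x.1) : E * Om).
  apply: continuous_pair; first exact: continuous_cst.
  have cg : continuous (fun x : Om * R => (clock alpha x.2 *: v, x.1) : E * Om).
    apply: continuous_pair; last exact: continuous_fst.
    have cs : continuous (fun s : R => s *: v) by exact: scalel_continuous.
    have cc := continuous_compose (@continuous_clock R alpha) cs.
    exact: (continuous_compose (@continuous_snd _ _) cc).
  exact: (continuous_compose cg (continuous_tau2 tauP)).
have mPsi : measurable_fun setT Psi.
  apply: measurable_to_borel => // U oU; rewrite setTI.
  apply: (@open_prod_measurable R Om (Psi @^-1` U)).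
  by move/continuousP : cPsi; exact.
pose m0 := measure_function_pushforward__canonical__measure_function_Measure (nu \x P)%E mPsi.
exists (mscale (NngNum (ltW e0)) m0) => F cF F0.
have mF := continuous_EFin_measurable cF.
rewrite ge0_integral_mscale//=; last by move=> z _; rewrite lee_fin.
rewrite ge0_integral_pushforward//=; last by move=> z _; rewrite lee_fin.
have mFP : measurable_fun setT (fun x => (F (Psi x))%:E).
  exact: (measurableT_comp mF mPsi).
rewrite preimage_setT fubini_tonelli1//=; last by move=> z; rewrite lee_fin.
rewrite -ge0_integralZl//=; last first.
- by rewrite lee_fin ltW.
- by move=> w _; apply: integral_ge0 => r _; rewrite lee_fin.
- by apply: measurable_fun_fubini_tonelli_F => // x; rewrite lee_fin.
apply: eq_integral => w _; rewrite /fubini_F.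
have cFr : continuous (fun s : R => F (v, tau (s *: v) w)).
  exact: (@continuous_along _ _ _ _ tauP F v w cF).
rewrite integral_uniform//=; last first.
- by move=> r; rewrite lee_fin.
- apply/measurable_EFinP; apply: continuous_measurable_fun.
  exact: (continuous_compose (@continuous_clock R alpha) cFr).
rewrite subr0 muleA -EFinM mulfV ?gt_eqF// mul1e /disc_int mulrA mulfV ?gt_eqF// mul1r.
rewrite /Rintegral fineK//; apply: integrable_fin_num => //.
exact: (@integrable_clock R alpha t _ cFr).
Qed.

Lemma occupation_measure l (nu : {finite_measure set Y -> \bar R}) : path_ok l ->
  exists m : {measure set X -> \bar R}, forall F, continuous F -> (forall z, 0 <= F z) ->
   (\int[m]_z (F z)%:E = \int[nu]_w (occ_mean tau alpha l F w)%:E)%E.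
Proof.
elim: l nu => [|[t v] l IH] nu /=.
  move=> _; pose g (w : Y) : X := (0, w).
  have mg : measurable_fun setT g.
    apply: (@continuous_borel_measurable Om (E * Om)%type).
    by apply: continuous_pair; [exact: continuous_cst|move=> ?; exact: cvg_id].
  exists (measure_function_pushforward__canonical__measure_function_Measure nu mg).
  move=> F cF F0; rewrite ge0_integral_pushforward//=.
  - exact: continuous_EFin_measurable.
  - by move=> z _; rewrite lee_fin.
move=> /andP[t01 lok]; have /andP[t0 t1] := t01.
have [m1 H1] := segment_measure v nu t01.
have mt : measurable_fun setT (tau (t *: v) : Y -> Y).
  by apply: continuous_borel_measurable; exact: continuous_tau.
pose nu0 := measure_function_pushforward__canonical__measure_function_Measure nu mt.
have [|nu1 nu1E] := @finite_measure_pack _ _ nu0.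
  by rewrite /nu0 /= /pushforward preimage_setT -ge0_fin_numE// fin_num_measure.
have [m2 H2] := IH nu1 lok.
exists (measure_add m1 (mscale (NngNum (expR_ge0 (- alpha * t))) m2)) => F cF F0.
have mF := continuous_EFin_measurable cF.
have F0' z : (0 <= (F z)%:E)%E by rewrite lee_fin.
rewrite ge0_integral_measure_add// ge0_integral_mscale//= H1// H2//.
have co := occ_mean_continuous tauP alpha0 lok cF.
have mo := continuous_EFin_measurable co.
have oc0 w : 0 <= occ_mean tau alpha l F w by exact: occ_mean_ge0.
rewrite nu1E ge0_integral_pushforward//=; last by move=> w _; rewrite lee_fin.
have mot := measurableT_comp mo mt.
rewrite preimage_setT -ge0_integralZl//=; last by move=> w _; rewrite lee_fin.
rewrite -ge0_integralD//=.
- move=> w _; rewrite lee_fin; apply: mulr_ge0; first exact: ltW.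
  apply: disc_int_ge0 => //; exact: (@continuous_along _ _ _ _ tauP F v w cF).
- apply: continuous_EFin_measurable.
  apply: continuous_mul; first exact: continuous_cst.
  exact: (@disc_along_continuous R n Om tau tauP alpha alpha0 t F v t01 cF).
- by move=> w _; rewrite -EFinM lee_fin mulr_ge0// expR_ge0.
- by apply: measurable_funeM.
Qed.

End CompetitorMeasure.

(** * Upper bound for the minimal action *)

Section TestFunctions.
Variables (R : realType) (n : nat) (Om : pmetricType R).
Variable tau : 'rV[R]_n -> Om -> Om.
Local Notation E := 'rV[R]_n.

Lemma derive_grad (k : E -> R) x v : differentiable k x -> 'D_v k x = dotv v (grad k x).
Proof.
move=> dk.
have span (z : E) : z = \sum_i z 0 i *: delta_mx 0 i by exact: row_sum_delta.
rewrite (derive_lin (b := fun i => delta_mx 0 i) (c := fun i (z : E) => z 0 i) span _ dk).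
by apply: eq_bigr => i _; rewrite mxE.
Qed.

Lemma derive_shift (k : E -> R) x u : 'D_u (fun y => k (y + x)) 0 = 'D_u k x.
Proof.
have E1 : (fun h : R => h^-1 *: (k (h *: u + 0 + x) - k (0 + x))) =
    (fun h : R => h^-1 *: (k (h *: u + x) - k x)).
  by apply/funext => h; rewrite addr0 add0r.
by rewrite /derive /= E1.
Qed.

Lemma C1s_orbit_derivative phi : C1s tau phi ->
  forall v w s, is_derive s (1 : R) (fun s => phi 0 (tau (s *: v) w))
     (dotv v (grad (phi ^~ (tau (s *: v) w)) 0)).
Proof.
move=> [stat dphi _ _] v w s.
have phiE x : phi 0 (tau x w) = phi x w by rewrite -stat add0r.
have -> : (fun s : R => phi 0 (tau (s *: v) w)) = (fun s : R => (phi ^~ w) (0 + s *: v)).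
  by apply/funext => r; rewrite phiE add0r.
have [dw _] := dphi w.
have := is_derive_line (dw (0 + s *: v)).
rewrite derive_grad//; congr (is_derive _ _ _ (dotv _ _)).
have -> : phi ^~ (tau (s *: v) w) = (fun y => (phi ^~ w) (y + s *: v)).
  by apply/funext => y; rewrite stat.
by apply/rowP => i; rewrite !mxE (derive_shift (phi ^~ w)) add0r.
Qed.

End TestFunctions.

Section Reachable.
Variables (R : realType) (n : nat) (Om : pmetricType R).
Variable tau : 'rV[R]_n -> Om -> Om.
Variable L : 'rV[R]_n -> 'rV[R]_n -> Om -> R.
Hypothesis cO : compact [set: Om].
Hypothesis tauP : continuous_action tau.
Hypothesis LP : admissible_lagrangian tau L.
Local Notation E := 'rV[R]_n.
Local Notation X := (borel (E * Om)%type).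
Local Notation Y := (borel Om).
Variables (alpha A : R).
Hypothesis alpha0 : 0 < alpha.
Hypothesis LA : forall w, L 0 0 w <= A.
Local Notation J := (path_cost tau L alpha A).

Lemma finite_lt (nu : {finite_measure set Y -> \bar R}) : (nu setT < +oo)%E.
Proof. by rewrite -ge0_fin_numE// fin_num_measure. Qed.

Lemma continuous_integrable (nu : {finite_measure set Y -> \bar R}) (g : Om -> R) :
  continuous g -> nu.-integrable setT (EFin \o (g : Y -> R)).
Proof.
move=> cg; apply: measurable_bounded_integrable => //.
- exact: finite_lt.
- exact: continuous_real_measurable.
have [M M0 bM] := compact_continuous_bounded cO cg.
exists M; split; first exact: num_real.
by move=> x Mx w _ /=; apply: le_trans (bM w _) (ltW Mx).
Qed.

Definition discounted_flux (phi : E -> Om -> R) (z : E * Om) : R :=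
  dotv z.1 (grad (phi ^~ z.2) 0) - alpha * phi 0 z.2.

(** The quantification over all finite measures nu, not only the given
    probability, is what allows the base space to be cut into pieces
    ([reachable_min]). *)
Definition reachable (g : Om -> R) : Prop :=
  forall nu : {finite_measure set Y -> \bar R},
  exists m : {measure set X -> \bar R}, [/\ m setT = nu setT,
    (forall phi, C1s tau phi -> m.-integrable setT (EFin \o (discounted_flux phi : X -> R)) /\
      (\int[m]_z (discounted_flux phi z)%:E = (- alpha)%:E * \int[nu]_w (phi 0 w)%:E)%E) &
    (\int[m]_z (L 0 z.1 z.2)%:E <= alpha%:E * \int[nu]_w (g w)%:E)%E].

Lemma continuous_flux phi : C1s tau phi -> continuous (discounted_flux phi).
Proof.
move=> [_ _ cphi cgrad]; apply: continuous_sub.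
  apply: continuous_dotv; first exact: continuous_fst.
  exact: (continuous_compose (@continuous_snd _ _) cgrad).
apply: continuous_mul; first exact: continuous_cst.
exact: (continuous_compose (@continuous_snd _ _) (cphi 0)).
Qed.

(** The occupation measure satisfies its defining identity for nonnegative
    integrands only, so the flux is split into its positive and negative parts. *)
Lemma reachable_path l : path_ok l -> reachable (J l).
Proof.
move=> lok nu; have [m Hm] := occupation_measure tauP alpha0 nu lok.
have oint (F : E * Om -> R) : continuous F ->
    nu.-integrable setT (EFin \o (occ_mean tau alpha l F : Y -> R)).
  by move=> cF; apply: continuous_integrable; exact: occ_mean_continuous.
have mint (F : E * Om -> R) : continuous F -> (forall z, 0 <= F z) ->
    m.-integrable setT (EFin \o (F : X -> R)).
  move=> cF F0; apply/integrableP; split; first exact: continuous_EFin_measurable.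
  under eq_integral do rewrite /= ger0_norm//.
  rewrite Hm// -ge0_fin_numE; first exact: (integrable_fin_num measurableT (oint F cF)).
  by apply: integral_ge0 => w _; rewrite lee_fin occ_mean_ge0.
exists m; split.
- have c1 : continuous (fun _ : E * Om => (1 : R)) by exact: continuous_cst.
  have := Hm (fun=> 1) c1 (fun=> ler01).
  under [in RHS]eq_integral do rewrite occ_mean1//.
  by rewrite !integral_cst// !mul1e.
- move=> phi phiC; have cF := continuous_flux phiC.
  pose F := discounted_flux phi.
  pose Fp z := Num.max (F z) 0; pose Fn z := Num.max (- F z) 0.
  have cmax (G : E * Om -> R) : continuous G -> continuous (fun z => Num.max (G z) 0).
    by move=> cG z; apply: continuous_max; [exact: cG|exact: cvg_cst].
  have cFp : continuous Fp by exact: cmax.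
  have cFn : continuous Fn by apply: cmax => z; apply: continuousN; exact: cF.
  have Fp0 z : 0 <= Fp z by rewrite le_max lexx orbT.
  have Fn0 z : 0 <= Fn z by rewrite le_max lexx orbT.
  have FE z : F z = Fp z - Fn z.
    rewrite /Fp /Fn !maxEle; move: (F z) => x.
    case: ifPn; case: ifPn; rewrite -?ltNge; lra.
  have -> : EFin \o (F : X -> R) = (fun z => (Fp z)%:E - (Fn z)%:E)%E.
    by apply/funext => z; rewrite /= FE EFinB.
  have iF := integrableB measurableT (mint _ cFp Fp0) (mint _ cFn Fn0).
  split; first exact: iF.
  transitivity (\int[m]_z ((Fp z)%:E - (Fn z)%:E))%E.
    by apply: eq_integral => z _; rewrite -EFinB -FE.
  rewrite integralB_EFin//; [|exact: mint|exact: mint].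
  rewrite !Hm// -integralB_EFin//; [|exact: oint|exact: oint].
  have [_ _ cphi cgrad] := phiC.
  rewrite -integralZl//; last exact: continuous_integrable.
  apply: eq_integral => w _; rewrite -EFinB -EFinM; congr EFin.
  rewrite -occ_meanB// -(occ_mean_constraint tauP alpha0 w (cphi 0) cgrad
     (C1s_orbit_derivative phiC) lok).
  by congr occ_mean; apply/funext => z; rewrite -FE.
have cL := continuous_lagrangian0 LP.
rewrite Hm//; last by move=> z; exact: (lagrangian_ge0 LP).
have cJ : continuous (J l) by exact: path_cost_continuous.
have iJ := continuous_integrable nu cJ.
rewrite -integralZl//; apply: le_integral => //.
- exact: oint.
- exact: integrableZl.
by move=> w _; rewrite /= -EFinM lee_fin; exact: occ_mean_lagrangian.
Qed.

(** Use the first measure over the base points where the first function is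
    smaller and the second elsewhere.  The set is open, so it is measurable. *)
Lemma reachable_min g1 g2 : continuous g1 -> continuous g2 ->
  reachable g1 -> reachable g2 -> reachable (fun w => Num.min (g1 w) (g2 w)).
Proof.
move=> c1 c2 r1 r2 nu.
pose g w := Num.min (g1 w) (g2 w).
have cg : continuous g.
  by move=> w; apply: continuous_min; [exact: c1|exact: c2].
pose h w := g1 w - g2 w.
have ch : continuous h by exact: continuous_sub.
pose B : set Y := h @^-1` [set x | 0 < x].
have mB : measurable B.
  by apply: open_borel; move/continuousP : ch; apply; exact: open_gt.
have mBC : measurable (~` B) by exact: measurableC.
have fin D : measurable D -> (nu D < +oo)%E.
  by move=> mD; rewrite -ge0_fin_numE// fin_num_measure.
pose nu1 : {finite_measure set Y -> \bar R} := mfrestr mB (fin _ mB).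
pose nu2 : {finite_measure set Y -> \bar R} := mfrestr mBC (fin _ mBC).
have nuE D : measurable D -> nu D = measure_add nu1 nu2 D.
  move=> mD; rewrite measure_addE /= /mfrestr /mrestr -measureU//.
  - by rewrite -setIUr setUv setIT.
  - exact: measurableI.
  - exact: measurableI.
  by rewrite -setIIr setICr setI0.
have nuint f : continuous f ->
    (\int[nu]_w (f w)%:E = \int[nu1]_w (f w)%:E + \int[nu2]_w (f w)%:E)%E.
  move=> cf; rewrite -integral_measure_add//.
  - by apply: eq_measure_integral => D mD _; exact: nuE.
  - exact: (continuous_integrable nu1 cf).
  - exact: (continuous_integrable nu2 cf).
have fint (nui : {finite_measure set Y -> \bar R}) f : continuous f ->
    (\int[nui]_w (f w)%:E)%E \is a fin_num.
  by move=> cf; exact: (integrable_fin_num measurableT (continuous_integrable nui cf)).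
have aeE (nui : {finite_measure set Y -> \bar R}) f (D : set Y) : continuous f ->
    measurable D -> nui (~` D) = 0%E -> (forall w, D w -> f w = g w) ->
    (\int[nui]_w (f w)%:E = \int[nui]_w (g w)%:E)%E.
  move=> cf mD D0 fg; apply: ae_eq_integral => //.
  - exact: continuous_EFin_measurable.
  - exact: continuous_EFin_measurable.
  exists (~` D); split => //; first exact: measurableC.
  move=> w /= nfg Dw; apply: nfg => _; by rewrite fg.
have e1 : (\int[nu1]_w (g2 w)%:E = \int[nu1]_w (g w)%:E)%E.
  apply: (aeE nu1 g2 B) => //.
    by rewrite /= /mfrestr /mrestr setICl measure0.
  by move=> w; rewrite /B /h /= subr_gt0 /g => gg; rewrite min_r// ltW.
have e2 : (\int[nu2]_w (g1 w)%:E = \int[nu2]_w (g w)%:E)%E.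
  apply: (aeE nu2 g1 (~` B)) => //.
    by rewrite /= /mfrestr /mrestr setICl measure0.
  move=> w; rewrite /B /h /= subr_gt0 /g => /negP; rewrite -leNgt => gg.
  by rewrite min_l.
have [m1 [M1 C1 A1]] := r2 nu1; have [m2 [M2 C2 A2]] := r1 nu2.
exists (measure_add m1 m2); split.
- transitivity (m1 setT + m2 setT)%E; first exact: measure_addE.
  rewrite M1 M2; apply/esym.
  transitivity (measure_add nu1 nu2 setT); [exact: nuE|exact: measure_addE].
- move=> phi phiC; have [i1 E1] := C1 _ phiC; have [i2 E2] := C2 _ phiC.
  have [_ _ cphi _] := phiC.
  split.
    apply/integrableP; split; first exact: (measurable_int _ i1).
    rewrite ge0_integral_measure_add//.
      move/integrableP : i1 => [_ i1]; move/integrableP : i2 => [_ i2].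
      exact: lte_add_pinfty.
    by apply: measurableT_comp => //; exact: (measurable_int _ i1).
  rewrite integral_measure_add// E1 E2 (nuint _ (cphi 0)).
  by apply/esym; apply: muleDr => //; apply: fin_num_adde_defl; exact: fint.
rewrite ge0_integral_measure_add//; last first.
- apply: continuous_EFin_measurable; exact: (continuous_lagrangian0 LP).
- by move=> z _; rewrite lee_fin; exact: (lagrangian_ge0 LP).
rewrite (nuint _ cg) -e1 -e2.
have -> : (alpha%:E * (\int[nu1]_w (g2 w)%:E + \int[nu2]_w (g1 w)%:E) =
    alpha%:E * \int[nu1]_w (g2 w)%:E + alpha%:E * \int[nu2]_w (g1 w)%:E)%E.
  by apply: muleDr => //; apply: fin_num_adde_defl; exact: fint.
exact: leeD.
Qed.

(** By compactness at every base point one of finitely many paths costs at most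
    u + e / alpha; apply [reachable_min] to their costs. *)
Lemma competitor (u : Om -> R) : continuous u ->
  (forall w e, 0 < e -> exists2 l, path_ok l & J l w < u w + e) ->
  forall (nu : probability Y R) (e : R), 0 < e ->
  exists mu : probability X R, discounted_constraint tau alpha nu mu /\
   (action L mu <= (alpha%:E * \int[nu]_w (u w)%:E + e%:E))%E.
Proof.
move=> cu Ju nu e e0.
pose d := e / alpha; have d0 : 0 < d by rewrite divr_gt0.
have cJ l : path_ok l -> continuous (J l) by exact: path_cost_continuous.
pose U (l : seq (R * E)) : set Om := [set w | J l w - u w < d].
have oU l : [set l | path_ok l] l -> open (U l).
  move=> /= lok; have /continuousP ch := continuous_sub (cJ l lok) cu.
  exact: (ch _ (@open_lt R d)).
have cov : [set: Om] `<=` cover [set l | path_ok l] U.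
  move=> w _; have [l lok Hl] := Ju w d d0; exists l => //=.
  by rewrite /U /= ltrBlDl.
move: cO; rewrite compact_cover => /(_ _ _ _ oU cov) [D Dok Dcov].
pose g (ls : seq (seq (R * E))) (w : Om) :=
  foldr (fun l x => Num.min (J l w) x) (J [::] w) ls.
have gP ls : all (@path_ok R n) ls -> continuous (g ls) /\ reachable (g ls).
  elim: ls => [_|l ls IH /= /andP[lok /IH[c1 r1]]].
    by split; [exact: cJ|exact: (reachable_path (l := [::]))].
  split; last by apply: reachable_min => //; [exact: cJ|exact: reachable_path].
  by move=> w; apply: continuous_min; [exact: cJ|exact: c1].
have gle ls l w : l \in ls -> g ls w <= J l w.
  elim: ls => // l' ls IH; rewrite inE => /orP[/eqP <-|/IH H] /=.
    by rewrite ge_min lexx.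
  by rewrite ge_min H orbT.
have Dall : all (@path_ok R n) (finmap.enum_fset D).
  by apply/allP => l lD; have := Dok _ lD; rewrite inE.
have [cg rg] := gP _ Dall.
have gu w : g (finmap.enum_fset D) w <= u w + d.
  have [l /= lD Hl] := Dcov w Logic.I; apply: le_trans (gle _ l _ _) _ => //.
  by move: Hl; rewrite /U /= ltrBlDl => /ltW.
have [m [M Cm Am]] := rg nu.
have m1 : m setT = 1%E by rewrite M; exact: probability_setT.
pose mu : probability X R := mnormalize m (dirac (point : X)).
have muE (S : set X) : measurable S -> mu S = m S.
  by move=> _; rewrite /mu /= /mnormalize m1 onee_eq0 /= invr1 mule1.
have muint f : (\int[mu]_z f z = \int[m]_z f z)%E.
  by apply: eq_measure_integral => S mS _; exact: muE.
exists mu; split.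
  by move=> phi phiC; rewrite muint; have [_ ->] := Cm _ phiC.
rewrite /action muint; apply: le_trans Am _.
have iu := continuous_integrable nu cu; have ig := continuous_integrable nu cg.
have -> : e%:E = (alpha%:E * \int[nu]_w d%:E)%E.
  have -> : (\int[nu]_w d%:E = d%:E * nu setT)%E by exact: integral_cst.
  by rewrite (probability_setT nu) mule1 -EFinM /d mulrC divfK// gt_eqF.
have id : nu.-integrable setT (EFin \o (fun _ : Y => d)).
  by apply: continuous_integrable; exact: continuous_cst.
have <- : (alpha%:E * (\int[nu]_w (u w)%:E + \int[nu]_w d%:E) =
    alpha%:E * \int[nu]_w (u w)%:E + alpha%:E * \int[nu]_w d%:E)%E.
  apply: muleDr => //; apply: fin_num_adde_defl.
  exact: (integrable_fin_num measurableT id).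
rewrite lee_pmul2l//.
rewrite -integralD//; apply: le_integral => //; first exact: integrableD.
by move=> w _; rewrite /= -EFinD lee_fin.
Qed.

End Reachable.

(** * Regularized subsolutions and second differences *)

Section Subsolution.
Variables (R : realType) (n : nat) (Om : pmetricType R).
Variable tau : 'rV[R]_n -> Om -> Om.
Variable L : 'rV[R]_n -> 'rV[R]_n -> Om -> R.
Hypothesis tauP : continuous_action tau.
Local Notation E := 'rV[R]_n.
Variables (u : Om -> R) (alpha B c k : R).
Hypotheses (alpha0 : 0 < alpha) (cu : continuous u) (B0 : 0 <= B) (c0 : 0 <= c).
Hypotheses (k0 : 0 < k) (ck : c <= k).
Hypothesis u0 : forall w, 0 <= u w.
Hypothesis uB : forall w y, `|u (tau y w) - u w| <= B * enorm y.
Hypothesis uc : forall w y,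
  u (tau y w) + u (tau (- y) w) - 2 * u w <= c * enorm y ^+ 2.
Hypothesis usub : forall v w d, 0 < d -> exists2 t0, 0 < t0 & forall t, 0 < t <= t0 ->
  u w <= t * (L 0 v w + d) + expR (- alpha * t) * u (tau (t *: v) w).

Local Notation z_ := (sup_point tauP cu B0 k0 uB).
Local Notation phi := (sup_convolution tauP cu B0 k0 uB).
Local Notation P := (sup_gradient tauP cu B0 k0 uB).

Lemma expR_second_order (x : R) : 0 <= x -> 1 - x <= expR (- x) <= 1 - x + x ^+ 2.
Proof.
move=> x0; have h1 := expR_ge1Dx (- x); apply/andP; split; first by lra.
have := expR_ge1Dx x => /(ler_wpM2r (expR_ge0 (- x))); rewrite -expRD subrr expR0 => h2.
rewrite -(@ler_pM2r _ (1 + x)); last by lra.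
rewrite mulrC; apply: le_trans h2 _.
have -> : (1 - x + x ^+ 2) * (1 + x) = 1 + x ^+ 3 by ring.
by rewrite lerDl exprn_ge0.
Qed.

(** Start the integrated inequality for u at tau_z w, with z optimal for w: all
    terms but the Lagrangian can then be rewritten at w, and dividing by t gives the
    infinitesimal inequality. *)
Lemma sup_convolution_subsolution v w :
  alpha * phi w - dotv v (P w) <= L 0 v (tau (z_ w) w).
Proof.
apply/ler_addgt0Pr => e e0.
set z := z_ w; set l := L 0 v (tau z w).
have d0 : 0 < e / 2 by rewrite divr_gt0.
have [t0 t00 Ht] := usub v (tau z w) d0.
pose K := k + 2 * c.
have K0 : 0 <= K by apply: addr_ge0; [exact: ltW|exact: mulr_ge0].
pose p := dotv v (P w).
have f0 : 0 <= phi w by exact: le_trans (u0 w) (le_sup_convolution _ _ _ _ _ _).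
pose M := alpha ^+ 2 * phi w + alpha * `|p| + K * enorm v ^+ 2.
have M0 : 0 <= M.
  rewrite /M; apply: addr_ge0; last by rewrite mulr_ge0// sqr_ge0.
  by apply: addr_ge0; apply: mulr_ge0 => //; [exact: sqr_ge0|exact: ltW].
pose t := Num.min t0 (e / (2 * (M + 1))).
have t_gt0 : 0 < t.
  by rewrite lt_min t00 divr_gt0// mulr_gt0//; lra.
have tM : t * M <= e / 2.
  have h : t <= e / (2 * (M + 1)) by rewrite ge_min lexx orbT.
  apply: le_trans (ler_wpM2r M0 h) _.
  have -> : e / (2 * (M + 1)) * M = e / 2 * (M / (M + 1)) by field; rewrite gt_eqF//; lra.
  have M1 : 0 < M + 1 by apply: ltr_wpDl.
  by apply: ler_piMr; [exact: ltW|rewrite ler_pdivrMr// mul1r lerDl].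
have tt0 : 0 < t <= t0 by rewrite t_gt0 ge_min lexx.
have := Ht t tt0; rewrite -/l => h1.
set q := expR (- alpha * t) in h1.
have at0 : 0 <= alpha * t by rewrite mulr_ge0// ltW.
have /andP[q1 q2] : 1 - alpha * t <= q <= 1 - alpha * t + (alpha * t) ^+ 2.
  by rewrite /q mulNr; exact: expR_second_order.
have q0 : 0 <= q by exact: expR_ge0.
have q11 : q <= 1 by rewrite /q expR_le1 mulNr oppr_le0.
have h2 : u (tau (t *: v) (tau z w)) - k * enorm z ^+ 2 <= phi (tau (t *: v) w).
  have -> : tau (t *: v) (tau z w) = tau z (tau (t *: v) w).
    by rewrite -!(tauD tauP) addrC.
  exact: sup_convolution_ge.
have h3 : phi (tau (t *: v) w) <= phi w + t * p + K * t ^+ 2 * enorm v ^+ 2.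
  have := sup_convolution_expansion tauP cu B0 c0 k0 ck uB uc w (t *: v).
  rewrite ler_norml => /andP[_].
  rewrite dotvZl enormZ exprMn (real_normK (num_real t)) -/K -/p mulrA; lra.
have h4 : phi w = u (tau z w) - k * enorm z ^+ 2 by [].
have kz : 0 <= k * enorm z ^+ 2 by rewrite mulr_ge0 ?sqr_ge0// ltW.
have h5 := ler_wpM2l q0 h2.
have h6 := ler_wpM2l q0 h3.
have h7 : q * (k * enorm z ^+ 2) <= k * enorm z ^+ 2 by rewrite ler_piMl.
have h8 : (alpha * t - (alpha * t) ^+ 2) * phi w <= (1 - q) * phi w.
  by rewrite ler_wpM2r//; lra.
have h9 : q * (t * p) <= t * p + alpha * t ^+ 2 * `|p|.
  have hp : (1 - q) * (t * - p) <= (1 - q) * (t * `|p|).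
    apply: ler_wpM2l; first lra.
    by apply: ler_wpM2l; [exact: ltW|rewrite -normrN ler_norm].
  have hq : (1 - q) * (t * `|p|) <= alpha * t * (t * `|p|).
    by apply: ler_wpM2r; [rewrite mulr_ge0// ltW|lra].
  lra.
have h10 : q * (K * t ^+ 2 * enorm v ^+ 2) <= K * t ^+ 2 * enorm v ^+ 2.
  by rewrite ler_piMl// !mulr_ge0 ?enorm_ge0// ltW.
rewrite -(ler_pM2l t_gt0).
have hM := ler_wpM2l (ltW t_gt0) tM.
rewrite -/p.
suff : t * (alpha * phi w - p) <= t * (l + e / 2) + t * (t * M) by lra.
rewrite /M.
move: h1 h4 h5 h6 h7 h8 h9 h10.
move: (u (tau z w)) (u (tau _ _)) (phi w) (phi _) (k * enorm z ^+ 2) (enorm v ^+ 2).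
move=> x1 x2 x3 x4 x5 x6 h1 h4 h5 h6 h7 h8 h9 h10; lra.
Qed.

End Subsolution.

Section ExpansionAlgebra.
Variables (R : realType) (n : nat) (Om : pmetricType R).
Variable tau : 'rV[R]_n -> Om -> Om.
Hypothesis tauP : continuous_action tau.
Local Notation E := 'rV[R]_n.

Lemma tauAC x y w : tau x (tau y w) = tau y (tau x w).
Proof. by rewrite -!(tauD tauP) addrC. Qed.

Lemma second_difference_expansion K f P h : orbit_expansion tau K f P ->
  orbit_expansion tau (4 * K)
    (fun w => f (tau h w) + f (tau (- h) w) - 2 * f w)
    (fun w => P (tau h w) + P (tau (- h) w) - (2 : R) *: P w).
Proof.
move=> fP w x.
have := fP w x; have := fP (tau h w) x; have := fP (tau (- h) w) x.
rewrite !(tauAC x) !dotvDr dotvNr dotvZr !ler_norml.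
by move=> /andP[? ?] /andP[? ?] /andP[? ?]; apply/andP; split; lra.
Qed.

(** How far s falls below - T.  The function s |-> - (excess T s)^2 / 2 has
    derivative excess T s, itself Lipschitz, so composing with it preserves
    quadratic expansions ([excess_expansion]). *)
Definition excess (T s : R) : R := Num.max 0 (- T - s).

Lemma excess_ge0 T s : 0 <= excess T s.
Proof. by rewrite le_max lexx. Qed.

Lemma excess_taylor T s r :
  `|- excess T (s + r) ^+ 2 / 2 + excess T s ^+ 2 / 2 - excess T s * r| <= r ^+ 2 / 2.
Proof.
rewrite /excess !maxEle ler_norml.
case: ifPn => h1; case: ifPn => h2; rewrite -?ltNge in h1 h2; apply/andP; split; nra.
Qed.

Lemma excess_expansion K Bg Q T g P : 0 <= K ->
  orbit_expansion tau K g P -> (forall w x, `|g (tau x w) - g w| <= Bg * enorm x) ->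
  (forall w, excess T (g w) <= Q) ->
  orbit_expansion tau (Bg ^+ 2 / 2 + Q * K)
    (fun w => - excess T (g w) ^+ 2 / 2) (fun w => excess T (g w) *: P w).
Proof.
move=> K0 gP gB eQ w x; rewrite dotvZr.
set r := g (tau x w) - g w; set q := excess T (g w).
have h1 := excess_taylor T (g w) r.
have gE : g w + r = g (tau x w) by rewrite /r addrC subrK.
rewrite gE -/q in h1.
have h2 : `|q * (r - dotv x (P w))| <= Q * (K * enorm x ^+ 2).
  rewrite normrM; apply: ler_pM => //; last exact: gP.
  rewrite ger0_norm; [exact: eQ|exact: excess_ge0].
have h3 : r ^+ 2 <= Bg ^+ 2 * enorm x ^+ 2.
  have hr := gB w x; rewrite -exprMn -(real_normK (num_real r)).
  by rewrite ler_sqr ?nnegrE//; exact: le_trans hr.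
move: h1 h2; rewrite !ler_norml => /andP[? ?] /andP[? ?]; apply/andP; split; lra.
Qed.

End ExpansionAlgebra.

(** * The support of a holonomic minimizing measure *)

Section Regularization.
Variables (R : realType) (n : nat) (Om : pmetricType R).
Variable tau : 'rV[R]_n -> Om -> Om.
Variable L : 'rV[R]_n -> 'rV[R]_n -> Om -> R.
Hypothesis tauP : continuous_action tau.
Local Notation E := 'rV[R]_n.
Variables (u : Om -> R) (alpha B c C : R).

(** What remains of the sup-convolution of parameter k once its construction is
    forgotten.  The term in B / k of the last field is the oscillation of L over the
    optimal displacement. *)
Record regularized (k : R) (phi : Om -> R) (P : Om -> E) : Prop := Regularized {
  reg_continuous : continuous phi;
  reg_expansion : exists2 K, 0 <= K & orbit_expansion tau K phi P;
  reg_ge : forall w, u w <= phi w;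
  reg_le : forall w, phi w <= u w + B ^+ 2 / k;
  reg_lipschitz : forall w y, `|phi (tau y w) - phi w| <= B * enorm y;
  reg_gradient : forall w, enorm (P w) <= 2 * B;
  reg_semiconcave : forall w h, phi (tau h w) <= phi w + dotv h (P w) + c * enorm h ^+ 2;
  reg_subsolution : forall v w,
    alpha * phi w - dotv v (P w) <= L 0 v w + B / k * (C + C * L 0 v w) }.

Hypotheses (alpha0 : 0 < alpha) (cu : continuous u) (B0 : 0 <= B) (c0 : 0 <= c).
Hypothesis u0 : forall w, 0 <= u w.
Hypothesis uB : forall w y, `|u (tau y w) - u w| <= B * enorm y.
Hypothesis uc : forall w y,
  u (tau y w) + u (tau (- y) w) - 2 * u w <= c * enorm y ^+ 2.
Hypothesis usub : forall v w d, 0 < d -> exists2 t0, 0 < t0 & forall t, 0 < t <= t0 ->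
  u w <= t * (L 0 v w + d) + expR (- alpha * t) * u (tau (t *: v) w).
Hypothesis L0 : forall v w, 0 <= L 0 v w.
Hypotheses (C0 : 0 <= C)
  (LC : forall x v w, L 0 v (tau x w) <= L 0 v w + enorm x * (C + C * L 0 v w)).

Lemma regularization (k : R) : 0 < k -> c <= k -> exists phi P, regularized k phi P.
Proof.
move=> k0 ck.
have scc := sup_convolution_semiconcave tauP cu B0 c0 k0 ck uB uc.
have exp := sup_convolution_expansion tauP cu B0 c0 k0 ck uB uc.
exists (sup_convolution tauP cu B0 k0 uB), (sup_gradient tauP cu B0 k0 uB); split.
- exact: sup_convolution_continuous.
- exists (k + 2 * c) => //; apply: addr_ge0; [exact: ltW|exact: mulr_ge0].
- by move=> w; exact: le_sup_convolution.
- by move=> w; exact: sup_convolution_le.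
- by move=> w y; exact: sup_convolution_lipschitz.
- by move=> w; exact: sup_gradient_le.
- exact: (semiconcave_expansion_le tauP scc exp).
- move=> v w.
  apply: le_trans (sup_convolution_subsolution tauP alpha0 cu B0 c0 k0 ck u0 uB uc usub v w) _.
  apply: le_trans (LC _ _ _) _; rewrite lerD2l ler_wpM2r//; last exact: sup_point_le.
  by rewrite addr_ge0// mulr_ge0.
Qed.

End Regularization.

Section MatherSupport.
Variables (R : realType) (n : nat) (Om : pmetricType R).
Variable tau : 'rV[R]_n -> Om -> Om.
Variable L : 'rV[R]_n -> 'rV[R]_n -> Om -> R.
Hypothesis cO : compact [set: Om].
Hypothesis tauP : continuous_action tau.
Hypothesis LP : admissible_lagrangian tau L.
Local Notation E := 'rV[R]_n.
Local Notation X := (borel (E * Om)%type).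
Local Notation Y := (borel Om).
Variables (u : Om -> R) (alpha B c C A R1 CH : R).
Hypotheses (alpha0 : 0 < alpha) (cu : continuous u) (B0 : 0 <= B) (c0 : 0 <= c).
Hypothesis uB : forall w y, `|u (tau y w) - u w| <= B * enorm y.
Hypothesis reg : forall k, 0 < k -> c <= k ->
  exists phi P, regularized tau L u alpha B c C k phi P.
Hypothesis C0 : 0 <= C.
Hypotheses (A0 : 0 <= A) (uA : forall w, alpha * (u w + B ^+ 2) <= A).
Hypotheses (R11 : 1 <= R1)
  (LR1 : forall v w, R1 <= enorm v -> (2 * B + A + 2) * enorm v <= L 0 v w).
Hypotheses (CH0 : 0 <= CH) (LCH : forall v h xi w,
  enorm v <= R1 -> enorm h <= 1 -> enorm xi <= 1 ->
  L 0 (v + xi) (tau h w) + L 0 (v - xi) (tau (- h) w) - 2 * L 0 v w <=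
    CH * (enorm h ^+ 2 + enorm xi ^+ 2)).
Variables (nu : probability Y R) (mu : probability X R).
Hypothesis mu_constraint : discounted_constraint tau alpha nu mu.
Hypothesis mu_holonomic : holonomic tau nu mu.
Hypothesis mu_action : (action L mu <= alpha%:E * \int[nu]_w (u w)%:E)%E.

Let Lz (z : E * Om) : R := L 0 z.1 z.2.
Let Lz0 z : 0 <= Lz z. Proof. exact: (lagrangian_ge0 LP). Qed.
Let cLz : continuous Lz. Proof. exact: (continuous_lagrangian0 LP). Qed.

Definition mean (f : E * Om -> R) : R := (\int[mu]_(z in [set: X]) f z)%R.

(** Since the action is finite, these are continuous functions that mu integrates;
    by superlinearity they include v.Q(w) for continuous Q. *)
Definition dominated (f : E * Om -> R) : Prop :=
  continuous f /\ exists2 M : R, 0 <= M & forall z, `|f z| <= M * (1 + Lz z).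

Lemma lagrangian_integrable : mu.-integrable setT (EFin \o (Lz : X -> R)).
Proof.
apply/integrableP; split; first exact: continuous_EFin_measurable.
under eq_integral do rewrite /= ger0_norm//.
apply: le_lt_trans mu_action _.
have iu := continuous_integrable cO nu cu.
have fu : (\int[nu]_w (u w)%:E)%E \is a fin_num := integrable_fin_num measurableT iu.
by rewrite -(fineK fu) -EFinM ltry.
Qed.

Lemma dominated_integrable f : dominated f -> mu.-integrable setT (EFin \o (f : X -> R)).
Proof.
move=> [cf [M M0 fM]].
have iL : mu.-integrable setT (EFin \o ((fun z => M * (1 + Lz z)) : X -> R)).
  have -> : EFin \o ((fun z => M * (1 + Lz z)) : X -> R) =
     (fun z : X => (M%:E * (cst 1%:E \+ (EFin \o (Lz : X -> R))) z)%E).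
    by apply/funext => z; rewrite /= EFinM EFinD.
  apply: integrableZl => //; apply: integrableD => //.
    exact: finite_measure_integrable_cst.
  exact: lagrangian_integrable.
apply: le_integrable iL => //; first exact: continuous_EFin_measurable.
by move=> z _ /=; rewrite lee_fin; apply: le_trans (fM z) (ler_norm _).
Qed.

Lemma dominatedD f g : dominated f -> dominated g -> dominated (fun z => f z + g z).
Proof.
move=> [cf [M M0 fM]] [cg [N N0 gN]]; split; first exact: continuous_add.
exists (M + N); first exact: addr_ge0.
by move=> z; rewrite mulrDl; apply: le_trans (ler_normD _ _) (lerD (fM z) (gN z)).
Qed.

Lemma dominatedM (a : E * Om -> R) f Ma : continuous a -> (forall z, `|a z| <= Ma) ->
  dominated f -> dominated (fun z => a z * f z).
Proof.
move=> ca aM [cf [M M0 fM]]; split; first exact: continuous_mul.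
have Ma0 : 0 <= Ma by exact: le_trans (normr_ge0 _) (aM (0, point)).
exists (Ma * M); first exact: mulr_ge0.
by move=> z; rewrite normrM -mulrA; exact: ler_pM.
Qed.

Lemma dominatedZ (a : R) f : dominated f -> dominated (fun z => a * f z).
Proof. by apply: (@dominatedM (fun=> a) f `|a|) => //; exact: continuous_cst. Qed.

Lemma dominated_lagrangian : dominated Lz.
Proof.
split => //; exists 1 => // z; rewrite mul1r ger0_norm// lerDr; exact: ler01.
Qed.

Lemma dominated_base (f : Om -> R) : continuous f -> dominated (fun z => f z.2).
Proof.
move=> cf; split; first exact: (continuous_compose (@continuous_snd _ _) cf).
have [M M0 fM] := compact_continuous_bounded cO cf.
exists M => // z; apply: le_trans (fM _ _) _ => //.
by rewrite ler_peMr// lerDl.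
Qed.

Lemma dominated_velocity (Q : Om -> E) : continuous Q ->
  dominated (fun z => dotv z.1 (Q z.2)).
Proof.
move=> cQ; split.
  apply: continuous_dotv; first exact: continuous_fst.
  exact: (continuous_compose (@continuous_snd _ _) cQ).
have cn : continuous (fun w => enorm (Q w)).
  exact: (continuous_compose cQ (@continuous_enorm R n)).
have [M M0 QM] := compact_continuous_bounded cO cn.
have [r r0 Hr] := lagrangian_superlinear cO LP 1.
have r1 : 1 <= 1 + r by rewrite lerDl ltW.
exists (M * (1 + r)); first by rewrite mulr_ge0// addr_ge0// ltW.
move=> [v w] /=; apply: le_trans (normr_dotv_le _ _) _.
rewrite mulrC -mulrA; apply: ler_pM; rewrite ?enorm_ge0//.
  by apply: le_trans (QM w _) => //; rewrite ler_norm.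
have := Lz0 (v, w) => /= l0.
have [rv|vr] := leP r (enorm v).
  have := Hr v w rv; rewrite mul1r => /le_trans; apply.
  apply: (@le_trans _ _ (1 * (1 + L 0 v w))); first by rewrite mul1r lerDr.
  by rewrite ler_wpM2r// addr_ge0.
apply: (@le_trans _ _ ((1 + r) * 1)); first by rewrite mulr1; lra.
by apply: ler_wpM2l; [lra|rewrite lerDl].
Qed.

Lemma meanD f g : dominated f -> dominated g ->
  mean (fun z => f z + g z) = mean f + mean g.
Proof. by move=> df dg; rewrite /mean RintegralD//; exact: dominated_integrable. Qed.

Lemma meanZ (a : R) f : dominated f -> mean (fun z => a * f z) = a * mean f.
Proof. by move=> df; rewrite /mean RintegralZl//; exact: dominated_integrable. Qed.

Lemma mean_le f g : dominated f -> dominated g -> (forall z, f z <= g z) ->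
  mean f <= mean g.
Proof. by move=> df dg fg; apply: le_Rintegral => //; exact: dominated_integrable. Qed.

Lemma mean_cst (a : R) : mean (fun=> a) = a.
Proof.
by rewrite /mean Rintegral_cst// [X in fine X](probability_setT mu) mulr1.
Qed.

Lemma mean_base f K P : continuous f -> orbit_expansion tau K f P ->
  mean (fun z => f z.2) = fine (\int[nu]_w (f w)%:E)%E.
Proof.
move=> cf fP; have [phiC _] := orbit_expansion_C1s tauP cf fP.
rewrite /mean /Rintegral; congr fine.
have -> : (\int[nu]_w (f w)%:E = \int[nu]_w (f (tau 0 w))%:E)%E.
  by apply: eq_integral => w _; rewrite tau0.
rewrite -(mu_holonomic phiC); apply: eq_integral => z _.
by rewrite tau0.
Qed.

(** Add alpha times the holonomy condition to the discounted constraint, both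
    tested with f. *)
Lemma mean_velocity_gradient f K P : continuous f -> orbit_expansion tau K f P ->
  mean (fun z => dotv z.1 (P z.2)) = 0.
Proof.
move=> cf fP; have [phiC gradE] := orbit_expansion_C1s tauP cf fP.
have cP := orbit_expansion_continuous tauP fP cf.
have dP := dominated_velocity cP; have df := dominated_base cf.
have int1 := continuous_integrable cO nu cf.
have H : mean (fun z => dotv z.1 (P z.2) + - alpha * f z.2) =
    - alpha * fine (\int[nu]_w (f w)%:E)%E.
  have <- : fine ((- alpha)%:E * \int[nu]_w (f w)%:E)%E =
      - alpha * fine (\int[nu]_w (f w)%:E)%E.
    by rewrite fineM//; exact: (integrable_fin_num measurableT int1).
  rewrite /mean /Rintegral; congr fine.
  have -> : (\int[nu]_w (f w)%:E = \int[nu]_w (f (tau 0 w))%:E)%E.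
    by apply: eq_integral => w _; rewrite tau0.
  rewrite -(mu_constraint phiC); apply: eq_integral => z _.
  by rewrite gradE tau0// mulNr.
move: H; rewrite meanD//; last exact: dominatedZ.
by rewrite meanZ// (mean_base cf fP); lra.
Qed.

Lemma mean_lagrangian_le : mean Lz <= alpha * fine (\int[nu]_w (u w)%:E)%E.
Proof.
have iu := continuous_integrable cO nu cu.
have fu : (\int[nu]_w (u w)%:E)%E \is a fin_num := integrable_fin_num measurableT iu.
rewrite -lee_fin EFinM (fineK fu); apply: le_trans mu_action.
by rewrite /mean /Rintegral fineK//; exact: (integrable_fin_num measurableT lagrangian_integrable).
Qed.

(** The slack of the subsolution inequality for phi. *)
Definition defect (phi : Om -> R) (P : Om -> E) (k : R) (z : E * Om) : R :=
  Lz z + dotv z.1 (P z.2) - alpha * phi z.2 + B / k * (C + C * Lz z).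

Let D1 := B * (C + C * mean Lz).

Lemma defect_dominated k phi P : regularized tau L u alpha B c C k phi P ->
  dominated (defect phi P k).
Proof.
move=> [cphi [K K0 ex] _ _ _ _ _ _].
have cP := orbit_expansion_continuous tauP ex cphi.
have -> : defect phi P k = (fun z => Lz z + (dotv z.1 (P z.2) +
    (- alpha * phi z.2 + B / k * (C + C * Lz z)))).
  by apply/funext => z; rewrite /defect; ring.
apply: dominatedD; first exact: dominated_lagrangian.
apply: dominatedD; first exact: dominated_velocity.
apply: dominatedD; first by apply: dominatedZ; exact: dominated_base.
apply: dominatedZ; apply: dominatedD.
  by apply: (@dominated_base (fun=> C)); exact: continuous_cst.
by apply: dominatedZ; exact: dominated_lagrangian.
Qed.

Lemma defect_ge0 k phi P z : regularized tau L u alpha B c C k phi P ->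
  0 <= defect phi P k z.
Proof. by case=> _ _ _ _ _ _ _ /(_ z.1 z.2); rewrite /defect /Lz; lra. Qed.

(** The gradient term averages to zero, phi >= u, and the action of mu is at most
    alpha times the mean of u, so only the error term in B / k is left. *)
Lemma mean_defect_le k phi P : 0 < k -> regularized tau L u alpha B c C k phi P ->
  mean (defect phi P k) <= D1 / k.
Proof.
move=> k0 [cphi [K K0 ex] phi_ge _ _ _ _ _].
have cP := orbit_expansion_continuous tauP ex cphi.
have -> : defect phi P k = (fun z => Lz z + (dotv z.1 (P z.2) +
    (- alpha * phi z.2 + B / k * (C + C * Lz z)))).
  by apply/funext => z; rewrite /defect; ring.
have d1 := dominated_lagrangian; have d2 := dominated_velocity cP.
have d3 := dominatedZ (- alpha) (dominated_base cphi).
have dC := dominated_base (@continuous_cst Om R C).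
have d4 := dominatedZ (B / k) (dominatedD dC (dominatedZ C d1)).
rewrite (meanD d1 (dominatedD d2 (dominatedD d3 d4))) (meanD d2 (dominatedD d3 d4)).
rewrite (meanD d3 d4) (mean_velocity_gradient cphi ex) meanZ; last exact: dominated_base.
rewrite (meanZ _ (dominatedD dC (dominatedZ C d1))) (meanD dC (dominatedZ C d1)).
rewrite mean_cst (meanZ C d1) (mean_base cphi ex).
have iu := continuous_integrable cO nu cu.
have iphi := continuous_integrable cO nu cphi.
have : fine (\int[nu]_w (u w)%:E)%E <= fine (\int[nu]_w (phi w)%:E)%E.
  apply: fine_le; try exact: (integrable_fin_num measurableT).
  by apply: le_integral => // w _; rewrite lee_fin.
move/(ler_wpM2l (ltW alpha0)); have := mean_lagrangian_le; rewrite /D1.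
have -> : B * (C + C * mean Lz) / k = B / k * (C + C * mean Lz) by rewrite mulrAC.
lra.
Qed.

(** Markov's inequality, with k tending to infinity. *)
Lemma null_open_set (U : set (E * Om)) (kap M k1 : R) : open U -> 0 < kap ->
  (forall k, k1 <= k -> exists G, [/\ dominated G, (forall z, 0 <= G z),
     (forall z, U z -> kap <= G z) & mean G <= M / k]) ->
  mu U = 0%E.
Proof.
move=> oU kap0 H; have mU := open_borel oU.
have fU : mu U \is a fin_num by rewrite fin_num_measure.
have p0 : 0 <= fine (mu U) by rewrite fine_ge0.
suff : fine (mu U) <= 0.
  move=> ple; have : fine (mu U) = 0 by apply/eqP; rewrite eq_le ple p0.
  by move=> pE; rewrite -(fineK fU) pE.
rewrite leNgt; apply/negP => p_gt0.
have kp : 0 < kap * fine (mu U) by rewrite mulr_gt0.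
pose k := Num.max k1 ((`|M| + 1) / (kap * fine (mu U))).
have [|G [dG G0 GU GM]] := H k; first by rewrite le_max lexx.
(* With this k, M / k is smaller than kap times the measure of U. *)
have k_ge : (`|M| + 1) / (kap * fine (mu U)) <= k by rewrite le_max lexx orbT.
have k0 : 0 < k by apply: lt_le_trans k_ge; rewrite divr_gt0// ltr_wpDl.
have iG := dominated_integrable dG.
have : kap * fine (mu U) <= mean G.
  rewrite -lee_fin EFinM (fineK fU).
  rewrite /mean /Rintegral fineK; last exact: (integrable_fin_num measurableT iG).
  rewrite -(integral_cst mu mU kap%:E).
  apply: (@le_trans _ _ (\int[mu]_(z in U) (G z)%:E)%E).
    apply: ge0_le_integral => //.
    - by move=> z _; rewrite lee_fin ltW.
    - by apply: measurable_funTS; exact: continuous_EFin_measurable (proj1 dG).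
  apply: ge0_subset_integral => //.
  - exact: continuous_EFin_measurable (proj1 dG).
  - by move=> z _; rewrite lee_fin.
move/le_trans => /(_ _ GM); rewrite ler_pdivlMr// => h1.
rewrite ler_pdivrMr// in k_ge.
have := ler_norm M; rewrite mulrC in h1; lra.
Qed.

Lemma support_avoids (U : set (E * Om)) z : open U -> mu U = 0%E -> msupport mu z -> ~ U z.
Proof. by move=> oU U0 sz Uz; have := sz U oU Uz; rewrite U0 ltxx. Qed.

(** Superlinearity makes the Lagrangian dominate v.P and alpha phi at large
    velocities. *)
Lemma defect_large k phi P v w : 1 <= k -> regularized tau L u alpha B c C k phi P ->
  R1 <= enorm v -> enorm v + 1 <= defect phi P k (v, w).
Proof.
move=> k1 [_ _ _ phile _ gradP _ _] vR; rewrite /defect /Lz /=.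
have k0 : 0 < k by exact: lt_le_trans k1.
have h1 : alpha * phi w <= A.
  apply: le_trans (uA w); rewrite ler_pM2l//; apply: le_trans (phile w) _.
  by rewrite lerD2l ler_pdivrMr// ler_peMr// sqr_ge0.
have h2 : - (enorm v * (2 * B)) <= dotv v (P w).
  rewrite lerNl -dotvNl; apply: le_trans (dotv_le_enorm _ _) _.
  by rewrite enormN ler_wpM2l// enorm_ge0.
have h3 : 0 <= B / k * (C + C * L 0 v w).
  apply: mulr_ge0; first by rewrite divr_ge0// ltW.
  by apply: addr_ge0 => //; apply: mulr_ge0 => //; exact: (Lz0 (v, w)).
have A1 : 0 <= A + 1 by apply: addr_ge0.
have v1 : 1 <= enorm v by exact: le_trans vR.
have := LR1 w vR; have := ler_wpM2l A1 v1; rewrite mulr1.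
lra.
Qed.

Lemma support_bounded z : msupport mu z -> enorm z.1 <= R1.
Proof.
move=> sz; rewrite leNgt; apply/negP => Rz.
pose U : set (E * Om) := [set z | R1 < enorm z.1].
have oU : open U.
  have /continuousP H := continuous_compose (@continuous_fst E Om) (@continuous_enorm R n).
  exact: (H _ (@open_gt R R1)).
apply: (@support_avoids U z oU _ sz) => //.
apply: (@null_open_set U 1 D1 (Num.max 1 c)) => // k.
rewrite ge_max => /andP[k1 ck]; have k0 : 0 < k by exact: lt_le_trans k1.
have [phi [P rP]] := reg k0 ck.
exists (defect phi P k); split.
- exact: defect_dominated.
- by move=> z'; exact: defect_ge0.
- move=> [v w] /= /ltW vR; apply: le_trans (defect_large w k1 rP vR).
  by rewrite lerDr enorm_ge0.
- exact: mean_defect_le.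
Qed.

(** At small defect the subsolution inequality is nearly an equality at the
    velocity v; subtracting it from the inequality at v - s h bounds s h.P, and
    h.P bounds the increment of phi along h by semiconcavity. *)
Lemma support_upper z h s : msupport mu z -> 0 < s ->
  s * (u (tau h z.2) - u z.2 - c * enorm h ^+ 2) <=
    L 0 (z.1 - s *: h) z.2 - L 0 z.1 z.2.
Proof.
move=> sz s0; rewrite leNgt; apply/negP => lt.
pose Phi (z : E * Om) := s * (u (tau h z.2) - u z.2 - c * enorm h ^+ 2) -
  (L 0 (z.1 - s *: h) z.2 - L 0 z.1 z.2).
have cPhi : continuous Phi.
  have c2 := @continuous_snd E Om.
  apply: continuous_sub; last apply: continuous_sub => //.
    apply: continuous_mul; first exact: continuous_cst.
    apply: continuous_sub; last exact: continuous_cst.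
    apply: continuous_sub; last exact: (continuous_compose c2 cu).
    exact: (continuous_compose c2 (continuous_compose (continuous_tau tauP (x := h)) cu)).
  have cf : continuous (fun z : E * Om => (z.1 - s *: h, z.2) : E * Om).
    apply: continuous_pair => //; move=> x; apply: cvgB; first exact: cvg_fst.
    exact: cvg_cst.
  exact: (continuous_compose cf cLz).
pose kap := Phi z / 2.
have kap0 : 0 < kap by rewrite divr_gt0// subr_gt0.
pose U := [set z' | kap < Phi z'] `&` [set z' : E * Om | enorm z'.1 < R1 + 1].
have oU : open U.
  apply: openI.
    by move/continuousP : cPhi => /(_ _ (@open_gt R kap)).
  have /continuousP H := continuous_compose (@continuous_fst E Om) (@continuous_enorm R n).
  exact: (H _ (@open_lt R (R1 + 1))).
apply: (@support_avoids U z oU _ sz); last first.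
  split; first by rewrite /= /kap ltr_pdivrMr// ltr_pMr ?ltr1n// subr_gt0.
  by rewrite /=; apply: le_lt_trans (support_bounded sz) _; rewrite ltrDl.
have [M3 M30 HM3] := lagrangian_bounded cO LP (R1 + 1 + s * enorm h).
pose M4 := s * B ^+ 2 + B * (C + C * M3).
have kap2 : 0 < kap / 2 by rewrite divr_gt0.
apply: (@null_open_set U (kap / 2) D1 (Num.max (Num.max 1 c) (M4 / (kap / 2)))) => // k.
rewrite !ge_max => /andP[/andP[k1 ck] kM].
have k0 : 0 < k by exact: lt_le_trans k1.
have [phi [P rP]] := reg k0 ck.
exists (defect phi P k); split.
- exact: defect_dominated.
- by move=> z'; exact: defect_ge0.
- move=> [v w] [/= hPhi vR]; have [_ _ phige phile _ _ phisc phisub] := rP.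
  have h1 := phisub (v - s *: h) w.
  have h2 := phisc w h; have h3 := phige (tau h w); have h4 := phile w.
  have vsh : enorm (v - s *: h) <= R1 + 1 + s * enorm h.
    apply: le_trans (ler_enormB _ _) _; rewrite enormZ gtr0_norm// lerD2r.
    exact: ltW.
  have h5 := HM3 _ w vsh.
  have Bk : 0 <= B / k by rewrite divr_ge0// ltW.
  have h6 : B / k * (C + C * L 0 (v - s *: h) w) <= B / k * (C + C * M3).
    by rewrite ler_wpM2l// lerD2l ler_wpM2l.
  have h7 : 0 <= B / k * (C + C * L 0 v w).
    apply: mulr_ge0 => //; apply: addr_ge0 => //; apply: mulr_ge0 => //.
    exact: (Lz0 (v, w)).
  have h8 : s * (B ^+ 2 / k) + B / k * (C + C * M3) <= kap / 2.
    have -> : s * (B ^+ 2 / k) + B / k * (C + C * M3) = M4 / k.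
      by rewrite /M4; field; rewrite gt_eqF.
    by rewrite ler_pdivrMr// mulrC -ler_pdivrMr.
  have h9 : s * (u (tau h w) - u w - B ^+ 2 / k - c * enorm h ^+ 2) <= s * dotv h (P w).
    by rewrite ler_pM2l//; lra.
  rewrite /defect /Lz /=; move: hPhi; rewrite /Phi /=.
  rewrite dotvDl dotvNl dotvZl in h1.
  move: h1 h6 h7 h8 h9.
  move: (B / k * (C + C * L 0 (v - s *: h) w)) (B / k * (C + C * L 0 v w)).
  move: (B / k * (C + C * M3)) (B ^+ 2 / k) (c * enorm h ^+ 2).
  move: (L 0 (v - s *: h) w) (L 0 v w) (dotv v (P w)) (dotv h (P w)) (alpha * phi w).
  move=> x1 x2 x3 x4 x5 x6 x7 x8 x9 x10 h1 h6 h7 h8 h9 h10; lra.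
- exact: mean_defect_le.
Qed.

Let lam := 1 + alpha.
Let C2 := CH * (1 + lam ^+ 2) + 2 * c * lam.

(** Add the subsolution inequalities at tau_h w and tau_(-h) w and subtract the
    near equality at w.  The velocities v + lam h and v - lam h make appear
    - lam h.(P(tau_h w) - P(tau_(-h) w)), which semiconcavity bounds below by
    - lam times the second difference of phi up to O(|h|^2); with lam = 1 + alpha this still leaves
    a coefficient - 1 after the zero order term has taken alpha times the second
    difference. *)
Lemma second_difference_defect k phi P v w h M :
  1 <= k -> regularized tau L u alpha B c C k phi P ->
  enorm v <= R1 -> enorm h <= 1 -> lam * enorm h <= 1 ->
  (forall v' w', enorm v' <= R1 + 1 -> L 0 v' w' <= M) ->
  - (phi (tau h w) + phi (tau (- h) w) - 2 * phi w) <=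
    dotv v (P (tau h w) + P (tau (- h) w) - (2 : R) *: P w) +
    2 * defect phi P k (v, w) + 2 * (B / k * (C + C * M)) + C2 * enorm h ^+ 2.
Proof.
move=> k1 [_ _ _ _ _ _ phisc phisub] vR h1 lh HM.
have k0 : 0 < k by exact: lt_le_trans k1.
have Bk : 0 <= B / k by rewrite divr_ge0// ltW.
have lam0 : 0 <= lam by apply: addr_ge0 => //; exact: ltW.
pose xi := lam *: h.
have xi1 : enorm xi <= 1 by rewrite enormZ ger0_norm.
have e1 v' w' : enorm v' <= R1 + 1 ->
    B / k * (C + C * L 0 v' w') <= B / k * (C + C * M).
  by move=> v'R; rewrite ler_wpM2l// lerD2l ler_wpM2l// HM.
have a1 := phisub (v + xi) (tau h w).
have a2 := phisub (v - xi) (tau (- h) w).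
have b1 : B / k * (C + C * L 0 (v + xi) (tau h w)) <= B / k * (C + C * M).
  by apply: e1; apply: le_trans (ler_enormD _ _) _; exact: lerD.
have b2 : B / k * (C + C * L 0 (v - xi) (tau (- h) w)) <= B / k * (C + C * M).
  by apply: e1; apply: le_trans (ler_enormB _ _) _; exact: lerD.
have b3 : 0 <= B / k * (C + C * L 0 v w).
  apply: mulr_ge0 => //; apply: addr_ge0 => //; apply: mulr_ge0 => //.
  exact: (Lz0 (v, w)).
have c1 := LCH w vR h1 xi1.
have d1 := phisc (tau h w) (- h); rewrite tauK// in d1.
have d2 := phisc (tau (- h) w) h.
rewrite -(tauD tauP) subrr tau0// in d2.
have xiE : enorm xi ^+ 2 = lam ^+ 2 * enorm h ^+ 2.
  by rewrite enormZ exprMn ger0_norm.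
rewrite xiE in c1.
rewrite dotvDl /xi dotvZl in a1; rewrite dotvDl dotvNl /xi dotvZl in a2.
rewrite dotvNl enormN in d1.
have d3 : lam * (2 * phi w) <= lam * (phi (tau h w) - dotv h (P (tau h w)) +
    phi (tau (- h) w) + dotv h (P (tau (- h) w)) + 2 * c * enorm h ^+ 2).
  by apply: ler_wpM2l => //; lra.
rewrite /defect /Lz /= !dotvDr dotvNr dotvZr /C2.
move: a1 a2 b1 b2 b3 c1 d3; rewrite -/xi /lam.
move: (L 0 (v + xi) _) (L 0 (v - xi) _) (L 0 v w).
move: (dotv v (P (tau h w))) (dotv v (P (tau (- h) w))) (dotv v (P w)).
move: (dotv h (P (tau h w))) (dotv h (P (tau (- h) w))).
move: (phi (tau h w)) (phi (tau (- h) w)) (phi w) (enorm h ^+ 2) (B / k).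
move=> f1 f2 f3 q bk p1 p2 p3 p4 p5 l1 l2 l3; lra.
Qed.

(** Let q be the excess of the second difference g of phi below - C2 |h|^2.
    Multiplying [second_difference_defect] by q bounds q^2 by q v.Q, plus terms of
    mean O(1/k).  As q Q is the gradient of - q^2 / 2 composed with g, the first
    term has mean zero, so the mean of q^2 tends to zero. *)
Lemma support_lower z h : msupport mu z -> enorm h <= 1 -> lam * enorm h <= 1 ->
  - (C2 * enorm h ^+ 2) <= u (tau h z.2) + u (tau (- h) z.2) - 2 * u z.2.
Proof.
move=> sz h1 lh; rewrite leNgt; apply/negP => lt.
pose T := C2 * enorm h ^+ 2.
pose D w := u (tau h w) + u (tau (- h) w) - 2 * u w.
have cD : continuous D.
  apply: continuous_sub; last first.
    by apply: continuous_mul => //; exact: continuous_cst.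
  have ct x := continuous_compose (continuous_tau tauP (x := x)) cu.
  by apply: continuous_add; exact: ct.
pose kap := (- T - D z.2) / 3.
have kap0 : 0 < kap by rewrite divr_gt0// /T /D; lra.
pose U := [set z : E * Om | D z.2 < - T - 2 * kap].
have oU : open U.
  have /continuousP H := continuous_compose (@continuous_snd E Om) cD.
  exact: (H _ (@open_lt R _)).
have Dz : D z.2 = - T - 3 * kap by rewrite /kap; field.
apply: (@support_avoids U z oU _ sz); last by rewrite /U /= Dz; lra.
have [M M0 HM] := lagrangian_bounded cO LP (R1 + 1).
pose Qm := 2 * B * enorm h + 2 * B ^+ 2.
have Qm0 : 0 <= Qm by rewrite /Qm addr_ge0// ?mulr_ge0 ?enorm_ge0 ?sqr_ge0.
pose M' := Qm ^+ 2 + 8 * B * Qm.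
have M'0 : 0 <= M' by rewrite addr_ge0 ?sqr_ge0// !mulr_ge0.
pose M5 := (2 * Qm + M') * D1 + 2 * Qm * (B * (C + C * M)).
apply: (@null_open_set U (kap ^+ 2) M5
  (Num.max (Num.max 1 c) (2 * B ^+ 2 / kap))) => //; first by rewrite exprn_gt0.
move=> k; rewrite !ge_max => /andP[/andP[k1 ck] kM].
have k0 : 0 < k by exact: lt_le_trans k1.
have [phi [P rP]] := reg k0 ck.
have [cphi [K K0 ex] phige phile phil gradP phisc phisub] := rP.
pose g w := phi (tau h w) + phi (tau (- h) w) - 2 * phi w.
pose Q w := P (tau h w) + P (tau (- h) w) - (2 : R) *: P w.
pose q w := excess T (g w).
have cg : continuous g.
  apply: continuous_sub; last first.
    by apply: continuous_mul => //; exact: continuous_cst.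
  have ct x := continuous_compose (continuous_tau tauP (x := x)) cphi.
  by apply: continuous_add; exact: ct.
have cP := orbit_expansion_continuous tauP ex cphi.
have cexc : continuous (excess T).
  move=> x; apply: (@continuous_max R R (fun=> 0) (fun s => - T - s)).
    exact: cvg_cst.
  by apply: cvgB; [exact: cvg_cst|exact: cvg_id].
have cq : continuous q by exact: (continuous_compose cg cexc).
have Bk2 : B ^+ 2 / k <= B ^+ 2 by rewrite ler_pdivrMr// ler_peMr// sqr_ge0.
have gD w : g w <= D w + 2 * (B ^+ 2 / k).
  by have := phile (tau h w); have := phile (tau (- h) w); have := phige w; rewrite /g /D; lra.
have qQm w : q w <= Qm.
  rewrite /q /excess ge_max Qm0 /=.
  have := phige (tau h w); have := phige (tau (- h) w); have := phile w.
  have := uB w h; have := uB w (- h); rewrite enormN !ler_norml => /andP[? _] /andP[? _].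
  have T0 : 0 <= T.
    rewrite /T /C2 mulr_ge0 ?sqr_ge0// addr_ge0// !mulr_ge0 ?addr_ge0 ?sqr_ge0//.
    by rewrite ltW.
  rewrite /Qm /g; lra.
have q0 w : 0 <= q w by exact: excess_ge0.
have gex := second_difference_expansion tauP h ex.
have glip w x : `|g (tau x w) - g w| <= 4 * B * enorm x.
  have := phil (tau h w) x; have := phil (tau (- h) w) x; have := phil w x.
  rewrite /g !(tauAC tauP _ x) !ler_norml => /andP[? ?] /andP[? ?] /andP[? ?].
  by apply/andP; split; lra.
have K4 : 0 <= 4 * K by rewrite mulr_ge0.
have fex := excess_expansion K4 gex glip qQm.
have cf : continuous (fun w => - excess T (g w) ^+ 2 / 2).
  apply: continuous_mul; last exact: continuous_cst.
  by move=> w; apply: cvgN; apply: (continuous_mul cq cq).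
have zero := mean_velocity_gradient cf fex.
have cqQ := orbit_expansion_continuous tauP fex cf.
exists (fun z => q z.2 ^+ 2); split.
- by apply: (@dominated_base (fun w => q w ^+ 2)); exact: (continuous_mul cq cq).
- by move=> z'; exact: sqr_ge0.
- move=> z' Uz'; rewrite ler_sqr ?nnegrE//; last exact: ltW.
  rewrite /q /excess le_max; apply/orP; right.
  have := gD z'.2; move: Uz'; rewrite /U /= => Uz'.
  have : 2 * (B ^+ 2 / k) <= kap.
    by rewrite mulrA ler_pdivrMr// [kap * k]mulrC -ler_pdivrMr.
  lra.
have Bk0 : 0 <= B / k by rewrite divr_ge0// ltW.
pose e' := B / k * (C + C * M).
have e'0 : 0 <= e' by rewrite mulr_ge0// addr_ge0// mulr_ge0.
have dd := defect_dominated rP.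
have ptw z' : q z'.2 ^+ 2 <= dotv z'.1 (q z'.2 *: Q z'.2) +
    ((2 * Qm + M') * defect phi P k z' + 2 * Qm * e').
  case: z' => v w /=; rewrite dotvZr.
  have d0 := defect_ge0 (v, w) rP.
  have [vR|vR] := leP (enorm v) R1.
    have H := second_difference_defect w k1 rP vR h1 lh HM.
    rewrite -/(g w) -/(Q w) -/e' -/T in H.
    have qE : q w ^+ 2 = q w * (- T - g w).
      rewrite /q /excess maxEle; case: ifPn => // _.
      by rewrite mul0r expr0n.
    have h2 : q w * (- T - g w) <= q w * (dotv v (Q w) + 2 * defect phi P k (v, w) + 2 * e').
      by apply: ler_wpM2l => //; lra.
    have h3 := ler_wpM2r d0 (qQm w).
    have h4 := ler_wpM2r e'0 (qQm w).
    have h5 := mulr_ge0 M'0 d0.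
    rewrite qE; lra.
  have H := defect_large w k1 rP (ltW vR).
  have QB : enorm (Q w) <= 8 * B.
    apply: le_trans (ler_enormB _ _) _; rewrite enormZ ger0_norm//.
    have := ler_enormD (P (tau h w)) (P (tau (- h) w)).
    have := gradP (tau h w); have := gradP (tau (- h) w); have := gradP w; lra.
  have h2 : - dotv v (Q w) <= enorm v * (8 * B).
    rewrite -dotvNl; apply: le_trans (dotv_le_enorm _ _) _.
    by rewrite enormN ler_wpM2l// enorm_ge0.
  have h3 : - (q w * dotv v (Q w)) <= Qm * (enorm v * (8 * B)).
    rewrite -mulrN; apply: (@le_trans _ _ (q w * (enorm v * (8 * B)))).
      by rewrite ler_wpM2l.
    by rewrite ler_wpM2r// !mulr_ge0 ?enorm_ge0.
  have h4 : q w ^+ 2 <= Qm ^+ 2 by rewrite ler_sqr ?nnegrE.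
  have h5 := ler_wpM2l M'0 H.
  have h6 := mulr_ge0 Qm0 d0.
  have h7 := mulr_ge0 Qm0 e'0.
  have h8 := enorm_ge0 v.
  have h9 := mulr_ge0 (sqr_ge0 Qm) h8.
  have h10 : 0 <= 8 * B * Qm by rewrite !mulr_ge0.
  rewrite /M' in h5 *; lra.
have dQ := dominated_velocity cqQ.
have de : dominated (fun=> 2 * Qm * e').
  by apply: (@dominated_base (fun=> 2 * Qm * e')); exact: continuous_cst.
have dm := dominatedZ (2 * Qm + M') dd.
have dq2 : dominated (fun z' => q z'.2 ^+ 2).
  by apply: (@dominated_base (fun w => q w ^+ 2)); exact: (continuous_mul cq cq).
have := mean_le dq2 (dominatedD dQ (dominatedD dm de)) ptw.
rewrite (meanD dQ (dominatedD dm de)) zero (meanD dm de) (meanZ _ dd) mean_cst add0r.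
move/le_trans; apply.
have -> : M5 / k = (2 * Qm + M') * (D1 / k) + 2 * Qm * e'.
  by rewrite /M5 /e'; field; rewrite gt_eqF.
rewrite lerD2r ler_wpM2l ?mean_defect_le//.
by rewrite addr_ge0// mulr_ge0.
Qed.

End MatherSupport.

(** * Lipschitz dependence of the velocity *)

Section LipschitzSupport.
Variables (R : realType) (n : nat) (Om : pmetricType R).
Variable tau : 'rV[R]_n -> Om -> Om.
Variable L : 'rV[R]_n -> 'rV[R]_n -> Om -> R.
Hypothesis cO : compact [set: Om].
Hypothesis tauP : continuous_action tau.
Hypothesis LP : admissible_lagrangian tau L.
Local Notation E := 'rV[R]_n.

Local Notation DL w p v := ('D_p (fun v' => L 0 v' w) v).

Lemma derive_lagrangianD v w p q : DL w (p + q) v = DL w p v + DL w q v.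
Proof. by rewrite -[p]scale1r (derive_lagrangian_linear LP) scale1r mul1r. Qed.

Lemma derive_lagrangian0 v w : DL w 0 v = 0.
Proof. by have := derive_lagrangianD v w 0 0; rewrite addr0; lra. Qed.

Lemma derive_lagrangianZ v w (a : R) p : DL w (a *: p) v = a * DL w p v.
Proof.
by rewrite -[a *: p]addr0 (derive_lagrangian_linear LP) derive_lagrangian0 addr0.
Qed.

Lemma derive_lagrangianN v w p : DL w (- p) v = - DL w p v.
Proof. by rewrite -scaleN1r derive_lagrangianZ mulN1r. Qed.

(** Divide by s and let s tend to zero. *)
Lemma derive_lagrangian_ge v w h (X : R) :
  (forall s, 0 < s -> s * X <= L 0 (v - s *: h) w - L 0 v w) -> X <= - DL w h v.
Proof.
move=> H; rewrite -derive_lagrangianN.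
have dL : derivable (fun v => L 0 v w) v (- h) by exact: (derivable_lagrangian LP).
rewrite leNgt; apply/negP => lt.
move/cvgrPdist_lt : dL => /(_ (X - DL w (- h) v)).
rewrite subr_gt0 => /(_ lt); rewrite -/(DL w (- h) v).
move=> /nbhs_ballP[r /= r0 Hr].
have r2 : 0 < r / 2 by rewrite divr_gt0.
have br : ball (0 : R) r (r / 2).
  by rewrite /ball /= sub0r normrN gtr0_norm//; lra.
have := Hr _ br (lt0r_neq0 r2); have := H _ r2.
rewrite scalerN [- _ + v]addrC.
move: (DL w (- h) v) lt (L 0 (v - _) w - L 0 v w) => d lt l; rewrite /GRing.scale /=.
rewrite -ler_pdivlMl// => h1; rewrite ltr_norml => /andP[h2 _]; lra.
Qed.


Section TwoSided.
Variables (u : Om -> R) (S : set (E * Om)) (c C2 h0 : R).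
Hypothesis S_upper : forall z h s, S z -> 0 < s ->
  s * (u (tau h z.2) - u z.2 - c * enorm h ^+ 2) <=
    L 0 (z.1 - s *: h) z.2 - L 0 z.1 z.2.
Hypothesis S_lower : forall z h, S z -> enorm h <= h0 ->
  - (C2 * enorm h ^+ 2) <= u (tau h z.2) + u (tau (- h) z.2) - 2 * u z.2.

(** The limit of [support_upper] as s tends to zero. *)
Lemma support_taylor_le z h : S z ->
  u (tau h z.2) - u z.2 <= - DL z.2 h z.1 + c * enorm h ^+ 2.
Proof.
move=> Sz; rewrite -lerBlDr; apply: derive_lagrangian_ge => s s0.
exact: S_upper.
Qed.

Lemma support_taylor_ge z h : S z -> enorm h <= h0 ->
  - DL z.2 h z.1 - (c + C2) * enorm h ^+ 2 <= u (tau h z.2) - u z.2.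
Proof.
move=> Sz hh; have := S_lower Sz hh.
have := support_taylor_le (- h) Sz; rewrite derive_lagrangianN enormN; lra.
Qed.

(** Both routes from w to tau_(h + y) w are used: the upper bound for the
    direct one, the lower bounds for its two stages.  The slopes along y
    cancel. *)
Lemma support_difference_le v1 v2 w y h : 0 <= c ->
  S (v1, w) -> S (v2, tau y w) -> enorm y <= h0 -> enorm h <= h0 ->
  DL w h v1 - DL (tau y w) h v2 <= (3 * c + C2) * (enorm y ^+ 2 + enorm h ^+ 2).
Proof.
move=> c0 S1 S2 yh hh.
have /= a1 := support_taylor_le (h + y) S1.
have /= a2 := support_taylor_ge S1 yh.
have /= a3 := support_taylor_ge S2 hh.
have a4 := ler_wpM2l c0 (sqr_enormD_le h y).
rewrite derive_lagrangianD (tauD tauP) in a1; lra.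
Qed.

End TwoSided.

(** Take h = s (v1 - v2) in [support_difference_le].  Uniform convexity bounds
    the left-hand side below by s g |v1 - v2|^2 up to O(|y| |v1 - v2|), and for small
    s this dominates the quadratic remainder in h.  The constant depends on
    neither u nor the set, which makes it uniform in the discount. *)
Lemma support_lipschitz (R1 c C2 h0 : R) :
  1 <= R1 -> 0 <= c -> 0 <= C2 -> 0 < h0 <= 1 ->
  exists2 C5, 0 <= C5 & forall (u : Om -> R) (S : set (E * Om)),
  (forall z, S z -> enorm z.1 <= R1) ->
  (forall z h s, S z -> 0 < s -> s * (u (tau h z.2) - u z.2 - c * enorm h ^+ 2) <=
    L 0 (z.1 - s *: h) z.2 - L 0 z.1 z.2) ->
  (forall z h, S z -> enorm h <= h0 ->
    - (C2 * enorm h ^+ 2) <= u (tau h z.2) + u (tau (- h) z.2) - 2 * u z.2) ->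
  forall v1 v2 w y, S (v1, w) -> S (v2, tau y w) -> enorm (v1 - v2) <= C5 * enorm y.
Proof.
move=> R11 c0 C20 /andP[h00 h01].
have [g g0 Hg] := derive_lagrangian_monotone cO LP R1.
have [C3 C30 HC3] := derive_lagrangian_lipschitz cO LP R1.
pose K3 := 3 * c + C2; have K30 : 0 <= K3 by rewrite addr_ge0// mulr_ge0.
(* The first bound absorbs K3 |s d|^2 into a quarter of s g |d|^2; the second
   keeps |s d| at most h0, as |d| <= 2 R1. *)
pose s := Num.min (g / (4 * K3 + 1)) (h0 / (2 * R1)).
have R10 : 0 < 2 * R1 by lra.
have K31 : 0 < 4 * K3 + 1 by lra.
have s0 : 0 < s by rewrite lt_min !divr_gt0.
have sK : s * (4 * K3 + 1) <= g by rewrite -ler_pdivlMr// ge_min lexx.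
have sR : s * (2 * R1) <= h0 by rewrite -ler_pdivlMr// ge_min lexx orbT.
pose Q := 2 / (s * g) * (K3 + s * C3 ^+ 2 / g).
have sg : 0 < s * g by rewrite mulr_gt0.
have Q0 : 0 <= Q.
  apply: mulr_ge0; first by apply: divr_ge0 => //; exact: ltW.
  apply: addr_ge0 => //; apply: divr_ge0; last exact: ltW.
  by apply: mulr_ge0; [exact: ltW|exact: sqr_ge0].
have R1h : 0 <= 2 * R1 / h0 by apply: divr_ge0; exact: ltW.
exists (1 + Q + 2 * R1 / h0); first by lra.
move=> u S Sb Su Sl v1 v2 w y S1 S2.
have b1 := Sb _ S1; have b2 := Sb _ S2; rewrite /= in b1 b2.
have db : enorm (v1 - v2) <= 2 * R1 by apply: le_trans (ler_enormB _ _) _; lra.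
have y0 := enorm_ge0 y.
have [yh|hy] := leP (enorm y) h0; last first.
  have h1 : 2 * R1 <= 2 * R1 / h0 * enorm y.
    by rewrite mulrAC ler_pdivlMr// ler_pM2l// ltW.
  have h2 := mulr_ge0 Q0 y0.
  apply: le_trans db _; apply: le_trans h1 _.
  by rewrite [leRHS]mulrDl mulrDl lerDr; lra.
have sd : enorm (s *: (v1 - v2)) <= h0.
  rewrite enormZ ger0_norm; last exact: ltW.
  by apply: le_trans sR; rewrite ler_pM2l.
have a1 := support_difference_le Su Sl c0 S1 S2 yh sd.
rewrite !derive_lagrangianZ -mulrBr in a1.
have a2 := Hg v1 v2 w b1 b2.
have yR : enorm y <= R1 by lra.
have := HC3 v2 y (v1 - v2) w b2 yR; rewrite ler_norml => /andP[_ a3].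
rewrite enormZ ger0_norm in a1; last exact: ltW.
apply: (@le_trans _ _ ((1 + Q) * enorm y)); last by rewrite ler_wpM2r//; lra.
rewrite -ler_sqr ?nnegrE ?enorm_ge0//; last by rewrite mulr_ge0//; lra.
rewrite -/K3 in a1.
have d0 := enorm_ge0 (v1 - v2).
move: a1 a2 a3.
move: (DL w _ v1) (DL w _ v2) (DL (tau y w) _ v2) => p1 p2 p3.
move: (enorm (v1 - v2)) (enorm y) d0 y0 => d e d0 e0 a1 a2 a3.
have b3 : s * (g * d ^+ 2 - C3 * e * d) <= K3 * (e ^+ 2 + (s * d) ^+ 2).
  by apply: le_trans a1; rewrite ler_pM2l//; lra.
have b4 : s * K3 * d ^+ 2 <= g / 4 * d ^+ 2 by rewrite ler_wpM2r ?sqr_ge0//; lra.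
(* Young's inequality absorbs another quarter. *)
have b5 : C3 * e * d <= g / 4 * d ^+ 2 + C3 ^+ 2 / g * e ^+ 2.
  rewrite -subr_ge0; have -> : g / 4 * d ^+ 2 + C3 ^+ 2 / g * e ^+ 2 - C3 * e * d =
      (g / 2 * d - C3 * e) ^+ 2 / g by field; rewrite gt_eqF.
  by rewrite divr_ge0 ?sqr_ge0// ltW.
have b6 : s * (g / 2 * d ^+ 2) <= (K3 + s * C3 ^+ 2 / g) * e ^+ 2.
  have b4' := ler_wpM2l (ltW s0) b4; have b5' := ler_wpM2l (ltW s0) b5.
  have -> : (K3 + s * C3 ^+ 2 / g) * e ^+ 2 =
      K3 * e ^+ 2 + s * (C3 ^+ 2 / g * e ^+ 2) by ring.
  have e1 : K3 * (e ^+ 2 + (s * d) ^+ 2) = K3 * e ^+ 2 + s * (s * K3 * d ^+ 2) by ring.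
  rewrite e1 mulrBr in b3; rewrite mulrDr in b5'.
  have e2 : s * (g * d ^+ 2) = s * (g / 2 * d ^+ 2) + s * (g / 4 * d ^+ 2) + s * (g / 4 * d ^+ 2) by field.
  move: b3 b4' b5'; rewrite e2.
  move: (s * (g / 2 * d ^+ 2)) (s * (g / 4 * d ^+ 2)) (s * (C3 * e * d))
    (s * (s * K3 * d ^+ 2)) (s * (C3 ^+ 2 / g * e ^+ 2)) (K3 * e ^+ 2).
  by move=> *; lra.
have b7 : d ^+ 2 <= Q * e ^+ 2.
  have -> : Q * e ^+ 2 = (K3 + s * C3 ^+ 2 / g) * e ^+ 2 / (s * g / 2).
    by rewrite /Q; field; rewrite !gt_eqF.
  rewrite ler_pdivlMr; last by rewrite divr_gt0.
  by move: b6; move: (_ * e ^+ 2) => z; lra.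
apply: le_trans b7 _; rewrite exprMn ler_wpM2r ?sqr_ge0//.
by have := sqr_ge0 Q; lra.
Qed.

End LipschitzSupport.

(** * Extension off the support *)

Section LipschitzGraph.
Variables (R : realType) (n : nat) (Om : pmetricType R).
Variable tau : 'rV[R]_n -> Om -> Om.
Hypothesis tauP : continuous_action tau.
Local Notation E := 'rV[R]_n.
Variables (S : set (E * Om)) (K : R).
Hypotheses (K0 : 0 <= K) (S_lip : forall v1 v2 w y,
  S (v1, w) -> S (v2, tau y w) -> enorm (v1 - v2) <= K * enorm y).

(** The McShane extension along orbits: each coordinate is the largest function
    with the given Lipschitz constant that agrees with the data.  On orbits that
    do not meet the set this is empty and the infimum is a default value. *)
Definition extension_values (i : 'I_n) (w : Om) : set R :=
  [set x | exists v w' y, [/\ S (v, w'), tau y w' = w & x = v 0 i + K * enorm y]].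

Definition extension (w : Om) : E := \row_i inf (extension_values i w).

Lemma extension_values_ge i v w y x : S (v, w) -> extension_values i (tau y w) x ->
  v 0 i - K * enorm y <= x.
Proof.
move=> Sv [v' [w' [y' [Sv' yE ->]]]].
have w'E : w' = tau (y - y') w by rewrite addrC tauD// -yE tauK.
rewrite w'E in Sv'.
have := S_lip Sv Sv'; have := normr_coord_le (v - v') i; rewrite !mxE.
have := ler_wpM2l K0 (ler_enormB y y'); have := ler_norm (v 0 i - v' 0 i); lra.
Qed.

Lemma extension_bounds v w y i : S (v, w) ->
  v 0 i - K * enorm y <= extension (tau y w) 0 i <= v 0 i + K * enorm y.
Proof.
move=> Sv; rewrite mxE; apply/andP; split.
  apply: lb_le_inf; first by exists (v 0 i + K * enorm y), v, w, y.
  by move=> x; exact: extension_values_ge.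
apply: ge_inf; last by exists v, w, y.
by exists (v 0 i - K * enorm y) => x; exact: extension_values_ge.
Qed.

Lemma extension_support v w : S (v, w) -> extension w = v.
Proof.
move=> Sv; apply/rowP => i; have := extension_bounds 0 i Sv.
by rewrite tau0// enorm0 mulr0 subr0 addr0 => /le_anti.
Qed.

(** The factor n comes from extending the coordinates separately. *)
Lemma lipschitz_graph : exists V : Om -> E,
  S = [set z : E * Om | (snd @` S) z.2 /\ z.1 = V z.2] /\
  forall w y, (snd @` S) w -> enorm (V (tau y w) - V w) <= n%:R * K * enorm y.
Proof.
exists extension; split.
  apply/seteqP; split => -[v w] /=.
    by move=> Sv; split; [exists (v, w)|rewrite (extension_support Sv)].
  by move=> [[[v' w'] Sv /= <-] ->]; rewrite (extension_support Sv).
move=> w y [[v w'] Sv /= <-]; apply: le_trans (enorm_le_sum _) _.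
rewrite -mulrA mulr_natl -[X in _ *+ X]card_ord -sumr_const; apply: ler_sum => i _.
have := extension_bounds y i Sv; rewrite (extension_support Sv) !mxE ler_norml => /andP[? ?].
by apply/andP; split; lra.
Qed.

End LipschitzGraph.

(** * Constants uniform in the discount *)

Section UniformConstant.
Variables (R : realType) (n : nat) (Om : pmetricType R).
Variable tau : 'rV[R]_n -> Om -> Om.
Variable L : 'rV[R]_n -> 'rV[R]_n -> Om -> R.
Hypothesis cO : compact [set: Om].
Hypothesis tauP : continuous_action tau.
Hypothesis LP : admissible_lagrangian tau L.
Local Notation E := 'rV[R]_n.

Lemma lagrangian_superlinear1 (K : R) : exists2 r : R, 1 <= r &
  forall v w, r <= enorm v -> K * enorm v <= L 0 v w.
Proof.
have [r r0 Hr] := lagrangian_superlinear cO LP K.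
exists (Num.max r 1); first by rewrite le_max lexx orbT.
by move=> v w; rewrite ge_max => /andP[rv _]; exact: Hr.
Qed.

Lemma lagrangian_second_difference1 (r : R) : 1 <= r -> exists2 C : R, 0 <= C &
  forall v h xi w, enorm v <= r -> enorm h <= 1 -> enorm xi <= 1 ->
  L 0 (v + xi) (tau h w) + L 0 (v - xi) (tau (- h) w) - 2 * L 0 v w <=
    C * (enorm h ^+ 2 + enorm xi ^+ 2).
Proof.
move=> r1; have [C C0 HC] := lagrangian_second_difference cO LP r.
by exists C => // v h xi w vr h1 x1; apply: HC => //; exact: le_trans r1.
Qed.

Lemma lagrangian_oscillation : exists2 C : R, 0 <= C & forall x v w,
  L 0 v (tau x w) <= L 0 v w + enorm x * (C + C * L 0 v w).
Proof.
case: LP => _ _ _ [L0 [C HC] LS]; exists `|C| => // x v w.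
have := HC 0 x v w; rewrite add0r -{1}[x]add0r LS -lerBlDl => /le_trans; apply.
rewrite ler_wpM2l ?enorm_ge0// lerD ?ler_norm// ler_wpM2r//; exact: ler_norm.
Qed.

(** Minimality against the competitors of [competitor]. *)
Lemma mather_action_le (alpha A : R) (u : Om -> R) nu mu :
  0 < alpha -> (forall w, L 0 0 w <= A) -> continuous u ->
  (forall w e, 0 < e -> exists2 l, path_ok l & path_cost tau L alpha A l w < u w + e) ->
  discounted_mather tau L alpha nu mu ->
  (action L mu <= alpha%:E * \int[nu]_w (u w)%:E)%E.
Proof.
move=> alpha0 LA cu Ju [_ mu_min]; apply/lee_addgt0Pr => e e0.
have [mu' [mu'C mu'A]] := competitor cO tauP LP alpha0 LA cu Ju nu e0.
exact: le_trans (mu_min _ mu'C) mu'A.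
Qed.

(** Every constant below is chosen from L and a alone, before the discount. *)
Lemma uniform_lipschitz_graph (a : R) : 0 < a -> exists C : R,
  forall (alpha : R) (nu : probability (borel Om) R)
    (mu : probability (borel (E * Om)%type) R),
  0 < alpha <= a -> discounted_mather tau L alpha nu mu -> holonomic tau nu mu ->
  exists V : Om -> E,
    msupport mu = [set z : E * Om | (snd @` msupport mu) z.2 /\ z.1 = V z.2] /\
    forall (w : Om) (y : E), (snd @` msupport mu) w ->
      enorm (V (tau y w) - V w) <= C * enorm y.
Proof.
move=> a0.
have [C C0 LC] := lagrangian_oscillation.
have [A A0 LA'] := lagrangian_bounded cO LP 0.
have LA w : L 0 0 w <= A by apply: LA'; rewrite enorm0.
have [B B0 LB] := lagrangian_bounded cO LP 1.
have [R0 R01 LR] := lagrangian_superlinear1 (expR a * B).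
have [CR CR0 LCR] := lagrangian_second_difference1 R01.
pose A' := A + a * B ^+ 2.
have A'0 : 0 <= A' by apply: addr_ge0 => //; rewrite mulr_ge0 ?sqr_ge0// ltW.
have [R1 R11 LR1] := lagrangian_superlinear1 (2 * B + A' + 2).
have [CH CH0 LCH] := lagrangian_second_difference1 R11.
pose c := 2 * B + 2 * CR.
have c0 : 0 <= c by apply: addr_ge0; exact: mulr_ge0.
pose C2 := CH * (1 + (1 + a) ^+ 2) + 2 * c * (1 + a).
have a1 : 0 < 1 + a by rewrite addr_gt0.
have C20 : 0 <= C2.
  apply: addr_ge0; apply: mulr_ge0; rewrite ?(ltW a1)//; last exact: mulr_ge0.
  by rewrite addr_ge0 ?sqr_ge0.
have h01 : 0 < (1 + a)^-1 <= 1.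
  by rewrite invr_gt0 a1 invf_le1// lerDl ltW.
have [K K0 HK] := support_lipschitz cO tauP LP R11 c0 C20 h01.
exists (n%:R * K) => alpha nu mu /andP[alpha0 alphaa] muM muH.
apply: (lipschitz_graph tauP K0).
pose u := value tau L alpha A.
have cu : continuous u by exact: (value_continuous cO tauP LP alpha0 alphaa LA B0 LB R01 LR).
have uB w y : `|u (tau y w) - u w| <= B * enorm y.
  exact: (value_lipschitz tauP LP alpha0 LA B0 LB).
have uc w y : u (tau y w) + u (tau (- y) w) - 2 * u w <= c * enorm y ^+ 2.
  exact: (value_semiconcave tauP LP alpha0 alphaa LA B0 LB R01 LR CR0 LCR).
have u0 w : 0 <= u w by exact: (value_ge0 tauP LP alpha0 LA).
have usub := value_subsolution tauP LP alpha0 LA.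
have L0 v w : 0 <= L 0 v w by exact: (lagrangian_ge0 LP).
have reg := regularization tauP alpha0 cu B0 c0 u0 uB uc usub L0 C0 LC.
have uA w : alpha * (u w + B ^+ 2) <= A'.
  rewrite mulrDr; apply: lerD; first exact: (alpha_value_le tauP LP alpha0 LA).
  by rewrite ler_wpM2r// sqr_ge0.
have muA : (action L mu <= alpha%:E * \int[nu]_w (u w)%:E)%E.
  apply: (mather_action_le alpha0 LA cu _ muM) => w e.
  exact: (value_adherent tauP LP alpha0 LA).
have muC := proj1 muM.
apply: (HK u).
- by move=> z; exact: (support_bounded cO tauP LP alpha0 cu B0 reg C0 A'0 uA R11 LR1 muC muH muA).
- by move=> z h s; exact: (support_upper cO tauP LP alpha0 cu B0 reg C0 A'0 uA R11 LR1 muC muH muA).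
- move=> z h Sz hh.
  have eh := enorm_ge0 h.
  have h1 : enorm h <= 1 by apply: le_trans hh _; case/andP: h01.
  have hl : (1 + a) * enorm h <= 1.
    by rewrite mulrC -ler_pdivlMr// mul1r.
  have hal : (1 + alpha) * enorm h <= 1.
    by apply: le_trans hl; rewrite ler_wpM2r// lerD2l.
  have := support_lower cO tauP LP alpha0 cu B0 c0 uB reg C0 A'0 uA R11 LR1 CH0 LCH
    muC muH muA Sz h1 hal.
  apply: le_trans.
  rewrite lerN2 ler_wpM2r ?sqr_ge0// lerD//.
    by rewrite ler_wpM2l// lerD2l ler_sqr ?nnegrE ?lerD2l ?addr_ge0// ltW.
  by rewrite ler_wpM2l ?lerD2l// mulr_ge0.
Qed.

End UniformConstant.

Theorem corollary15 (R : realType) (n : nat) (Om : pmetricType R)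
    (tau : 'rV[R]_n -> Om -> Om) (L : 'rV[R]_n -> 'rV[R]_n -> Om -> R) :
  compact [set: Om] ->
  continuous_action tau ->
  uniformly_transitive tau ->
  admissible_lagrangian tau L ->
  exists C : R -> R,
    (exists M : R, \forall alpha \near 0^'+, `|C alpha| <= M) /\
    forall (alpha : R) (nu : probability (borel Om) R)
        (mu : probability (borel ('rV[R]_n * Om)%type) R),
      0 < alpha ->
      discounted_mather tau L alpha nu mu ->
      holonomic tau nu mu ->
      exists V : Om -> 'rV[R]_n,
        msupport mu =
          [set z : 'rV[R]_n * Om | (snd @` msupport mu) z.2 /\ z.1 = V z.2] /\
        forall (w : Om) (y : 'rV[R]_n), (snd @` msupport mu) w ->
          enorm (V (tau y w) - V w) <= C alpha * enorm y.
Proof.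
move=> cO tauP _ LP.
have maxP (b : R) : 0 < Num.max b 1 by rewrite lt_max ltr01 orbT.
have [f Hf] := choice (fun b => uniform_lipschitz_graph cO tauP LP (maxP b)).
(* The constant of the larger discount max(alpha, 1) serves alpha, and it is
   the same for all alpha <= 1. *)
exists (fun alpha => f (Num.max alpha 1)); split; last first.
  move=> alpha nu mu alpha0; apply: Hf; rewrite alpha0 /= !le_max lexx //.
exists `|f 1|; near=> alpha.
rewrite (max_idPr _)//; near: alpha; exact: nbhs_right_le.
Unshelve. all: by end_near.
Qed.
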